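(* Let $F\subseteq[-1/2,1/2]$ be a fat Cantor set of positive length, and set $$K=\{z\in\mathbb{C}:\ \mathrm{Re}(z)\in F,\ \mathrm{Im}(z)\in[-1/2,1/2]\}.$$ Then there is a Swiss cheese set $X$ with $K\subseteq X$ such that every point of $X\setminus K$ is a point of continuity and an R-point for $R(X)$, every point in $K$ is a non-R-point and a point of discontinuity for $R(X)$, and $R(X)$ has no non-trivial Jensen measures.
   Context: A fat Cantor set is a compact subset of $\mathbb{R}$ that is nowhere dense and has positive length (one-dimensional Lebesgue measure). A compact plane set is a non-empty compact subset of $\mathbb{C}$. A Swiss cheese set is a compact plane set obtained by deleting a sequence of open discs from a closed disc. For a compact plane set $X$, $C(X)$ denotes the algebra of all continuous functions $X\to\mathbb{C}$, and $R(X)$ denotes the set of all $f\in C(X)$ which can be uniformly approximated on $X$ by rational functions with no poles on $X$. With the uniform norm, $R(X)$ is a uniform algebra which is natural on $X$: its only characters are the evaluations at points of $X$, and points of $X$ are identified with these characters. For $x\in X$, let $J_x$ be the ideal of all $f\in R(X)$ such that $x$ lies in the interior (relative to $X$) of the zero set $f^{-1}(\{0\})$, and let $M_x=\{f\in R(X): f(x)=0\}$. A point $x\in X$ is a point of continuity for $R(X)$ if for all $y\in X\setminus\{x\}$ we have $J_y\not\subseteq M_x$; otherwise it is a point of discontinuity. A point $x\in X$ is an R-point for $R(X)$ if for all $y\in X\setminus\{x\}$ we have $J_x\not\subseteq M_y$; otherwise it is a non-R-point. A representing measure for $x\in X$ (with respect to $R(X)$) is a regular Borel probability measure $\mu$ on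 $X$ with $f(x)=\int_X f\,d\mu$ for all $f\in R(X)$. A Jensen measure for $x$ is a representing measure $\mu$ for $x$ such that $\log|f(x)|\le\int_X\log|f(w)|\,d\mu(w)$ for all $f\in R(X)$, where $\log(0):=-\infty$. Such a measure is trivial if it is the point mass at $x$. ''$R(X)$ has no non-trivial Jensen measures'' means that, for every $x\in X$, every Jensen measure for $x$ is trivial. *)

(* Defs.v *)
From HB Require Import structures.
From mathcomp Require Import all_boot all_order all_algebra.
From mathcomp Require Import all_classical all_reals all_analysis.
From mathcomp Require Import complex.

Set Implicit Arguments.
Unset Strict Implicit.
Unset Printing Implicit Defensive.

Import Order.TTheory GRing.Theory Num.Theory.
Import numFieldNormedType.Exports.

Local Open Scope classical_set_scope.
Local Open Scope ring_scope.
Local Open Scope complex_scope.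

(* The norm on R[i] takes its values in R[i] itself; the topology is the one
   induced by that norm, so that balls for radii r%:C are Euclidean discs. *)
HB.instance Definition _ (R : realType) := NormedModule.copy R[i] R[i]^o.

(* The modulus as an element of R. *)
Definition modulus (R : realType) (z : R[i]) : R := complex.Re `|z|.

Definition borelC (R : realType) := g_sigma_algebraType (@open R[i]).

Definition nowhere_dense (T : topologicalType) (A : set T) :=
  (closure A)° = set0.

Definition fat_cantor_set (R : realType) (F : set R) :=
  [/\ compact F, nowhere_dense F & (0 < lebesgue_measure F)%E].

Section UniformAlgebra.
Variable R : realType.
Local Notation C := R[i].
Implicit Types (X : set C) (x y : C) (f : C -> C).

Definition open_disc (a : C) (r : R) : set C := [set z | modulus (z - a) < r].

Definition closed_disc (a : C) (r : R) : set C :=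
  [set z | modulus (z - a) <= r].

Definition compact_plane_set X := X !=set0 /\ compact X.

Definition swiss_cheese_set X :=
  compact_plane_set X /\
  exists (a0 : C) (r0 : R) (a : nat -> C) (r : nat -> R),
    [/\ 0 < r0, forall n, 0 < r n &
        X = closed_disc a0 r0 `\` \bigcup_n open_disc (a n) (r n)].

(* A function on X is represented by a function on the whole plane; everything
   below depends only on its values on X. *)
Definition CX X : set (C -> C) := [set f | {within X, continuous f}].

Definition RX X : set (C -> C) :=
  [set f | CX X f /\
    forall e : R, 0 < e -> exists p q : {poly C},
      (forall z, X z -> q.[z] != 0) /\
      (forall z, X z -> modulus (f z - p.[z] / q.[z]) < e)].

Definition Jideal X x : set (C -> C) :=
  [set f | RX X f /\ \forall z \near within X (nbhs x), f z = 0].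

Definition Mideal X x : set (C -> C) := [set f | RX X f /\ f x = 0].

Definition point_of_continuity X x :=
  X x /\ forall y, (X `\ x) y -> ~ (Jideal X y `<=` Mideal X x).

Definition point_of_discontinuity X x := X x /\ ~ point_of_continuity X x.

Definition R_point X x :=
  X x /\ forall y, (X `\ x) y -> ~ (Jideal X x `<=` Mideal X y).

Definition non_R_point X x := X x /\ ~ R_point X x.

Definition regular_measure (mu : probability (borelC R) R) :=
  forall A : set (borelC R), measurable A ->
    mu A = ereal_inf [set mu U | U in [set U : set C | open U /\ A `<=` U]] /\
    mu A = ereal_sup [set mu L | L in [set L : set C | compact L /\ L `<=` A]].

Definition Cintegral (mu : probability (borelC R) R) X f : C :=
  (\int[mu]_(w in X) complex.Re (f w)) +i*
  (\int[mu]_(w in X) complex.Im (f w)).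

(* A probability measure on X is a probability measure on the plane that is
   carried by X. *)
Definition representing_measure X x (mu : probability (borelC R) R) :=
  [/\ mu X = 1%E, regular_measure mu &
      forall f, RX X f -> f x = Cintegral mu X f].

(* lne 0 = -oo, and log |f| is bounded above on X, so that the integral below
   is well defined in [-oo, +oo[. *)
Definition Jensen_measure X x (mu : probability (borelC R) R) :=
  representing_measure X x mu /\
  forall f, RX X f ->
    (lne (modulus (f x))%:E <= \int[mu]_(w in X) lne (modulus (f w))%:E)%E.

Definition trivial_measure x (mu : probability (borelC R) R) :=
  forall A : set (borelC R), measurable A -> mu A = \d_(x : borelC R) A.

Definition no_nontrivial_Jensen_measures X :=
  forall x, X x -> forall mu : probability (borelC R) R,
    Jensen_measure X x mu -> trivial_measure x mu.

End UniformAlgebra.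

(* Main.v *)
Require Import Defs.
From mathcomp Require Import all_boot all_order all_algebra.
From mathcomp Require Import all_classical all_reals all_analysis.
From mathcomp Require Import complex measurable_realfun.
From mathcomp Require Import ring lra zify.

Import Order.TTheory GRing.Theory Num.Theory.
Import numFieldNormedType.Exports.

Local Open Scope classical_set_scope.
Local Open Scope ring_scope.

Set Implicit Arguments.
Unset Strict Implicit.
Unset Printing Implicit Defensive.

(** Consider the discs [B_n] with rational centre and radius whose boundary circle
misses [K].  Near each of these circles, discs of very small total radius are
deleted so that some [f_n] in [R(X)] vanishes on [X] outside [B_n] and has no
zero in [X] inside [B_n] ([mckissick]).  Two points of [X] that are not on a
common vertical segment of [K] are separated by some [B_n]
([strip_separated]): by a small disc around a point off [K], or by a huge disc,
almost a half-plane, whose boundary passes through a gap of the Cantor set or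
above or below the strip.  So every point off [K] is a point of continuity and
an R-point.  If [mu] is a Jensen measure for [x] and [x] is in [B_n], then
[mu] has no mass outside [B_n], as the integral of [log |f_n|] would be [-oo]
([jensen_null_zero]).  Hence [mu] is carried by [x] if [x] is off [K], and by
the vertical segment of [K] through [x] otherwise; on this segment the modulus
of [1 + (z - x) ^ 2 / 4] is maximal at [x] only, and Jensen's inequality forces
[mu] to be the point mass ([jensen_null_peak]).

It remains to see that a function of [R(X)] that vanishes near a point of [K]
vanishes on the vertical segment of [K] through this point
([unique_on_segment]).  The distance [s_n] from [K] of the discs deleted near
the [n]-th circle is known before their total radius is chosen, so this radius
can be tiny in terms of [s_0], ..., [s_n].  By the Cauchy formula, a rational
function with poles off [X] and bounded by [M] on [X] is, on [K], a function
analytic and bounded at distance [d_N = min (s_0, ..., s_N)] from [K], up to an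
error of [M] times the sum over [n > N] of total radius / [s_n]
([cauchy_decomposition]).  Smallness of the analytic part on a short
subsegment propagates to the whole segment, with a loss that depends on [N]
only ([propagation]), and the radii of the levels after [N] are so small that
the error survives this loss.  Letting [N] go to infinity gives the claim.

Integrals over circles are replaced by averages over [2 ^ m]-th roots of
unity, which are explicit by the partial fraction expansion of
[1 / (1 - b ^ (2 ^ m))] ([sum_dyadic_roots]); the same expansion bounds the
factors of the product that defines [f_n]. *)

(** * Modulus and topology of the plane *)

Section Modulus.
Variable R : realType.
Local Notation C := R[i].
Local Open Scope complex_scope.
Implicit Types (x y z : C) (r : R).

Lemma modulusE z : modulus z = Num.sqrt (complex.Re z ^+ 2 + complex.Im z ^+ 2).
Proof. by case: z. Qed.

Lemma modulus_norm z : (modulus z)%:C = `|z|.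
Proof. by []. Qed.

Lemma modulus_ge0 z : 0 <= modulus z.
Proof. by rewrite modulusE sqrtr_ge0. Qed.

Lemma modulusM x y : modulus (x * y) = modulus x * modulus y.
Proof. exact: Normc.normcM. Qed.

Lemma modulusV x : modulus x^-1 = (modulus x)^-1.
Proof. exact: Normc.normcV. Qed.

Lemma modulusN x : modulus (- x) = modulus x.
Proof. exact: normcN. Qed.

Lemma modulusBC x y : modulus (x - y) = modulus (y - x).
Proof. by rewrite -modulusN opprB. Qed.

Lemma ler_modulusD x y : modulus (x + y) <= modulus x + modulus y.
Proof. exact: le_normcD. Qed.

Lemma modulus0 : modulus (0 : C) = 0.
Proof. exact: Normc.normc0. Qed.

Lemma modulus1 : modulus (1 : C) = 1.
Proof. exact: Normc.normc1. Qed.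

Lemma modulus_eq0 z : (modulus z == 0) = (z == 0).
Proof.
apply/eqP/eqP => [/Normc.eq0_normc //|->]; exact: modulus0.
Qed.

Lemma modulus_gt0 z : (0 < modulus z) = (z != 0).
Proof. by rewrite lt_neqAle modulus_ge0 andbT eq_sym modulus_eq0. Qed.

Lemma modulusX z n : modulus (z ^+ n) = modulus z ^+ n.
Proof. by elim: n => [|n IH]; rewrite ?expr0 ?modulus1 // !exprS modulusM IH. Qed.

Lemma modulus_real r : modulus r%:C = `|r|.
Proof. by rewrite modulusE /= expr0n addr0 sqrtr_sqr. Qed.

Lemma modulus_nat n : modulus (n%:R : C) = n%:R.
Proof. by rewrite -(rmorph_nat (real_complex R)) modulus_real normr_nat. Qed.

Lemma sqr_modulus z : modulus z ^+ 2 = complex.Re z ^+ 2 + complex.Im z ^+ 2.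
Proof. by rewrite modulusE sqr_sqrtr // addr_ge0 // sqr_ge0. Qed.

Lemma ler_Re_modulus z : `|complex.Re z| <= modulus z.
Proof.
rewrite -(@ler_pXn2r _ 2) ?nnegrE ?modulus_ge0 // sqr_modulus real_normK ?num_real //.
by rewrite lerDl sqr_ge0.
Qed.

Lemma ler_Im_modulus z : `|complex.Im z| <= modulus z.
Proof.
rewrite -(@ler_pXn2r _ 2) ?nnegrE ?modulus_ge0 // sqr_modulus real_normK ?num_real //.
by rewrite lerDr sqr_ge0.
Qed.

Lemma modulus_le_ReIm z : modulus z <= `|complex.Re z| + `|complex.Im z|.
Proof.
rewrite -(@ler_pXn2r _ 2) ?nnegrE ?addr_ge0 ?modulus_ge0 // sqr_modulus.
rewrite sqrrD !real_normK ?num_real // -addrA lerD2l lerDr.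
by rewrite mulrn_wge0 // mulr_ge0.
Qed.

Lemma ler_modulusB x y : modulus x - modulus y <= modulus (x - y).
Proof. by rewrite lerBlDr -{1}(subrK y x) ler_modulusD. Qed.

Lemma ler_modulus_distD y x z : modulus (x - z) <= modulus (x - y) + modulus (y - z).
Proof. by rewrite -(subrKA y) ler_modulusD. Qed.

Lemma ler_modulus_sum (I : Type) (s : seq I) (P : pred I) (F : I -> C) :
  modulus (\sum_(i <- s | P i) F i) <= \sum_(i <- s | P i) modulus (F i).
Proof.
elim/big_ind2: _ => [|x1 x2 y1 y2 h1 h2|//]; first by rewrite modulus0.
by rewrite (le_trans (ler_modulusD _ _)) // lerD.
Qed.

Lemma modulus_prod (I : Type) (s : seq I) (P : pred I) (F : I -> C) :
  modulus (\prod_(i <- s | P i) F i) = \prod_(i <- s | P i) modulus (F i).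
Proof. by elim/big_ind2: _ => [|x1 ? y1 ? <- <-|//]; rewrite ?modulus1 ?modulusM. Qed.

Lemma modulusfV x y : modulus (x / y) = modulus x / modulus y.
Proof. by rewrite modulusM modulusV. Qed.

Lemma ReB x y : complex.Re (x - y) = complex.Re x - complex.Re y.
Proof. by case: x y => [? ?] []. Qed.

Lemma ImB x y : complex.Im (x - y) = complex.Im x - complex.Im y.
Proof. by case: x y => [? ?] []. Qed.

End Modulus.

Section PlaneTopology.
Variable R : realType.
Local Notation C := R[i].
Local Open Scope complex_scope.
Implicit Types (x y z : C) (r : R) (X A : set C).

Lemma nbhs_modulusP x A :
  nbhs x A <-> exists2 e : R, 0 < e & forall y, modulus (y - x) < e -> A y.
Proof.
split=> [/nbhs_ballP [e /= e0 h]|[e e0 h]].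
  have eE : e = (complex.Re e)%:C.
    by move: e0; rewrite ltcE => /andP[/eqP]; case: (e) => [a b] /= ->.
  exists (complex.Re e); first by move: e0; rewrite ltcE => /andP[].
  move=> y hy; apply: h; rewrite -ball_normE /ball_ /=.
  by rewrite eE -modulus_norm ltcR modulusBC.
apply/nbhs_ballP; exists e%:C => /=; first by rewrite ltcR.
by move=> y; rewrite -ball_normE /ball_ /= -modulus_norm ltcR modulusBC => /h.
Qed.

Lemma open_modulusP A :
  open A <-> forall x, A x -> exists2 e : R, 0 < e & forall y, modulus (y - x) < e -> A y.
Proof.
rewrite openE; split=> h x /h; rewrite /interior; first by move/nbhs_modulusP.
by move=> ?; apply/nbhs_modulusP.
Qed.

Lemma within_nbhsP (T : topologicalType) X (f : C -> T) :
  {within X, continuous f} <->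
  (forall x, X x -> forall B, nbhs (f x) B -> exists2 d : R, 0 < d &
     forall y, X y -> modulus (y - x) < d -> B (f y)).
Proof.
split=> [/subspace_continuousP h x Xx B fB|h].
  have /nbhs_modulusP[d d0 hd] : nbhs x [set y | X y -> B (f y)] := h x Xx B fB.
  by exists d => // y Xy /hd; apply.
apply/subspace_continuousP => x Xx B /(h x Xx) [d d0 hd].
suff : nbhs x [set y | X y -> B (f y)] by [].
by apply/nbhs_modulusP; exists d => // y yd Xy; exact: hd.
Qed.

Lemma within_modulusP X (f : C -> C) :
  {within X, continuous f} <->
  (forall x, X x -> forall e : R, 0 < e -> exists2 d : R, 0 < d &
     forall y, X y -> modulus (y - x) < d -> modulus (f y - f x) < e).
Proof.
rewrite within_nbhsP; split=> h x Xx.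
  move=> e e0; have [|d d0 hd] := h x Xx [set w | modulus (w - f x) < e].
    by apply/nbhs_modulusP; exists e.
  by exists d.
move=> A /nbhs_modulusP[e e0 hA]; have [d d0 hd] := h x Xx e e0.
by exists d => // y Xy yd; apply: hA; exact: hd.
Qed.

Lemma continuous_modulusP (T : topologicalType) (f : C -> T) :
  (forall x B, nbhs (f x) B -> exists2 d : R, 0 < d &
     forall y, modulus (y - x) < d -> B (f y)) -> continuous f.
Proof. by move=> h x B /h; rewrite -nbhs_modulusP. Qed.

Lemma continuous_Re : continuous (@complex.Re R).
Proof.
apply: continuous_modulusP => x A /nbhs_ballP[e e0 hA]; exists e => // y yx.
apply: hA; rewrite -ball_normE /ball_ /= distrC -ReB.
exact: le_lt_trans (ler_Re_modulus _) yx.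
Qed.

Lemma continuous_Im : continuous (@complex.Im R).
Proof.
apply: continuous_modulusP => x A /nbhs_ballP[e e0 hA]; exists e => // y yx.
apply: hA; rewrite -ball_normE /ball_ /= distrC -ImB.
exact: le_lt_trans (ler_Im_modulus _) yx.
Qed.

Lemma continuous_modulus : continuous (@modulus R).
Proof.
apply: continuous_modulusP => x A /nbhs_ballP[e e0 hA]; exists e => // y yx.
apply: hA; rewrite -ball_normE /ball_ /= ltr_norml; apply/andP; split.
  rewrite ltrNl opprB (le_lt_trans (ler_modulusB _ _)) //.
by rewrite (le_lt_trans (ler_modulusB _ _)) // modulusBC.
Qed.

Lemma open_open_disc x r : open (open_disc x r).
Proof.
apply/open_modulusP => y /= yx; exists (r - modulus (y - x)); first by rewrite subr_gt0.
move=> z zy; rewrite /open_disc /= (le_lt_trans (ler_modulus_distD y _ _)) //.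
by rewrite -ltrBrDr.
Qed.

Lemma closed_closed_disc x r : closed (closed_disc x r).
Proof.
rewrite -openC; apply/open_modulusP => y /negP; rewrite -ltNge => yx.
exists (modulus (y - x) - r); first by rewrite subr_gt0.
move=> z zy; apply/negP; rewrite -ltNge.
have := ler_modulus_distD z y x; rewrite (modulusBC y z); lra.
Qed.

Lemma compact_plane_box r : compact [set z : C | `|complex.Re z| <= r /\ `|complex.Im z| <= r].
Proof.
have -> : [set z : C | `|complex.Re z| <= r /\ `|complex.Im z| <= r] =
    (fun p : R * R => p.1 +i* p.2) @` (`[-r, r] `*` `[-r, r]).
  apply/seteqP; split=> [[a b] /= [ha hb]|_ [[a b] /= [ha hb] <-]].
    by exists (a, b) => //=; rewrite !in_itv /= -!ler_norml.
  by move: ha hb; rewrite !in_itv /= -!ler_norml.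
apply: continuous_compact; last exact: compact_setX (@segment_compact _ _ _) (@segment_compact _ _ _).
apply: continuous_subspaceT => -[a b] A /nbhs_modulusP[e e0 hA].
have e20 : 0 < e / 2 by rewrite divr_gt0.
exists (ball a (e/2), ball b (e/2)) => /=.
  by split; exact: nbhsx_ballx.
move=> [u v] /= [hu hv]; apply: hA; rewrite (le_lt_trans (modulus_le_ReIm _)) //=.
by move: hu hv; rewrite -ball_normE /ball_ /= => hu hv; rewrite (splitr e) ltrD // distrC.
Qed.

Lemma closed_bounded_compact A (r : R) : closed A -> (forall z, A z -> modulus z <= r) -> compact A.
Proof.
move=> cA hA; apply: (subclosed_compact cA (@compact_plane_box r)) => z /hA h.
by split; apply: le_trans h; rewrite ?ler_Re_modulus ?ler_Im_modulus.
Qed.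

(** The sequences [u n - 2 c / 2 ^ n] and [u n + 2 c / 2 ^ n] are monotone and
enclose the limit, which is therefore the supremum of the first one. *)
Lemma geometric_limit_real (u : nat -> R) (c : R) : 
  (forall n, `|u n.+1 - u n| <= c / 2 ^+ n) ->
  exists l, forall n, `|u n - l| <= 2 * c / 2 ^+ n.
Proof.
move=> h.
have half n : c / 2 ^+ n.+1 = c / 2 ^+ n / 2 by rewrite exprS invfM mulrCA mulrC.
pose v n := u n - 2 * c / 2 ^+ n; pose w n := u n + 2 * c / 2 ^+ n.
have vS n : v n <= v n.+1.
  by move: (h n); rewrite /v -!mulrA half ler_norml => /andP[]; lra.
have wS n : w n.+1 <= w n.
  by move: (h n); rewrite /w -!mulrA half ler_norml => /andP[]; lra.
have c0 n : 0 <= c / 2 ^+ n by exact: le_trans (h n).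
have vw n : v n <= w n by have := c0 n; rewrite /v /w -!mulrA; lra.
have vm : {homo v : m n / (m <= n)%N >-> m <= n} by apply: homo_leq => //; exact: le_trans.
have wm n m : (n <= m)%N -> w m <= w n.
  by elim: m => [|m IH]; rewrite leq_eqVlt => /predU1P[<-//|] // /IH; apply: le_trans.
have vw' n m : v n <= w m.
  by case: (leqP n m) => [nm|/ltnW nm]; [rewrite (le_trans (vm _ _ nm))|rewrite (le_trans (vw n)) // wm].
have ub : has_sup (range v).
  by split; [exists (v 0), 0|exists (w 0) => _ [n _ <-]].
exists (sup (range v)) => n.
have h1 : v n <= sup (range v) by apply: ub_le_sup; [exact: ub.2|exists n].
have h2 : sup (range v) <= w n by apply: ge_sup; [exact: ub.1|move=> _ [m _ <-]].
by move: h1 h2; rewrite /v /w ler_norml; lra.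
Qed.

Lemma geometric_limit (u : nat -> C) (c : R) :
  (forall n, modulus (u n.+1 - u n) <= c / 2 ^+ n) ->
  exists l, forall n, modulus (u n - l) <= 4 * c / 2 ^+ n.
Proof.
move=> h.
have [n|a ha] := @geometric_limit_real (fun n => complex.Re (u n)) c.
  by rewrite -ReB (le_trans (ler_Re_modulus _)).
have [n|b hb] := @geometric_limit_real (fun n => complex.Im (u n)) c.
  by rewrite -ImB (le_trans (ler_Im_modulus _)).
exists (a +i* b) => n; rewrite (le_trans (modulus_le_ReIm _)) // ReB ImB /=.
by move: (ha n) (hb n); rewrite -!mulrA; lra.
Qed.

End PlaneTopology.

(** * Uniform limits of rational functions *)

Section RationalApproximation.
Variable R : realType.
Local Notation C := R[i].
Local Open Scope complex_scope.
Implicit Types (x y z : C) (X : set C).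

Lemma continuous_poly (p : {poly C}) : continuous (fun z : C => p.[z]).
Proof.
elim/poly_ind: p => [|p c IH].
  have -> : (fun z : C => (0 : {poly C}).[z]) = fun=> 0 by apply/funext => z; rewrite horner0.
  exact: cst_continuous.
have -> : (fun z : C => (p * 'X + c%:P).[z]) = fun z => p.[z] * z + c.
  by apply/funext => z; rewrite hornerMXaddC.
move=> x; apply: (@continuousD C C C (fun z : C => p.[z] * z) (fun=> c) x); last exact: cst_continuous.
by apply: continuousM; [exact: IH|exact: cvg_id].
Qed.

Lemma continuous_rational (p q : {poly C}) x : q.[x] != 0 ->
  {for x, continuous (fun z : C => p.[z] / q.[z])}.
Proof.
move=> qx; apply: continuousM; first exact: continuous_poly.
by apply: continuousV => //; exact: continuous_poly.
Qed.

(** Continuity is inherited from the approximating rational functions, so that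
membership in [RX] only requires the approximation. *)
Lemma RX_of_rational_approx X (f : C -> C) :
  (forall e : R, 0 < e -> exists p q : {poly C},
      (forall z, X z -> q.[z] != 0) /\
      (forall z, X z -> modulus (f z - p.[z] / q.[z]) < e)) -> RX X f.
Proof.
move=> h; split=> //; apply/within_modulusP => x Xx e e0.
have e30 : 0 < e / 3 by rewrite divr_gt0.
have [p [q [q0 fpq]]] := h _ e30.
have /(_ [set w | modulus (w - p.[x] / q.[x]) < e / 3]) := continuous_rational (p:=p) (q0 x Xx).
rewrite /= => /(_ _) /nbhs_modulusP[|d d0 hd].
  by apply/nbhs_modulusP; exists (e/3).
exists d => // y Xy yx; have h1 := fpq _ Xx; have h2 := fpq _ Xy; have h3 := hd _ yx.
have := ler_modulus_distD (p.[y] / q.[y]) (f y) (f x).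
have := ler_modulus_distD (p.[x] / q.[x]) (p.[y]/q.[y]) (f x).
move: h3; rewrite /= (modulusBC (p.[x] / q.[x]) (f x)) => h3; lra.
Qed.

Lemma RX_poly X (p : {poly C}) : RX X (fun z => p.[z]).
Proof.
apply: RX_of_rational_approx => e e0; exists p, 1; split=> z _; first by rewrite hornerC oner_eq0.
by rewrite hornerC divr1 subrr modulus0.
Qed.

End RationalApproximation.

(** * Averages over roots of unity of order a power of two *)

Section RootsOfUnity.
Variable R : realType.
Local Notation C := R[i].
Local Open Scope complex_scope.

(** The [2 ^ m]-th roots of unity, listed by the recursion
[1 - b ^ (2 N) = (1 - b ^ N) (1 - (zeta b) ^ N)] with [zeta ^ N = -1]. *)
Fixpoint dyadic_roots (m : nat) : seq C :=
  if m is m'.+1 then dyadic_roots m' ++ [seq (2 ^ m').-root (-1) * w | w <- dyadic_roots m']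
  else [:: 1].

Lemma size_dyadic_roots m : size (dyadic_roots m) = (2 ^ m)%N.
Proof. by elim: m => //= m IH; rewrite size_cat size_map IH expnS mul2n addnn. Qed.

Lemma rootN1 m : (2 ^ m).-root (-1 : C) ^+ (2 ^ m) = -1.
Proof. by rewrite rootCK // expn_gt0. Qed.

Lemma modulus_dyadic_roots m w : w \in dyadic_roots m -> modulus w = 1.
Proof.
elim: m w => [|m IH] w /=; first by rewrite inE => /eqP ->; exact: modulus1.
rewrite mem_cat => /orP[/IH//|/mapP[v /IH v1 ->]].
rewrite modulusM v1 mulr1; apply/eqP; rewrite -(@pexpr_eq1 _ _ (2 ^ m)) ?modulus_ge0 ?expn_gt0 //.
by rewrite -modulusX rootN1 modulusN modulus1.
Qed.

(** The partial fraction expansion of [1 / (1 - b ^ N)].  It serves twice: it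
bounds the factors of the McKissick product, and it evaluates averages over
circles. *)
Lemma sum_dyadic_roots m (b : C) : (forall w, w \in dyadic_roots m -> 1 - w * b != 0) ->
  1 - b ^+ (2 ^ m) != 0 /\
  \sum_(w <- dyadic_roots m) (1 - w * b)^-1 = (2 ^ m)%:R / (1 - b ^+ (2 ^ m)).
Proof.
elim: m b => [|m IH] b /= hb.
  have := hb 1; rewrite inE eqxx mul1r => /(_ isT) b1.
  by rewrite expn0 expr1 big_seq1 !mul1r.
have [|h1 s1] := IH b; first by move=> w hw; apply: hb; rewrite mem_cat hw.
have [|h2 s2] := IH ((2 ^ m).-root (-1) * b).
  move=> w hw; have := hb ((2 ^ m).-root (-1) * w); rewrite mem_cat map_f // orbT => /(_ isT).
  by rewrite mulrCA mulrA mulrAC mulrC mulrA.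
have hX : ((2 ^ m).-root (-1) * b) ^+ (2 ^ m) = - b ^+ (2 ^ m) by rewrite exprMn rootN1 mulN1r.
move: h2 s2; rewrite hX opprK => h2 s2.
have eX : b ^+ (2 ^ m.+1) = b ^+ (2 ^ m) ^+ 2 by rewrite -exprM expnS mulnC.
have fac : 1 - b ^+ (2 ^ m.+1) = (1 - b ^+ (2 ^ m)) * (1 + b ^+ (2 ^ m)) by rewrite eX; ring.
split; first by rewrite fac mulf_neq0.
rewrite big_cat big_map s1 fac /=.
under eq_bigr do rewrite -mulrA mulrCA.
rewrite s2 expnS natrM; field.
by rewrite h1 h2.
Qed.

(** Far from all the poles, [1 / (1 - b ^ N)] is bounded by the inverse of the
distance to the nearest one, because it is an average of the simple fractions
[1 / (1 - w b)]; no factor depending on [N] is lost. *)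
Lemma dyadic_roots_bound m (b : C) (d : R) : 0 < d ->
  (forall w, w \in dyadic_roots m -> d <= modulus (1 - w * b)) ->
  1 - b ^+ (2 ^ m) != 0 /\ modulus (1 - b ^+ (2 ^ m))^-1 <= d^-1.
Proof.
move=> d0 hb; have [|h0 hs] := @sum_dyadic_roots m b.
  by move=> w /hb h; rewrite -modulus_gt0 (lt_le_trans d0).
split=> //; have N0 : 0 < (2 ^ m)%:R :> R by rewrite ltr0n expn_gt0.
rewrite -(ler_pM2l N0) -{1}modulus_nat -modulusM -hs.
apply: le_trans (ler_modulus_sum _ _ _) _.
rewrite big_seq; apply: (@le_trans _ _ (\sum_(w <- dyadic_roots m | w \in dyadic_roots m) d^-1)).
  by apply: ler_sum => w /hb h; rewrite modulusV lef_pV2 ?posrE // (lt_le_trans d0).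
by rewrite -big_seq big_const_seq count_predT size_dyadic_roots iter_addr_0 mulr_natl.
Qed.

End RootsOfUnity.

(** * Functions that vanish exactly outside a disc *)

Section Products.
Variable R : realType.
Local Notation C := R[i].
Local Open Scope complex_scope.
(** An infinite product whose factors are at a given point of three kinds:
tiny ([<= alpha k]) up to some index, then possibly one factor of which only
the bound [1 / delta k] is known, then close to 1 (within [alpha k]).  As
[alpha k] is much smaller than [delta k.+1], the tiny factor before the
exceptional one compensates for it, and the partial products converge
uniformly. *)
Variables (alpha delta : nat -> R).
Hypothesis delta_gt0 : forall k, 0 < delta k.
Hypothesis delta_le1 : forall k, delta k <= 1.
Hypothesis alpha_le : forall k, alpha k <= delta k.+1 / 2 ^+ k.+2.

Variable h : nat -> C.
Hypothesis h_le : forall k, modulus (h k) <= (delta k)^-1.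
Hypothesis h_zone : forall k j, (k < j)%N ->
  modulus (h k) <= alpha k \/ modulus (h j - 1) <= alpha j.

Let F n := \prod_(k < n) h k.

Let FS n : F n.+1 = F n * h n.
Proof. by rewrite /F big_ord_recr. Qed.

Let pow2_gt0 n : 0 < 2 ^+ n :> R. Proof. exact: exprn_gt0. Qed.

Let alpha_le2 k : alpha k <= (2 ^+ k.+2)^-1.
Proof.
apply: le_trans (alpha_le k) _.
by rewrite ler_pdivrMr // mulVf ?delta_le1 // gt_eqF.
Qed.

Let alpha_le1 k : alpha k <= 1.
Proof. by apply: le_trans (alpha_le2 k) _; rewrite invf_le1 // exprn_ege1 // ler1n. Qed.

Let zoneP n : (forall k, (k < n)%N -> modulus (h k) <= alpha k) \/
  modulus (h n - 1) <= alpha n.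
Proof.
have [|H] := pselect (forall k, (k < n)%N -> modulus (h k) <= alpha k); first by left.
right; apply: contrapT => hn; apply: H => k kn.
by case: (h_zone kn).
Qed.

Let small_F n : (forall k, (k < n.+1)%N -> modulus (h k) <= alpha k) ->
  modulus (F n.+1) <= alpha n.
Proof.
move=> H; rewrite FS modulusM -[leRHS]mul1r ler_pM ?modulus_ge0 ?H //.
rewrite /F modulus_prod; apply: prodr_ile1 => i _; rewrite modulus_ge0 /=.
by apply: le_trans (alpha_le1 i); apply: H; rewrite ltnS ltnW.
Qed.

Let F_le n : modulus (F n) <= (2 - (2 ^+ n)^-1) / delta 0.
Proof.
have d0 := delta_gt0 0; have d01 : 1 <= (delta 0)^-1 by rewrite invf_ge1.
elim: n => [|n IH].
  by rewrite /F big_ord0 modulus1 expr0 invr1; lra.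
rewrite FS modulusM; case: (zoneP n) => H.
  apply: (@le_trans _ _ (delta 0)^-1); last first.
    rewrite ler_peMl ?invr_ge0 ?(ltW d0) //.
    have : (2 ^+ n.+1)^-1 <= 1 :> R by rewrite invf_le1 // exprn_ege1 // ler1n.
    lra.
  case: n IH H => [|n] IH H; first by rewrite /F big_ord0 modulus1 mul1r.
  apply: le_trans (d01); rewrite -[leRHS](@mulfV _ (delta n.+1)) ?gt_eqF //.
  rewrite ler_pM ?modulus_ge0 //.
  apply: le_trans (small_F H) _; apply: le_trans (alpha_le n) _.
  by rewrite ler_piMr ?(ltW (delta_gt0 _)) // invf_le1 // exprn_ege1 // ler1n.
have hn : modulus (h n) <= 1 + (2 ^+ n.+2)^-1.
  have := ler_modulusB (h n) 1; rewrite modulus1 lerBlDl => /le_trans; apply.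
  by rewrite lerD2l (le_trans H).
apply: (@le_trans _ _ ((2 - (2 ^+ n)^-1) / delta 0 * (1 + (2 ^+ n.+2)^-1))).
  by rewrite ler_pM ?modulus_ge0.
rewrite mulrAC ler_pM2r ?invr_gt0 //.
rewrite !exprS !invfM; set t := (2 ^+ n)^-1.
have : 0 < t by rewrite invr_gt0.
nra.
Qed.

Lemma prod_step n : modulus (F n.+1 - F n) <= 2 / delta 0 / 2 ^+ n.
Proof.
have d0 := delta_gt0 0; have d01 : 1 <= (delta 0)^-1 by rewrite invf_ge1.
rewrite FS -{2}(mulr1 (F n)) -mulrBr modulusM; case: (zoneP n) => H; last first.
  apply: (@le_trans _ _ (2 / delta 0 * (2 ^+ n.+2)^-1)); last first.
    rewrite ler_pM2l ?divr_gt0 // lef_pV2 ?posrE // ler_eXn2l ?ltr1n //.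
    by rewrite -addn2 leq_addr.
  rewrite ler_pM ?modulus_ge0 // ?(le_trans H) //; apply: le_trans (F_le n) _.
  by rewrite ler_pM2r ?invr_gt0 // gerBl invr_ge0 ltW.
have hn : modulus (h n - 1) <= 2 / delta n.
  apply: le_trans (ler_modulusD _ _) _; rewrite modulusN modulus1.
  have : 1 <= (delta n)^-1 by rewrite invf_ge1.
  have := h_le n; lra.
case: n H hn => [|n] H hn.
  by rewrite /F big_ord0 modulus1 mul1r expr0 divr1.
apply: (@le_trans _ _ ((delta n.+1 / 2 ^+ n.+2) * (2 / delta n.+1))).
  by rewrite ler_pM ?modulus_ge0 // (le_trans (small_F H)).
have -> : delta n.+1 / 2 ^+ n.+2 * (2 / delta n.+1) = (2 ^+ n.+1)^-1.
  by rewrite [2 ^+ n.+2]exprS; field; rewrite expf_neq0 ?pnatr_eq0 //= gt_eqF.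
by rewrite ler_peMl ?invr_ge0 ?(ltW (pow2_gt0 _)) //; lra.
Qed.

Lemma prod_to_zero : (forall k, modulus (h k) <= alpha k) ->
  forall n, modulus (F n.+1) <= (2 ^+ n)^-1.
Proof.
move=> H n; apply: le_trans (small_F _) _ => //; apply: le_trans (alpha_le2 _) _.
by rewrite lef_pV2 ?posrE // ler_eXn2l ?ltr1n // -addn2 leq_addr.
Qed.

Lemma prod_bounded_below i : (forall k, (i < k)%N -> modulus (h k - 1) <= alpha k) ->
  forall n, modulus (F i.+1) / 2 <= modulus (F (i.+1 + n)).
Proof.
move=> H n.
suff : modulus (F i.+1) * (2^-1 + (2 ^+ n.+1)^-1) <= modulus (F (i.+1 + n)).
  apply: le_trans; rewrite ler_pM ?modulus_ge0 ?invr_ge0 // lerDl invr_ge0 ltW //.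
elim: n => [|n IH]; first by rewrite addn0 expr1; lra.
rewrite addnS (FS (i.+1 + n)) modulusM.
have hn : 1 - (2 ^+ n.+3)^-1 <= modulus (h (i.+1 + n)).
  have := ler_modulusB 1 (h (i.+1 + n)); rewrite modulus1 lerBlDr addrC -lerBlDr.
  apply: le_trans; rewrite lerD2l lerN2 modulusBC.
  apply: le_trans (H _ _) _; first by rewrite addSn ltnS leq_addr.
  apply: le_trans (alpha_le2 _) _.
  by rewrite lef_pV2 ?posrE // ler_eXn2l ?ltr1n // addSn !ltnS leq_addl.
apply: (@le_trans _ _ (modulus (F i.+1) * (2^-1 + (2 ^+ n.+1)^-1) * (1 - (2 ^+ n.+3)^-1))).
  rewrite -[leRHS]mulrA ler_wpM2l ?modulus_ge0 // !exprS !invfM; set t := (2 ^+ n)^-1.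
  have : 0 < t by rewrite invr_gt0.
  have : t <= 1 by rewrite /t invf_le1 // exprn_ege1 // ler1n.
  nra.
rewrite ler_pM //; first by rewrite mulr_ge0 ?modulus_ge0 // addr_ge0 ?invr_ge0 // ltW.
by rewrite subr_ge0 invf_le1 // exprn_ege1 // ler1n.
Qed.

(** If all the factors are tiny the product vanishes; if from some index on all
of them are close to 1, and none is zero, the product is not zero. *)
Lemma prod_limit : exists l : C,
  [/\ forall n, modulus (F n - l) <= 8 / delta 0 / 2 ^+ n,
      (forall k, modulus (h k) <= alpha k) -> l = 0 &
      forall i, (forall k, (i < k)%N -> modulus (h k - 1) <= alpha k) ->
        (forall k, h k != 0) -> l != 0].
Proof.
have [l hl] := geometric_limit prod_step.
have hl' n : modulus (F n - l) <= 8 / delta 0 / 2 ^+ n.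
  apply: le_trans (hl n) _; rewrite [4 * _]mulrA; lra.
have small e (c : R) : 0 < e -> 0 <= c -> exists n, forall m, (n <= m)%N -> c / 2 ^+ m < e.
  move=> e0 c0; exists (Num.trunc (c / e)).+1 => m nm.
  rewrite ltr_pdivrMr // -ltr_pdivrMl // mulrC.
  have h1 := truncnS_gt (c / e); apply: (lt_trans h1).
  apply: (@le_lt_trans _ _ m%:R); first by rewrite ler_nat.
  by rewrite -natrX ltr_nat ltn_expl.
have d0 := delta_gt0 0.
exists l; split=> //.
  move=> H; apply/eqP; rewrite -modulus_eq0; apply/eqP/le_anti; rewrite modulus_ge0 andbT.
  apply/ler_addgt0Pr => e e0; rewrite add0r.
  have [|n hn] := small e (8 / delta 0 + 2) e0; first by rewrite addr_ge0 // divr_ge0 // ltW.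
  have e2 : 2 / 2 ^+ n.+1 = (2 ^+ n)^-1 :> R by rewrite exprS invfM mulVKf ?pnatr_eq0.
  have := hn n.+1 (leqnSn n); rewrite mulrDl e2; have := hl' n.+1; have := prod_to_zero H n.
  have := ler_modulus_distD (F n.+1) l 0; rewrite !subr0 (modulusBC (F n.+1) l) -/(F n.+1).
  lra.
move=> i H h0; apply/eqP => l0.
have Fi : 0 < modulus (F i.+1).
  by rewrite modulus_gt0 /F; apply/prodf_neq0 => k _.
have [||n hn] := small (modulus (F i.+1) / 2) (8 / delta 0).
- by rewrite divr_gt0.
- by rewrite divr_ge0 // ltW.
have := hn (i.+1 + n)%N (leq_addl _ _); have := prod_bounded_below H n.
have := hl' (i.+1 + n)%N; rewrite l0 subr0; lra.
Qed.

End Products.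

Section McKissick.
Variable R : realType.
Local Notation C := R[i].
Local Open Scope complex_scope.

(** Bernoulli's inequality gives [(1 + y) ^ (2 ^ m) >= 2]; raise this to the
power [2 ^ L]. *)
Lemma bernoulli_pow2 (y : R) (m L : nat) : 0 <= y -> 1 <= y * 2 ^+ m ->
  2 ^+ (2 ^ L) <= (1 + y) ^+ (2 ^ (m + L)).
Proof.
move=> y0 ym.
have y2 : 2 <= (1 + y) ^+ (2 ^ m).
  apply: (@le_trans _ _ (1 + y *+ (2 ^ m))).
    by rewrite -(mulr_natr y) natrX; lra.
  elim: (2 ^ m)%N => [|n IH]; first by rewrite mulr0n expr0 addr0.
  rewrite exprS; apply: (@le_trans _ _ ((1 + y) * (1 + y *+ n))).
    have : 0 <= y *+ n by rewrite mulrn_wge0.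
    by rewrite mulrS; nra.
  by rewrite ler_wpM2l // addr_ge0.
rewrite expnD exprM; apply: lerXn2r => //; rewrite nnegrE //.
by rewrite exprn_ge0 // addr_ge0.
Qed.

Lemma exists_pow2_lt (e : R) : 0 < e -> exists n : nat, (2 ^+ n)^-1 <= e.
Proof.
move=> e0; exists (Num.trunc e^-1).+1.
rewrite -[leRHS]invrK lef_pV2 ?posrE ?invr_gt0 ?exprn_gt0 //.
apply/ltW/(lt_le_trans (truncnS_gt e^-1)).
by rewrite -natrX ler_nat ltnW // ltn_expl.
Qed.

Section Construction.
Variables (c : C) (rho : R) (j e : nat).
Hypothesis rho_gt0 : 0 < rho.
Hypothesis j3 : (3 <= j)%N.

(** The parameters of the product of the factors
[1 / (1 - ((z - c) / (rho * ring_rad k)) ^ (2 ^ ring_exp k))].  The radii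
[ring_rad k] increase to 1 at the rate [2 ^ - (k + j)], and the [k]-th factor
switches from 1 to 0 between [ring_mid (k - 1)] and [ring_mid k]; the exponent
is large enough for the error [ring_alpha k] to be doubly exponentially
small.  Around each pole on the [k]-th circle a disc of relative radius
[ring_delta k] is deleted; the total of these radii is of order [2 ^ - e].
The choice of [ring_p] makes [ring_alpha k] small compared with
[ring_delta k.+1]. *)
Definition ring_p := (e + j + 8)%N.
Definition ring_exp k := (k + j + (k + ring_p))%N.
Definition ring_rad k : R := 1 - 4 / 2 ^+ (k + j).
Definition ring_mid k : R := 1 - 3 / 2 ^+ (k + j).
Definition ring_delta k : R := (2 ^+ (e + k + ring_exp k))^-1.
Definition ring_alpha k : R := 2 / 2 ^+ (2 ^ (k + ring_p)).
Definition ring_centers k : seq C :=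
  [seq c + (rho * ring_rad k)%:C / w | w <- dyadic_roots R (ring_exp k)].
Definition ring_radius k : R := rho * ring_rad k * ring_delta k.
Definition ring_base (z : C) k : C := (z - c) / (rho * ring_rad k)%:C.
Definition ring_factor (z : C) k : C := (1 - ring_base z k ^+ (2 ^ ring_exp k))^-1.

Let t k : R := (2 ^+ (k + j))^-1.
Let t_gt0 k : 0 < t k. Proof. by rewrite /t invr_gt0 exprn_gt0. Qed.
Let tS k : t k.+1 = t k / 2. Proof. by rewrite /t addSn exprS invfM mulrC. Qed.
Let t_le8 k : t k <= 8^-1.
Proof.
rewrite /t lef_pV2 ?posrE ?exprn_gt0 //.
have -> : 8 = 2 ^+ 3 :> R by rewrite -natrX.
by rewrite ler_eXn2l ?ltr1n // (leq_trans j3) ?leq_addl.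
Qed.

Lemma ring_rad_gt0 k : 2^-1 <= ring_rad k.
Proof. have := t_le8 k; rewrite /ring_rad -/(t k); lra. Qed.

Lemma ring_rad_lt1 k : ring_rad k < 1.
Proof. by have := t_gt0 k; rewrite /ring_rad -/(t k); lra. Qed.

Let mid_homo k l : (k <= l)%N -> ring_mid k <= ring_mid l.
Proof.
move=> kl; rewrite lerD2l lerN2 ler_pM2l // lef_pV2 ?posrE ?exprn_gt0 //.
by rewrite ler_eXn2l ?ltr1n // leq_add2r.
Qed.

Lemma ring_delta_gt0 k : 0 < ring_delta k.
Proof. by rewrite invr_gt0 exprn_gt0. Qed.

Lemma ring_delta_le1 k : ring_delta k <= 1.
Proof. by rewrite /ring_delta invf_le1 ?exprn_gt0 // exprn_ege1 // ler1n. Qed.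

Lemma ring_alpha_le k : ring_alpha k <= ring_delta k.+1 / 2 ^+ k.+2.
Proof.
rewrite /ring_alpha /ring_delta -invfM -exprD.
have p0 n : 0 < 2 ^+ n :> R by rewrite exprn_gt0.
rewrite ler_pdivrMr // mulrC ler_pdivlMr // -exprS ler_eXn2l ?ltr1n //.
rewrite /ring_exp expnD.
have h2 q : (q < 2 ^ q)%N by exact: ltn_expl.
have h3 : (2 * ring_p <= 2 ^ ring_p)%N.
  by rewrite /ring_p addnS expnS leq_mul2l /=; exact: h2.
have := leq_mul (h2 k) h3; rewrite /ring_p; clear; lia.
Qed.

Lemma ring_radius_gt0 k : 0 < ring_radius k.
Proof.
rewrite /ring_radius !mulr_gt0 ?ring_delta_gt0 //.
by rewrite (lt_le_trans _ (ring_rad_gt0 k)).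
Qed.

Let rr_gt0 k : 0 < rho * ring_rad k.
Proof. by rewrite mulr_gt0 // (lt_le_trans _ (ring_rad_gt0 k)). Qed.

Lemma ring_centers_neq0 k : ring_centers k != [::].
Proof. by rewrite -size_eq0 size_map size_dyadic_roots -lt0n expn_gt0. Qed.

Lemma ring_near_circle k a z : a \in ring_centers k -> modulus (z - a) <= ring_radius k ->
  `|modulus (z - c) - rho| <= rho * (4 / 2 ^+ j + (2 ^+ e)^-1).
Proof.
move=> /mapP[w /modulus_dyadic_roots w1 ->] hz {a}.
have ac : modulus (c + (rho * ring_rad k)%:C / w - c) = rho * ring_rad k.
  rewrite addrAC subrr add0r modulusfV w1 divr1 modulus_real ger0_norm //.
  exact: ltW.
set a := c + (rho * ring_rad k)%:C / w in hz ac.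
have h1 := ler_modulus_distD a z c; have h2 := ler_modulus_distD z a c.
move: h2; rewrite (modulusBC a z) => h2.
have tj : t k <= (2 ^+ j)^-1.
  by rewrite lef_pV2 ?posrE ?exprn_gt0 // ler_eXn2l ?ltr1n // leq_addl.
have de : ring_delta k <= (2 ^+ e)^-1.
  by rewrite lef_pV2 ?posrE ?exprn_gt0 // ler_eXn2l ?ltr1n // -addnA leq_addr.
have r1 : ring_radius k <= rho * (2 ^+ e)^-1.
  rewrite /ring_radius -mulrA ler_pM2l //; apply: le_trans de.
  by rewrite ler_piMl ?(ltW (ring_delta_gt0 _)) // ltW // ring_rad_lt1.
have r2 : rho - rho * (4 / 2 ^+ j) <= rho * ring_rad k.
  rewrite -{1}(mulr1 rho) -mulrBr ler_pM2l // /ring_rad lerD2l lerN2 ler_pM2l //.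
have r3 : rho * ring_rad k <= rho by rewrite ler_piMr ?ltW ?ring_rad_lt1.
have r4 : 0 <= rho * (4 / 2 ^+ j) by rewrite mulr_ge0 ?divr_ge0 ?exprn_ge0 // ltW.
rewrite ler_norml mulrDr; apply/andP; split; lra.
Qed.

Lemma ring_sum n : \sum_(k < n) (size (ring_centers k))%:R * ring_radius k <= 2 * rho * (2 ^+ e)^-1.
Proof.
have st k : (size (ring_centers k))%:R * ring_radius k <= rho * (2 ^+ e)^-1 * (2 ^+ k)^-1.
  rewrite size_map size_dyadic_roots natrX /ring_radius /ring_delta exprD invfM.
  set N := 2 ^+ ring_exp k; have N0 : 0 < N by rewrite exprn_gt0.
  rewrite exprD invfM; set u := (_ ^+ e)^-1; set v := (_ ^+ k)^-1.
  have u0 : 0 < u by rewrite invr_gt0 exprn_gt0.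
  have v0 : 0 < v by rewrite invr_gt0 exprn_gt0.
  have -> : N * (rho * ring_rad k * (u * v / N)) = rho * u * v * ring_rad k.
    by field; rewrite gt_eqF.
  by rewrite ler_piMr ?(ltW (ring_rad_lt1 k)) // !mulr_ge0 // ltW.
apply: (@le_trans _ _ (rho * (2 ^+ e)^-1 * (2 - 2 * (2 ^+ n)^-1))).
  elim: n => [|n IH]; first by rewrite big_ord0 expr0; lra.
  rewrite big_ord_recr /=; apply: le_trans (lerD IH (st n)) _.
  rewrite -mulrDr ler_pM2l ?mulr_gt0 ?invr_gt0 ?exprn_gt0 // exprS invfM.
  by set x := (_ ^+ n)^-1; lra.
have : 0 <= rho * (2 ^+ e)^-1 * (2 ^+ n)^-1 by rewrite !mulr_ge0 ?invr_ge0 ?exprn_ge0 // ltW.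
by set u := (2 ^+ e)^-1; set v := (2 ^+ n)^-1; lra.
Qed.

Section Point.
Variable z : C.
Hypothesis hz : forall k a, a \in ring_centers k -> ring_radius k <= modulus (z - a).

Let base_far k w : w \in dyadic_roots R (ring_exp k) ->
  ring_delta k <= modulus (1 - w * ring_base z k).
Proof.
move=> hw; have w1 := modulus_dyadic_roots hw.
have w0 : w != 0 by rewrite -modulus_eq0 w1 oner_eq0.
have := hz (k := k) (map_f _ hw).
set q := (rho * ring_rad k)%:C.
have q0 : q != 0 by rewrite (_ : 0 = 0%:C) // (inj_eq (@complexI R)) gt_eqF.
have -> : z - (c + q / w) = (1 - w * ring_base z k) * (- q / w).
  move: q0; rewrite /ring_base -/q; clearbody q => q0.
  by field; rewrite ?q0 ?w0.
rewrite modulusM modulusfV modulusN w1 divr1 modulus_real (gtr0_norm (rr_gt0 k)).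
by rewrite /ring_radius mulrC ler_pM2r.
Qed.

Lemma ring_factor_bound k : modulus (ring_factor z k) <= (ring_delta k)^-1.
Proof. by have [] := dyadic_roots_bound (ring_delta_gt0 k) (@base_far k). Qed.

Lemma ring_factor_denom_neq0 k : 1 - ring_base z k ^+ (2 ^ ring_exp k) != 0.
Proof. by have [] := dyadic_roots_bound (ring_delta_gt0 k) (@base_far k). Qed.

Lemma ring_factor_neq0 k : ring_factor z k != 0.
Proof. by rewrite invr_eq0 ring_factor_denom_neq0. Qed.

Let modulus_base k : modulus (ring_base z k) = modulus (z - c) / (rho * ring_rad k).
Proof. by rewrite /ring_base modulusfV modulus_real (gtr0_norm (rr_gt0 k)). Qed.

Let big2 k : 2 <= 2 ^+ (2 ^ (k + ring_p)) :> R.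
Proof. by rewrite -[leLHS]expr1 ler_eXn2l ?ltr1n // expn_gt0. Qed.

Lemma ring_factor_small k : rho * ring_mid k <= modulus (z - c) ->
  modulus (ring_factor z k) <= ring_alpha k.
Proof.
move=> hm; rewrite /ring_factor modulusV.
set T := 2 ^+ (2 ^ (k + ring_p)) : R; have T2 : 2 <= T := big2 k.
have h1 : 1 + t k <= modulus (ring_base z k).
  rewrite modulus_base ler_pdivlMr // mulrCA (le_trans _ hm) // ler_pM2l //.
  rewrite /ring_mid /ring_rad -/(t k); have := t_gt0 k; nra.
have h2 : T <= modulus (ring_base z k ^+ (2 ^ ring_exp k)).
  rewrite modulusX; apply: le_trans (bernoulli_pow2 (y := t k) (m := k + j) (k + ring_p) _ _) _.
  - by rewrite ltW.
  - by rewrite /t mulVf // expf_neq0.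
  by apply: lerXn2r => //; rewrite nnegrE ?modulus_ge0 // addr_ge0 // ltW.
have h3 : T - 1 <= modulus (1 - ring_base z k ^+ (2 ^ ring_exp k)).
  by rewrite modulusBC (le_trans _ (ler_modulusB _ _)) // modulus1 lerD2r.
rewrite /ring_alpha -/T -[leRHS]invrK lef_pV2 ?posrE ?invr_gt0 ?divr_gt0 //; lra.
Qed.

Lemma ring_factor_near1 k l : (k < l)%N -> modulus (z - c) <= rho * ring_mid k ->
  modulus (ring_factor z l - 1) <= ring_alpha l.
Proof.
move=> kl hm.
set T := 2 ^+ (2 ^ (l + ring_p)) : R; have T2 : 2 <= T := big2 l.
case: l kl @T T2 => // l; rewrite ltnS => kl T T2.
have b0 := modulus_ge0 (ring_base z l.+1).
have h1 : modulus (ring_base z l.+1) <= (1 + t l.+1)^-1.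
  have t1 : 0 < 1 + t l.+1 by rewrite addr_gt0.
  rewrite modulus_base ler_pdivrMr // mulrC ler_pdivlMr //.
  apply: le_trans (ler_wpM2r (ltW t1) hm) _; rewrite -mulrA ler_pM2l //.
  apply: le_trans (ler_wpM2r (ltW t1) (mid_homo kl)) _.
  rewrite /ring_mid /ring_rad -/(t l) -/(t l.+1); have := t_gt0 l; have := t_le8 l; rewrite tS; nra.
have h2 : modulus (ring_base z l.+1 ^+ (2 ^ ring_exp l.+1)) <= T^-1.
  rewrite modulusX; apply: (@le_trans _ _ ((1 + t l.+1)^-1 ^+ (2 ^ ring_exp l.+1))).
    by apply: lerXn2r => //; rewrite nnegrE // invr_ge0 addr_ge0 // ltW.
  rewrite exprVn lef_pV2 ?posrE ?exprn_gt0 ?addr_gt0 //.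
  apply: bernoulli_pow2; first by rewrite ltW.
  by rewrite /t mulVf // expf_neq0.
have := ring_factor_denom_neq0 l.+1; rewrite /ring_factor; set x := _ ^+ _ in h2 * => x1.
have -> : (1 - x)^-1 - 1 = x / (1 - x) by field.
have Ti : T^-1 <= 2^-1 by rewrite lef_pV2 ?posrE //; lra.
have h3 : 2^-1 <= modulus (1 - x).
  by have := ler_modulusB 1 x; rewrite modulus1; lra.
rewrite modulusfV ler_pdivrMr; last by rewrite modulus_gt0.
rewrite /ring_alpha -/T; have : 0 < T^-1 by rewrite invr_gt0; lra.
nra.
Qed.

(** The circle of radius [rho * ring_mid k] separates the two regimes. *)
Lemma ring_zone k l : (k < l)%N ->
  modulus (ring_factor z k) <= ring_alpha k \/ modulus (ring_factor z l - 1) <= ring_alpha l.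
Proof.
move=> kl; have [h|/ltW h] := leP (rho * ring_mid k) (modulus (z - c)).
  by left; exact: ring_factor_small.
by right; exact: ring_factor_near1 h.
Qed.

End Point.
End Construction.

(** McKissick's lemma in Koerner's form: discs of arbitrarily small total radius,
as close as desired to the circle, such that off these discs there is a
uniform limit of rational functions that vanishes outside the circle and has
no zero inside. *)
Lemma mckissick (c : C) (rho s eps : R) : 0 < rho -> 0 < s -> 0 < eps ->
  exists (D : nat -> seq C) (r : nat -> R),
  [/\ forall k, D k != [::] /\ 0 < r k,
      forall k a z, a \in D k -> modulus (z - a) <= r k -> `|modulus (z - c) - rho| <= s,
      forall n, \sum_(k < n) (size (D k))%:R * r k <= eps &
      forall X : set C, (forall z, X z -> forall k a, a \in D k -> r k <= modulus (z - a)) ->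
      exists f, [/\ RX X f, forall z, X z -> rho <= modulus (z - c) -> f z = 0 &
        forall z, X z -> modulus (z - c) < rho -> f z != 0]].
Proof.
move=> rho0 s0 eps0.
have [j1 hj1] : exists n : nat, (2 ^+ n)^-1 <= s / (8 * rho).
  by apply: exists_pow2_lt; rewrite divr_gt0 // mulr_gt0.
pose j := (j1 + 3)%N.
have j3 : (3 <= j)%N by rewrite leq_addl.
have hj : (2 ^+ j)^-1 <= s / (8 * rho).
  by apply: le_trans hj1; rewrite lef_pV2 ?posrE ?exprn_gt0 // ler_eXn2l ?ltr1n // leq_addr.
have m0 : 0 < Num.min (s / (2 * rho)) (eps / (2 * rho)).
  by rewrite lt_min !divr_gt0 // mulr_gt0.
have [e] := exists_pow2_lt m0; rewrite le_min => /andP[he1 he2].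
exists (ring_centers c rho j e), (ring_radius rho j e); split.
- by move=> k; rewrite ring_centers_neq0 ring_radius_gt0.
- move=> k a z ha hz; apply: le_trans (ring_near_circle rho0 j3 ha hz) _.
  move: hj he1; rewrite !ler_pdivlMr ?mulr_gt0 //; lra.
- move=> n; apply: le_trans (ring_sum c j e rho0 n) _.
  move: he2; rewrite !ler_pdivlMr ?mulr_gt0 //; lra.
move=> X hX.
pose h z k := ring_factor c rho j e z k.
pose F z n := \prod_(k < n) h z k.
have lim z : exists l : C, X z ->
  [/\ forall n, modulus (F z n - l) <= 8 / ring_delta j e 0 / 2 ^+ n,
      (forall k, modulus (h z k) <= ring_alpha j e k) -> l = 0 &
      forall i, (forall k, (i < k)%N -> modulus (h z k - 1) <= ring_alpha j e k) ->
        (forall k, h z k != 0) -> l != 0].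
  have [Xz|nX] := pselect (X z); last by exists 0.
  have [l hl] := prod_limit (ring_delta_gt0 j e) (ring_delta_le1 j e)
    (ring_alpha_le j e) (ring_factor_bound rho0 j3 (hX z Xz)) (ring_zone rho0 j3 (hX z Xz)).
  by exists l.
have [f hf] := choice lim.
exists f; split.
- apply: RX_of_rational_approx => eta eta0.
  pose q n : {poly C} := \prod_(k < n)
    (1 - ((rho * ring_rad j k)%:C^-1 *: ('X - c%:P)) ^+ (2 ^ ring_exp j e k)).
  have qE n z : (q n).[z] = \prod_(k < n) (1 - ring_base c rho j z k ^+ (2 ^ ring_exp j e k)).
    rewrite horner_prod; apply: eq_bigr => k _.
    by rewrite !hornerE /ring_base mulrC.
  have d0 := ring_delta_gt0 j e 0.
  have [n hn] : exists n, 8 / ring_delta j e 0 / 2 ^+ n < eta.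
    have [|n hn] := @exists_pow2_lt (eta / 2 / (8 / ring_delta j e 0)).
      by rewrite !divr_gt0.
    exists n; move: hn; rewrite ler_pdivlMr ?divr_gt0 // mulrC => /le_lt_trans; apply.
    by lra.
  exists 1, (q n); split=> z Xz.
    rewrite qE; apply/prodf_neq0 => k _.
    by rewrite (ring_factor_denom_neq0 rho0 j3 (hX z Xz)).
  have [h1 _ _] := hf z Xz; apply: le_lt_trans hn; apply: le_trans (h1 n).
  rewrite modulusBC qE hornerC mul1r /F.
  by rewrite -(big_morph _ (@invfM C) (@invr1 C)).
- move=> z Xz hz; have [_ h2 _] := hf z Xz; apply: h2 => k.
  apply: (ring_factor_small _ rho0 j3); apply: le_trans hz.
  by rewrite ler_piMr ?(ltW rho0) // /ring_mid gerBl divr_ge0 // exprn_ge0.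
move=> z Xz hz; have [_ _ h3] := hf z Xz.
have [|i hi] := @exists_pow2_lt ((rho - modulus (z - c)) / (3 * rho)).
  by rewrite divr_gt0 ?subr_gt0 // mulr_gt0.
apply: (h3 i) => [k ik|k]; last exact: (ring_factor_neq0 rho0 j3 (hX z Xz)).
apply: (ring_factor_near1 rho0 j3 (hX z Xz) ik).
have hi' : (2 ^+ (i + j))^-1 <= (2 ^+ i)^-1 :> R.
  by rewrite lef_pV2 ?posrE ?exprn_gt0 // ler_eXn2l ?ltr1n // leq_addr.
move: hi; rewrite ler_pdivlMr ?mulr_gt0 // /ring_mid => hi.
set u := (2 ^+ (i + j))^-1 in hi' *; set v := (2 ^+ i)^-1 in hi hi'; nra.
Qed.

End McKissick.

(** * Replacing overlapping discs by separated ones *)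

Section Clusters.
Variable R : realType.
Local Notation C := R[i].
Local Open Scope complex_scope.

(** Sweep from the left: when the current point is covered by an interval, jump
just beyond the end of this interval, which then never matters again. *)
Lemma avoid_intervals (s : seq (R * R)) (A B : R) :
  (forall p, p \in s -> 0 <= p.2) -> 2 * (\sum_(p <- s) p.2) < B - A ->
  exists t, [/\ A <= t, t < B & forall p, p \in s -> t < p.1 - p.2 \/ p.1 + p.2 < t].
Proof.
have [n] := ubnP (size s); elim: n s A => // n IH s A sn s0 hs.
have S0 : 0 <= \sum_(p <- s) p.2 by rewrite big_seq sumr_ge0.
have [H|] := pselect (forall p, p \in s -> A < p.1 - p.2 \/ p.1 + p.2 < A).
  by exists A; split=> //; lra.
move=> /existsNP[p /not_implyP[ps /not_orP[/negP h1 /negP h2]]].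
rewrite -leNgt in h1; rewrite -leNgt in h2.
have e : \sum_(x <- s) x.2 = p.2 + \sum_(x <- rem p s) x.2.
  by rewrite (perm_big _ (perm_to_rem ps)) big_cons.
(* The slack B - A - 2 * (sum of the radii) is halved at each jump. *)
pose A' := p.1 + p.2 + (B - A - 2 * (\sum_(p <- s) p.2)) / 2.
have [|||t [t1 t2 t3]] := IH (rem p s) A'.
- by rewrite size_rem // prednK ?(leq_ltn_trans _ sn) //; case: (s) ps.
- by move=> x /mem_rem /s0.
- by rewrite /A'; move: hs; rewrite e; lra.
exists t; split=> //; first by apply: le_trans t1; rewrite /A'; lra.
move=> x xs; have := xs; rewrite (perm_mem (perm_to_rem ps)) inE => /predU1P[->|/t3//].
by right; move: t1; rewrite /A'; lra.
Qed.

(** A disc obtained by merging deleted discs.  Besides its centre and radius it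
carries the largest distance [cscale] from [K] guaranteed for one of the
merged discs, the sum [cweight] of their ratios radius / distance, and the
part [ctail] of this sum that comes from the discs whose guaranteed distance
is smaller than a threshold [d]. *)
Definition cluster := (C * (R * R) * (R * R))%type.
Definition ccenter (c : cluster) := c.1.1.
Definition cradius (c : cluster) := c.1.2.1.
Definition cscale (c : cluster) := c.1.2.2.
Definition cweight (c : cluster) := c.2.1.
Definition ctail (c : cluster) := c.2.2.

Variables (K : set C) (d : R).

(** The invariants preserved by merging.  They imply that a merged disc of small
weight is still far from [K]: its radius is at most [cscale * cweight], and it
contains a point at distance at least [cscale] from [K]. *)
Record valid_cluster (c : cluster) : Prop := ValidCluster {
  cradius_gt0 : 0 < cradius c;
  cscale_gt0 : 0 < cscale c;
  cscale_le1 : cscale c <= 1;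
  ctail_ge0 : 0 <= ctail c;
  cradius_le : cradius c <= cscale c * cweight c;
  cweight_tail : cscale c < d -> cweight c <= ctail c;
  cpoint : exists2 p, modulus (p - ccenter c) <= cradius c &
    forall z, K z -> cscale c <= modulus (p - z) }.

Definition cdisjoint (c c' : cluster) :=
  cradius c + cradius c' < modulus (ccenter c - ccenter c').

Definition cinside (c c' : cluster) :=
  modulus (ccenter c - ccenter c') + cradius c <= cradius c'.

Lemma cdisjointC c c' : cdisjoint c c' = cdisjoint c' c.
Proof. by rewrite /cdisjoint modulusBC addrC. Qed.

Lemma cinside_refl c : cinside c c.
Proof. by rewrite /cinside subrr modulus0 add0r. Qed.

Lemma cinside_trans c2 c1 c3 : cinside c1 c2 -> cinside c2 c3 -> cinside c1 c3.
Proof.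
rewrite /cinside => h1 h2; have := ler_modulus_distD (ccenter c2) (ccenter c1) (ccenter c3); lra.
Qed.

(** Two intersecting discs lie in a disc whose radius is the sum of their radii
and whose centre is the weighted mean of their centres. *)
Definition cmerge (c c' : cluster) : cluster :=
  (((cradius c)%:C * ccenter c + (cradius c')%:C * ccenter c') / (cradius c + cradius c')%:C,
   (cradius c + cradius c', Num.max (cscale c) (cscale c')),
   (cweight c + cweight c', ctail c + ctail c')).

Lemma cmergeC c c' : cmerge c c' = cmerge c' c.
Proof.
rewrite /cmerge [cradius c' + _]addrC [cweight c' + _]addrC [ctail c' + _]addrC.
by rewrite [X in X / _]addrC [Num.max (cscale c') _]maxC.
Qed.

Lemma cinside_mergel c c' : 0 < cradius c -> 0 < cradius c' -> ~~ cdisjoint c c' ->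
  cinside c (cmerge c c').
Proof.
move=> r0 r0'; rewrite /cdisjoint -leNgt /cinside /cmerge {1}/ccenter /= => h.
rewrite [X in _ <= X]/cradius /= addrC lerD2l.
set a := ccenter c in h *; set a' := ccenter c' in h *.
have rr : 0 < cradius c + cradius c' by rewrite addr_gt0.
have r1 : (cradius c + cradius c')%:C != 0.
  by rewrite (_ : 0 = 0%:C) // (inj_eq (@complexI R)) gt_eqF.
have -> : c.1.1 - ((cradius c)%:C * a + (cradius c')%:C * a') / (cradius c + cradius c')%:C =
   (cradius c' / (cradius c + cradius c'))%:C * (a - a').
  rewrite -/(ccenter c) -/a rmorphM fmorphV /=; move: r1; rewrite rmorphD => r1; field.
  exact: r1.
rewrite modulusM modulus_real ger0_norm ?divr_ge0 ?(ltW r0') ?(ltW rr) // mulrAC ler_pdivrMr //.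
by rewrite ler_pM2l.
Qed.

Lemma valid_cmerge c c' : valid_cluster c -> valid_cluster c' -> ~~ cdisjoint c c' ->
  valid_cluster (cmerge c c').
Proof.
wlog: c c' / cscale c' <= cscale c.
  move=> H v v' hc; have [/ltW|] := ltP (cscale c) (cscale c'); last by move/H; apply.
  by move/H; rewrite cmergeC cdisjointC; apply.
move=> ss v v' hc; have [r0 s0 s1 t0 rle wt [p hp pK]] := v.
have [r0' s0' s1' t0' rle' wt' _] := v'.
have w0' : 0 <= cweight c' by rewrite -(pmulr_rge0 _ s0') (le_trans (ltW r0')).
have sm : cscale (cmerge c c') = cscale c by rewrite /cmerge /cscale /=; apply/max_idPl.
split; rewrite ?sm //.
- by rewrite /cradius /= addr_gt0.
- by rewrite /ctail /= addr_ge0.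
- rewrite /cradius /cweight /= mulrDr lerD // (le_trans rle') // ler_wpM2r //.
- by move=> sd; rewrite /cweight /ctail /= lerD ?wt ?wt' // (le_lt_trans ss).
exists p => //; have := cinside_mergel r0 r0' hc; rewrite /cinside.
have := ler_modulus_distD (ccenter c) p (ccenter (cmerge c c')); lra.
Qed.

Definition separated (s : seq cluster) := pairwise cdisjoint s.

Lemma insert_cluster (c : cluster) (s : seq cluster) :
  valid_cluster c -> (forall x, x \in s -> valid_cluster x) -> separated s ->
  exists s', [/\ forall x, x \in s' -> valid_cluster x, separated s',
    \sum_(x <- s') cweight x = \sum_(x <- c :: s) cweight x,
    \sum_(x <- s') ctail x = \sum_(x <- c :: s) ctail x &
    forall x, x \in c :: s -> exists2 y, y \in s' & cinside x y].
Proof.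
have [n] := ubnP (size s); elim: n s c => // n IH s c sn vc vs ss.
case: (boolP (all (cdisjoint c) s)) => [H|/allPn[c' c's hc]].
  exists (c :: s); split=> //.
  - by move=> x; rewrite inE => /predU1P[->//|/vs].
  - by rewrite /separated pairwise_cons H.
  - by move=> x xs; exists x => //; exact: cinside_refl.
have vc' := vs _ c's.
have [||||s' [h1 h2 h3 h4 h5]] := IH (rem c' s) (cmerge c c').
- by rewrite size_rem // prednK ?(leq_ltn_trans _ sn) //; case: (s) c's.
- exact: valid_cmerge.
- by move=> x /mem_rem /vs.
- exact: subseq_pairwise (rem_subseq _ _) ss.
exists s'; split=> //.
- by rewrite h3 !big_cons (perm_big _ (perm_to_rem c's)) big_cons addrA.
- by rewrite h4 !big_cons (perm_big _ (perm_to_rem c's)) big_cons addrA.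
have [y ys hy] := h5 (cmerge c c') (mem_head _ _).
have [r0 r0'] : 0 < cradius c /\ 0 < cradius c' by split; apply: cradius_gt0.
move=> x; rewrite inE (perm_mem (perm_to_rem c's)) inE => /or3P[/eqP->|/eqP->|xr].
- by exists y => //; apply: cinside_trans hy; exact: cinside_mergel.
- exists y => //; apply: cinside_trans hy; rewrite cmergeC; apply: cinside_mergel => //.
  by rewrite cdisjointC.
by apply: h5; rewrite inE xr orbT.
Qed.

(** Merging intersecting discs until none is left covers all the discs by
separated ones, without changing the sums of the weights and of the tails. *)
Lemma separate_clusters (s : seq cluster) : (forall x, x \in s -> valid_cluster x) ->
  exists s', [/\ forall x, x \in s' -> valid_cluster x, separated s',
    \sum_(x <- s') cweight x = \sum_(x <- s) cweight x,
    \sum_(x <- s') ctail x = \sum_(x <- s) ctail x &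
    forall x, x \in s -> exists2 y, y \in s' & cinside x y].
Proof.
elim: s => [|c s IH] vs; first by exists [::].
have [|s1 [h1 h2 h3 h4 h5]] := IH; first by move=> x xs; apply: vs; rewrite inE xs orbT.
have [|s2 [k1 k2 k3 k4 k5]] := insert_cluster (vs c _) h1 h2; first exact: mem_head.
exists s2; split=> //; rewrite ?k3 ?k4 ?big_cons ?h3 ?h4 //.
move=> x; rewrite inE => /predU1P[->|/h5[y ys xy]]; first by apply: k5; exact: mem_head.
have [|w ws yw] := k5 y; first by rewrite inE ys orbT.
by exists w => //; exact: cinside_trans yw.
Qed.

End Clusters.

(** * Approximation by sums of simple fractions *)

Section SimpleFractions.
Variable R : realType.
Local Notation C := R[i].
Local Open Scope complex_scope.

Definition fractions (L : seq (C * C)) (z : C) : C := \sum_(p <- L) p.1 / (p.2 - z).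
Definition total_weight (L : seq (C * C)) : R := \sum_(p <- L) modulus p.1.

Lemma fractions_cat L1 L2 z : fractions (L1 ++ L2) z = fractions L1 z + fractions L2 z.
Proof. by rewrite /fractions big_cat. Qed.

Lemma total_weight_cat L1 L2 : total_weight (L1 ++ L2) = total_weight L1 + total_weight L2.
Proof. by rewrite /total_weight big_cat. Qed.

Definition scale_fractions (k : C) (L : seq (C * C)) := [seq (k * p.1, p.2) | p <- L].

Lemma fractions_scale k L z : fractions (scale_fractions k L) z = k * fractions L z.
Proof.
by rewrite /fractions big_map mulr_sumr; apply: eq_bigr => p _; rewrite mulrA.
Qed.

Lemma total_weight_scale k L : total_weight (scale_fractions k L) = modulus k * total_weight L.
Proof.
by rewrite /total_weight big_map mulr_sumr; apply: eq_bigr => p _; rewrite modulusM.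
Qed.

Lemma fractions_bound L z (e : R) : 0 < e -> (forall p, p \in L -> e <= modulus (p.2 - z)) ->
  modulus (fractions L z) <= total_weight L / e.
Proof.
move=> e0 hL; apply: le_trans (ler_modulus_sum _ _ _) _.
rewrite /total_weight mulr_suml big_seq [leRHS]big_seq; apply: ler_sum => p /hL hp.
rewrite modulusfV ler_pM ?modulus_ge0 ?invr_ge0 ?modulus_ge0 //.
by rewrite lef_pV2 ?posrE // (lt_le_trans e0).
Qed.

Lemma modulus_le_eps (x : C) : (forall e : R, 0 < e -> modulus x <= e) -> x = 0.
Proof.
move=> h; apply/eqP; rewrite -modulus_eq0; apply/eqP/le_anti; rewrite modulus_ge0 andbT.
by apply/ler_addgt0Pr => e e0; rewrite add0r; exact: h.
Qed.

Section Class.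
(** The functions that are uniform limits on [Y] of sums of simple fractions
with poles off [Y].  They form an algebra; the only difficulty is a product of
two fractions with the same pole. *)
Variables (Y : set C) (B : R).
Hypothesis Y_bounded : forall z, Y z -> modulus z <= B.
Hypothesis B_gt0 : 0 < B.
Hypothesis far_off : forall b, ~ Y b -> exists2 e : R, 0 < e & forall w, Y w -> e <= modulus (b - w).

Definition fractions_off (L : seq (C * C)) := forall p, p \in L -> ~ Y p.2.
Definition fractionable (f : C -> C) := forall e : R, 0 < e -> exists2 L, fractions_off L &
  forall w, Y w -> modulus (f w - fractions L w) <= e.

Lemma fractionableD f g : fractionable f -> fractionable g -> fractionable (fun z => f z + g z).
Proof.
move=> hf hg e e0; have e2 : 0 < e / 2 by rewrite divr_gt0.
have [L1 o1 h1] := hf _ e2; have [L2 o2 h2] := hg _ e2; exists (L1 ++ L2).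
  by move=> p; rewrite mem_cat => /orP[/o1|/o2].
move=> w Yw; rewrite fractions_cat opprD addrACA (le_trans (ler_modulusD _ _)) //.
by rewrite (splitr e) lerD ?h1 ?h2.
Qed.

Lemma fractionableZ k f : fractionable f -> fractionable (fun z => k * f z).
Proof.
move=> hf e e0; have k1 : 0 < modulus k + 1 by rewrite ltr_wpDl ?modulus_ge0.
have [|L o h] := hf (e / (modulus k + 1)); first by rewrite divr_gt0.
exists (scale_fractions k L); first by move=> _ /mapP[p /o hp ->].
move=> w Yw; rewrite fractions_scale -mulrBr modulusM.
apply: (@le_trans _ _ ((modulus k + 1) * (e / (modulus k + 1)))).
  by rewrite ler_pM ?modulus_ge0 ?h // lerDl.
by rewrite mulrCA mulfV ?gt_eqF // mulr1.
Qed.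

Lemma fractionable_ext f g : (forall z, Y z -> f z = g z) -> fractionable f -> fractionable g.
Proof.
move=> fg hf e e0; have [L o h] := hf e e0; exists L => // w Yw.
by rewrite -fg // h.
Qed.

Lemma fractionable_lim f : (forall e : R, 0 < e -> exists2 g, fractionable g &
  forall w, Y w -> modulus (f w - g w) <= e) -> fractionable f.
Proof.
move=> H e e0; have e2 : 0 < e / 2 by rewrite divr_gt0.
have [g hg fg] := H _ e2; have [L o h] := hg _ e2; exists L => // w Yw.
rewrite (le_trans (ler_modulus_distD (g w) _ _)) // (splitr e).
by rewrite lerD ?fg ?h.
Qed.

Lemma fractionable0 : fractionable (fun=> 0).
Proof.
by move=> e e0; exists [::] => // w _; rewrite /fractions big_nil subr0 modulus0 ltW.
Qed.

Lemma fractionable_sum (L : seq (C * C)) (F : C * C -> C -> C) :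
  (forall p, p \in L -> fractionable (F p)) -> fractionable (fun z => \sum_(p <- L) F p z).
Proof.
elim: L => [|p L IH] H.
  by apply: fractionable_ext fractionable0 => z _; rewrite big_nil.
apply: (@fractionable_ext (fun z => F p z + \sum_(p <- L) F p z)).
  by move=> z _; rewrite big_cons.
apply: fractionableD; first by apply: H; rewrite mem_head.
by apply: IH => x xL; apply: H; rewrite inE xL orbT.
Qed.

(** By linearity and passage to the limit, a bounded multiplier needs to be
tested on the simple fractions only. *)
Lemma fractionable_mul (m : C -> C) (M : R) : 0 < M ->
  (forall w, Y w -> modulus (m w) <= M) ->
  (forall b, ~ Y b -> fractionable (fun w => m w / (b - w))) ->
  forall f, fractionable f -> fractionable (fun w => m w * f w).
Proof.
move=> M0 hm gen f hf; apply: fractionable_lim => e e0.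
have [|L o h] := hf (e / M); first by rewrite divr_gt0.
exists (fun w => m w * fractions L w); last first.
  move=> w Yw; rewrite -mulrBr modulusM -[leRHS](divfK (lt0r_neq0 M0)) [leRHS]mulrC.
  by rewrite ler_pM ?modulus_ge0 ?hm ?h.
apply: (@fractionable_ext (fun w => \sum_(p <- L) p.1 * (m w / (p.2 - w)))).
  by move=> w _; rewrite /fractions mulr_sumr; apply: eq_bigr => p _; rewrite mulrCA.
by apply: fractionable_sum => p /o hp; apply: fractionableZ; exact: gen.
Qed.

Lemma fractionable_gen b : ~ Y b -> fractionable (fun w => (b - w)^-1).
Proof.
move=> nb e e0; exists [:: (1, b)] => [p|w Yw]; first by rewrite inE => /eqP ->.
by rewrite /fractions big_seq1 mul1r subrr modulus0 ltW.
Qed.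

Lemma off_neq b w : ~ Y b -> Y w -> b - w != 0.
Proof. by move=> nb Yw; rewrite subr_eq0; apply/eqP => bw; apply: nb; rewrite bw. Qed.

(** The constant 1 is the limit of [T / (T - w)] as the pole [T] goes to
infinity. *)
Lemma fractionable1 : fractionable (fun=> 1).
Proof.
apply: fractionable_lim => e e0.
(* The error is |w| / |T - w|, at most B / (T - B). *)
pose T := B + B / e + 1.
have Be : 0 < B / e by rewrite divr_gt0.
have T0 : 0 <= T by rewrite /T !addr_ge0 ?(ltW B_gt0) ?(ltW Be).
have nT : ~ Y T%:C.
  by move=> /Y_bounded; rewrite modulus_real ger0_norm // => TB; rewrite /T in TB; lra.
exists (fun w => T%:C * (T%:C - w)^-1); first exact/fractionableZ/fractionable_gen.
move=> w Yw; have n0 := off_neq nT Yw.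
have -> : 1 - T%:C * (T%:C - w)^-1 = - w / (T%:C - w) by field.
rewrite modulusfV modulusN ler_pdivrMr ?modulus_gt0 //.
apply: le_trans (Y_bounded Yw) _.
have := ler_modulusB T%:C w; rewrite modulus_real ger0_norm //.
have := Y_bounded Yw; move=> h1 h2.
have h3 : B / e <= modulus (T%:C - w) by rewrite /T in h2 *; lra.
by move: h3; rewrite ler_pdivrMr // mulrC.
Qed.

Lemma fractionable_mulX f : fractionable f -> fractionable (fun w => w * f w).
Proof.
apply: (@fractionable_mul id B) => // b nb.
apply: (@fractionable_ext (fun w => b * (b - w)^-1 + (-1) * 1)).
  by move=> w Yw; have := off_neq nb Yw => n0; field.
by apply: fractionableD; apply: fractionableZ; [exact: fractionable_gen|exact: fractionable1].
Qed.

Lemma fractionable_poly (P : {poly C}) f : fractionable f -> fractionable (fun w => P.[w] * f w).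
Proof.
move=> hf; elim/poly_ind: P => [|P c IH].
  by apply: fractionable_ext fractionable0 => z _; rewrite horner0 mul0r.
apply: (@fractionable_ext (fun w => w * (P.[w] * f w) + c * f w)).
  by move=> z _; rewrite hornerMXaddC mulrDl [P.[z] * z]mulrC mulrA.
by apply: fractionableD; [exact: fractionable_mulX|exact: fractionableZ].
Qed.

(** Two distinct poles are separated by partial fractions; a double pole is the
limit of two simple poles that merge. *)
Lemma fractionable_div b f : ~ Y b -> fractionable f -> fractionable (fun w => (b - w)^-1 * f w).
Proof.
move=> nb; have [e e0 he] := far_off nb.
have distinct b1 b2 : ~ Y b1 -> ~ Y b2 -> b1 != b2 ->
    fractionable (fun w => (b1 - w)^-1 / (b2 - w)).
  move=> n1 n2 b12; have b21 : b2 - b1 != 0 by rewrite subr_eq0 eq_sym.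
  apply: (@fractionable_ext (fun w => (b2 - b1)^-1 * (b1 - w)^-1 + (- (b2 - b1)^-1) * (b2 - w)^-1)).
    by move=> w Yw; have h1 := off_neq n1 Yw; have h2 := off_neq n2 Yw; field; rewrite b21 h1 h2.
  by apply: fractionableD; apply: fractionableZ; exact: fractionable_gen.
apply: (@fractionable_mul _ e^-1); first by rewrite invr_gt0.
  by move=> w /he h; rewrite modulusV lef_pV2 ?posrE // (lt_le_trans e0).
move=> b' nb'; have [bb'|/distinct] := eqVneq b b'; last exact.
rewrite -{}bb' {b' nb'}; apply: fractionable_lim => h h0.
(* The distance of the two poles; the error is at most t / (e ^ 2 * (e / 2)). *)
pose t := Num.min (e / 2) (h * e ^+ 3 / 2).
have e3 : 0 < e ^+ 3 by rewrite exprn_gt0.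
have t0 : 0 < t by rewrite lt_min !divr_gt0 // mulr_gt0.
have [t1 t2] : t <= e / 2 /\ t <= h * e ^+ 3 / 2 by split; rewrite ge_min lexx ?orbT.
have far' w : Y w -> e / 2 <= modulus (b + t%:C - w).
  move=> /he h1; have := ler_modulusB (b - w) (- t%:C).
  rewrite modulusN modulus_real (gtr0_norm t0) opprK addrAC; lra.
have nb' : ~ Y (b + t%:C).
  by move=> /far'; rewrite subrr modulus0; lra.
have bt : b != b + t%:C.
  by rewrite -subr_eq0 opprD addNKr oppr_eq0 (_ : 0 = 0%:C) // (inj_eq (@complexI R)) gt_eqF.
exists (fun w => (b - w)^-1 / (b + t%:C - w)); first exact: distinct.
move=> w Yw; have n1 := off_neq nb Yw; have n2 := off_neq nb' Yw.
have -> : (b - w)^-1 / (b - w) - (b - w)^-1 / (b + t%:C - w) =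
    t%:C / ((b - w) ^+ 2 * (b + t%:C - w)) by field; rewrite n1 n2.
rewrite modulusfV modulus_real (gtr0_norm t0) modulusM modulusX ler_pdivrMr; last first.
  by rewrite mulr_gt0 ?exprn_gt0 ?modulus_gt0.
apply: le_trans t2 _; rewrite -mulrA ler_pM2l //.
apply: (@le_trans _ _ (e ^+ 2 * (e / 2))); first by rewrite exprSr mulrA.
by rewrite ler_pM ?exprn_ge0 ?divr_ge0 ?(ltW e0) ?far' // lerXn2r ?nnegrE ?modulus_ge0 ?(ltW e0) ?he.
Qed.

Lemma fractionable_rational (P Q : {poly C}) : Q != 0 -> (forall b, root Q b -> ~ Y b) ->
  fractionable (fun w => P.[w] / Q.[w]).
Proof.
move=> Q0 hQ; apply: fractionable_poly.
have [rs Qrs] := closed_field_poly_normal Q.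
have {}hQ b : b \in rs -> ~ Y b.
  by move=> brs; apply: hQ; rewrite Qrs rootZ ?lead_coef_eq0 // root_prod_XsubC.
have l0 : lead_coef Q != 0 by rewrite lead_coef_eq0.
apply: (@fractionable_ext (fun w => (lead_coef Q)^-1 * (\prod_(b <- rs) ('X - b%:P)).[w]^-1)).
  by move=> w _; rewrite {2}Qrs hornerZ invfM.
apply: fractionableZ; elim: rs hQ {Qrs} => [|b rs IH] hQ.
  by apply: fractionable_ext fractionable1 => w _; rewrite big_nil hornerC invr1.
apply: (@fractionable_ext (fun w => (-1) * ((b - w)^-1 * (\prod_(b <- rs) ('X - b%:P)).[w]^-1))).
  move=> w _; rewrite big_cons hornerM hornerXsubC invfM -(opprB b w) invrN.
  by rewrite mulN1r mulNr.
apply/fractionableZ/fractionable_div; first by apply: hQ; rewrite mem_head.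
by apply: IH => x xrs; apply: hQ; rewrite inE xrs orbT.
Qed.

End Class.
End SimpleFractions.

(** * The Cauchy formula as a limit of averages *)

Section DiscreteCauchy.
Variable R : realType.
Local Notation C := R[i].
Local Open Scope complex_scope.

Lemma real_complex_neq0 (r : R) : r != 0 -> r%:C != 0 :> C.
Proof. by rewrite (_ : 0 = 0%:C) // (inj_eq (@complexI R)). Qed.

Lemma expr_pow2_small (k e : R) : 0 <= k -> k < 1 -> 0 < e ->
  \forall m \near \oo, k ^+ (2 ^ m) <= e.
Proof.
move=> k0 k1 e0.
have kn : `|k| < 1 by rewrite ger0_norm.
have := cvg_expr kn => /cvgr0_norm_le /(_ e e0) [N _ hN].
exists N => // m /= Nm; have := hN (2 ^ m)%N.
rewrite /= => /(_ (leq_trans Nm (ltnW (ltn_expl _ (ltnSn 1))))).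
by rewrite ger0_norm // exprn_ge0.
Qed.

(** The point [x] is inside or outside the circle of centre [a] and radius [r],
with a margin measured by [k < 1]. *)
Definition on_side (inner : bool) (a : C) (r k : R) (x : C) :=
  if inner then modulus (x - a) <= k * r else r <= k * modulus (x - a).

(** The average over [2 ^ m] equidistant points [w] of the circle of
[(w - a) / (w - x)]; it tends to the winding number of the circle around
[x]. *)
Definition winding (a : C) (r : R) m (x : C) : C := (1 - ((x - a) / r%:C) ^+ (2 ^ m))^-1.

Lemma winding_lim inner a r k e : 0 < r -> 0 <= k -> k < 1 -> 0 < e ->
  \forall m \near \oo, forall x, on_side inner a r k x ->
    modulus (winding a r m x - inner%:R) <= e.
Proof.
move=> r0 k0 k1 e0.
have m0 : 0 < Num.min 2^-1 (e / 2) by rewrite lt_min invr_gt0 divr_gt0 // andbT.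
have := expr_pow2_small k0 k1 m0; apply: filterS => m.
rewrite le_min => /andP[hm1 hm2] x; set u := (x - a) / r%:C.
have um : modulus u = modulus (x - a) / r by rewrite modulusfV modulus_real gtr0_norm.
rewrite /winding -/u; set y := u ^+ _; case: inner; rewrite /on_side => hx.
  have hy : modulus y <= k ^+ (2 ^ m).
    by rewrite modulusX lerXn2r ?nnegrE ?modulus_ge0 // um ler_pdivrMr.
  have h1 : 2^-1 <= modulus (1 - y) by have := ler_modulusB 1 y; rewrite modulus1; lra.
  have y1 : 1 - y != 0 by rewrite -modulus_gt0; lra.
  have -> : (1 - y)^-1 - true%:R = y / (1 - y) by rewrite (mulr1n (1 : C)); field.
  rewrite modulusfV ler_pdivrMr ?modulus_gt0 //; nra.
rewrite subr0 modulusV.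
have x0 : 0 < modulus (x - a).
  rewrite lt_neqAle modulus_ge0 andbT eq_sym; apply/eqP => h; move: hx; rewrite h; lra.
have u0 : 0 < modulus u by rewrite um divr_gt0.
have hy : (modulus y)^-1 <= k ^+ (2 ^ m).
  rewrite modulusX -exprVn lerXn2r ?nnegrE ?invr_ge0 ?modulus_ge0 //.
  by rewrite um invf_div ler_pdivrMr.
have y0 : 0 < modulus y by rewrite modulusX exprn_gt0.
have h2 : 2 <= modulus y by rewrite -[leLHS]invrK -[leRHS]invrK lef_pV2 ?posrE ?invr_gt0 // (le_trans hy).
have h1 : modulus y / 2 <= modulus (1 - y).
  by have := ler_modulusB y 1; rewrite modulus1 modulusBC; lra.
apply: (@le_trans _ _ (2 * (modulus y)^-1)); last by lra.
rewrite -[leRHS]invrK invfM invrK lef_pV2 ?posrE //; lra.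
Qed.

(** The Riemann sum of the Cauchy integral of [q] over the circle of centre [a]
and radius [r], as a sum of simple fractions with poles on the circle. *)
Definition circle_terms (q : C -> C) (a : C) (r : R) m : seq (C * C) :=
  [seq (q (a + r%:C / w) * (r%:C / w) / (2 ^ m)%:R, a + r%:C / w) | w <- dyadic_roots R m].

Lemma circle_pt_modulus (a : C) (r : R) m w : 0 < r -> w \in dyadic_roots R m ->
  modulus (a + r%:C / w - a) = r.
Proof.
move=> r0 /modulus_dyadic_roots w1.
by rewrite addrAC subrr add0r modulusfV w1 divr1 modulus_real gtr0_norm.
Qed.

Lemma circle_terms_poles q a r m p : 0 < r -> p \in circle_terms q a r m -> modulus (p.2 - a) = r.
Proof. by move=> r0 /mapP[w hw ->]; exact: circle_pt_modulus hw. Qed.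

Lemma circle_terms_weight q a r m M : 0 < r ->
  (forall x, modulus (x - a) = r -> modulus (q x) <= M) ->
  total_weight (circle_terms q a r m) <= r * M.
Proof.
move=> r0 hq; rewrite /total_weight big_map.
apply: (@le_trans _ _ (\sum_(w <- dyadic_roots R m) r * M / (2 ^ m)%:R)).
  rewrite big_seq [leRHS]big_seq; apply: ler_sum => w hw /=.
  have := circle_pt_modulus a r0 hw => /hq h.
  rewrite modulusfV modulus_nat ler_pM2r ?invr_gt0 ?ltr0n ?expn_gt0 //.
  rewrite modulusM modulusfV (modulus_dyadic_roots hw) divr1 modulus_real gtr0_norm // mulrC.
  by rewrite ler_pM2l.
rewrite big_const_seq count_predT size_dyadic_roots iter_addr_0 -(mulr_natr (r * M / _)) divfK //.
Qed.

Lemma circle_terms_sum (I : Type) (s : seq I) (c : I -> C) (g : I -> C -> C) a r m z :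
  fractions (circle_terms (fun w => \sum_(p <- s) c p * g p w) a r m) z =
  \sum_(p <- s) c p * fractions (circle_terms (g p) a r m) z.
Proof.
rewrite /fractions big_map /=.
under [RHS]eq_bigr do rewrite big_map mulr_sumr /=.
rewrite exchange_big /=; apply: eq_bigr => w _.
by rewrite !mulr_suml; apply: eq_bigr => p _; rewrite !mulrA.
Qed.

Lemma circle_terms_sub f g a r m z :
  fractions (circle_terms (fun w => f w - g w) a r m) z =
  fractions (circle_terms f a r m) z - fractions (circle_terms g a r m) z.
Proof.
rewrite /fractions !big_map -sumrB; apply: eq_bigr => w _ /=.
by rewrite -mulrBl -!mulrBl.
Qed.

Lemma winding_sum a r m x : 0 < r -> modulus (x - a) != r ->
  \sum_(w <- dyadic_roots R m) (r%:C / w) / (2 ^ m)%:R / (a + r%:C / w - x) = winding a r m x.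
Proof.
move=> r0 xr; have rC : r%:C != 0 by rewrite real_complex_neq0 ?gt_eqF.
have N0 : (2 ^ m)%:R != 0 :> C by rewrite pnatr_eq0 -lt0n expn_gt0.
have w_ne w : w \in dyadic_roots R m -> (w != 0) * (1 - w * ((x - a) / r%:C) != 0).
  move=> /modulus_dyadic_roots w1; split; first by rewrite -modulus_eq0 w1 oner_eq0.
  apply: contraNneq xr => /eqP; rewrite subr_eq0 => /eqP/(congr1 (@modulus R)).
  rewrite modulus1 modulusM w1 mul1r modulusfV modulus_real gtr0_norm // => h.
  by apply/eqP; rewrite -[RHS]mul1r h divfK // gt_eqF.
have [|n0 hs] := @sum_dyadic_roots R m ((x - a) / r%:C); first by move=> w /w_ne[].
rewrite /winding.
transitivity (\sum_(w <- dyadic_roots R m) (2 ^ m)%:R^-1 * (1 - w * ((x - a) / r%:C))^-1).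
  rewrite big_seq [RHS]big_seq; apply: eq_bigr => w /w_ne[w0].
  move: rC; generalize (r%:C : C) => q q0 h.
  have e : a + q / w - x = q / w * (1 - w * ((x - a) / q)) by field; rewrite ?q0 ?w0.
  rewrite e; set y := 1 - _ in h *; field.
  by rewrite h w0 q0 /= andbT; exact: N0.
rewrite -mulr_sumr hs mulrA mulVf // mul1r.
by [].
Qed.

(** Split [1 / ((b - w) (w - z))] into simple fractions in [w]. *)
Lemma circle_terms_gen a r m b z : 0 < r -> modulus (b - a) != r -> modulus (z - a) != r ->
  b != z ->
  fractions (circle_terms (fun w => (b - w)^-1) a r m) z =
  (winding a r m z - winding a r m b) / (b - z).
Proof.
move=> r0 br zr bz; have bz0 : b - z != 0 by rewrite subr_eq0.
rewrite -!winding_sum // -sumrB mulr_suml /fractions big_map big_seq [RHS]big_seq.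
apply: eq_bigr => w hw /=; have hx := circle_pt_modulus a r0 hw.
set x := a + r%:C / w in hx *.
have xb : x - b != 0 by rewrite subr_eq0; apply: contraNneq br => <-; rewrite hx.
have xz : x - z != 0 by rewrite subr_eq0; apply: contraNneq zr => <-; rewrite hx.
have bx : b - x != 0 by rewrite -opprB oppr_eq0.
clearbody x; rewrite -(mulrA _ (r%:C / w)); set k := r%:C / w / _; clearbody k; field.
by rewrite bz0 xb xz bx.
Qed.

Lemma circle_terms_gen_lim (K : set C) iz ib a r k e b eta : 0 < r -> 0 <= k -> k < 1 ->
  0 < e -> 0 < eta ->
  (forall z, K z -> on_side iz a r k z /\ e <= modulus (b - z)) -> on_side ib a r k b ->
  \forall m \near \oo, forall z, K z ->
    modulus (fractions (circle_terms (fun w => (b - w)^-1) a r m) z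
             - (iz%:R - ib%:R) / (b - z)) <= eta.
Proof.
move=> r0 k0 k1 e0 eta0 hK hb.
have off i x : on_side i a r k x -> modulus (x - a) != r.
  by case: i; rewrite /on_side => h; apply/eqP => xr; move: h; rewrite xr; nra.
have d0 : 0 < eta * e / 2 by rewrite divr_gt0 // mulr_gt0.
have := winding_lim ib a r0 k0 k1 d0; have := winding_lim iz a r0 k0 k1 d0.
apply: filterS2 => m h1 h2 z Kz; have [zs ez] := hK z Kz.
have bz : b != z by rewrite -subr_eq0 -modulus_gt0 (lt_le_trans e0).
rewrite circle_terms_gen ?(off _ _ hb) ?(off _ _ zs) // -mulrBl modulusfV.
rewrite ler_pdivrMr ?(lt_le_trans e0) //.
apply: (@le_trans _ _ (eta * e)); last by rewrite ler_pM2l.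
have -> : winding a r m z - winding a r m b - (iz%:R - ib%:R) =
  (winding a r m z - iz%:R) - (winding a r m b - ib%:R) by ring.
apply: le_trans (ler_modulusD _ _) _; rewrite modulusN.
by have := h1 z zs; have := h2 b hb; lra.
Qed.

End DiscreteCauchy.

Section Decomposition.
Variable R : realType.
Local Notation C := R[i].
Local Open Scope complex_scope.

Definition uniform_lim (K : set C) (F : nat -> C -> C) (G : C -> C) :=
  forall e : R, 0 < e -> \forall m \near \oo, forall z, K z -> modulus (F m z - G z) <= e.

Lemma uniform_limD K F1 F2 G1 G2 : uniform_lim K F1 G1 -> uniform_lim K F2 G2 ->
  uniform_lim K (fun m z => F1 m z + F2 m z) (fun z => G1 z + G2 z).
Proof.
move=> h1 h2 e e0; have e2 : 0 < e / 2 by rewrite divr_gt0.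
apply: filterS2 (h1 _ e2) (h2 _ e2) => m k1 k2 z Kz.
by rewrite opprD addrACA (le_trans (ler_modulusD _ _)) // (splitr e) lerD ?k1 ?k2.
Qed.

Lemma uniform_limZ K F G (k : C) : uniform_lim K F G ->
  uniform_lim K (fun m z => k * F m z) (fun z => k * G z).
Proof.
move=> h e e0; have k1 : 0 < modulus k + 1 by rewrite ltr_wpDl ?modulus_ge0.
apply: filterS (h (e / (modulus k + 1)) _) => [m hm z Kz|]; last by rewrite divr_gt0.
rewrite -mulrBr modulusM; apply: (@le_trans _ _ ((modulus k + 1) * (e / (modulus k + 1)))).
  by rewrite ler_pM ?modulus_ge0 ?hm // lerDl.
by rewrite mulrCA mulfV ?gt_eqF // mulr1.
Qed.

Lemma uniform_lim_sum (I : eqType) (s : seq I) K (F : I -> nat -> C -> C) G :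
  (forall i, i \in s -> uniform_lim K (F i) (G i)) ->
  uniform_lim K (fun m z => \sum_(i <- s) F i m z) (fun z => \sum_(i <- s) G i z).
Proof.
elim: s => [|i s IH] H.
  by move=> e e0; apply: filterE => m z _; rewrite !big_nil subrr modulus0 ltW.
have IH' : uniform_lim K (fun m z => \sum_(i <- s) F i m z) (fun z => \sum_(i <- s) G i z).
  by apply: IH => x xs; apply: H; rewrite inE xs orbT.
have := uniform_limD (H i (mem_head _ _)) IH'.
by move=> h e /h; apply: filterS => m hm z /hm; rewrite !big_cons.
Qed.

Lemma uniform_lim_ext K F1 G1 F2 G2 : (forall m z, K z -> F1 m z = F2 m z) ->
  (forall z, K z -> G1 z = G2 z) -> uniform_lim K F1 G1 -> uniform_lim K F2 G2.
Proof.
by move=> h1 h2 h e /h; apply: filterS => m hm z Kz; rewrite -h1 // -h2 // hm.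
Qed.

Lemma on_side_le i (a x : C) (r k k' : R) : 0 < r -> k <= k' -> on_side i a r k x -> on_side i a r k' x.
Proof.
move=> r0 kk; case: i; rewrite /on_side => h; apply: (le_trans h).
  by rewrite ler_wpM2r // ltW.
by rewrite ler_wpM2r // modulus_ge0.
Qed.

Lemma on_side_exists (a x : C) (r : R) : 0 < r -> modulus (x - a) != r ->
  exists2 k, 0 <= k < 1 & on_side (modulus (x - a) < r) a r k x.
Proof.
move=> r0; case: ltgtP => // h _.
  exists (modulus (x - a) / r); last by rewrite /on_side divfK ?gt_eqF.
  by rewrite divr_ge0 ?modulus_ge0 ?(ltW r0) //= ltr_pdivrMr // mul1r.
have x0 : 0 < modulus (x - a) by apply: lt_trans h.
exists (r / modulus (x - a)); last by rewrite /on_side divfK ?gt_eqF.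
by rewrite divr_ge0 ?modulus_ge0 ?(ltW r0) //= ltr_pdivrMr // mul1r.
Qed.

(** Separated discs: at most one of them contains a given point. *)
Lemma separated_sum (s : seq (cluster R)) b : separated s ->
  \sum_(c <- s) (modulus (b - ccenter c) < cradius c)%R%:R =
  (has (fun c => modulus (b - ccenter c) < cradius c) s)%:R :> C.
Proof.
elim: s => [|c s IH]; first by rewrite big_nil.
rewrite /separated pairwise_cons => /andP[/allP cs ss]; rewrite big_cons IH //=.
case: (ltP _ (cradius c)) => hc /=; last by rewrite add0r.
rewrite (_ : has _ s = false) ?addr0 //; apply/negbTE/hasPn => c' c's.
rewrite -leNgt; have := cs _ c's; rewrite /cdisjoint.
have := ler_modulus_distD b (ccenter c) (ccenter c'); rewrite (modulusBC (ccenter c) b); lra.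
Qed.

Section Cauchy.
Variables (K : set C) (d : R) (s : seq (cluster R)) (t : R).
Hypothesis K1 : forall z, K z -> modulus z <= 1.
Hypothesis vs : forall c, c \in s -> valid_cluster K d c.
Hypothesis ss : separated s.
Hypothesis small : \sum_(c <- s) cweight c <= 8^-1.
Hypothesis t32 : 3 / 2 <= t.
Hypothesis t2 : t <= 2.
Hypothesis ins : forall c, c \in s -> modulus (ccenter c) + cradius c < t.

Definition holed_disc : set C := [set w | modulus w <= t /\ forall c, c \in s -> cradius c <= modulus (w - ccenter c)].

Lemma cweight_ge0 c : c \in s -> 0 <= cweight c.
Proof.
move=> /vs[r0 s0 _ _ h _ _]; rewrite -(pmulr_rge0 _ s0); apply: le_trans h; exact: ltW.
Qed.

Lemma cweight_le8 c : c \in s -> cweight c <= 8^-1.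
Proof.
move=> cs; apply: le_trans small; rewrite (perm_big _ (perm_to_rem cs)) big_cons lerDl.
by rewrite big_seq sumr_ge0 // => x /mem_rem; exact: cweight_ge0.
Qed.

Lemma cluster_far c z : c \in s -> K z ->
  cradius c <= 8^-1 * cscale c /\ 7 / 8 * cscale c <= modulus (z - ccenter c).
Proof.
move=> cs Kz; have w8 := cweight_le8 cs; have [r0 s0 s1 t0 rle wt [p hp pK]] := vs cs.
have h : cradius c <= 8^-1 * cscale c.
  by apply: le_trans rle _; rewrite mulrC ler_wpM2r // ltW.
split=> //; have := pK z Kz; have := ler_modulus_distD (ccenter c) p z.
rewrite (modulusBC (ccenter c)); lra.
Qed.

Let circ_far c x z : c \in s -> K z -> modulus (x - ccenter c) = cradius c ->
  cscale c / 2 <= modulus (x - z).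
Proof.
move=> cs Kz hx; have [h1 h2] := cluster_far cs Kz.
have := ler_modulus_distD x z (ccenter c); rewrite hx (modulusBC z x).
have := cscale_gt0 (vs cs); lra.
Qed.

Let outer_far x z : K z -> modulus (x - 0) = t -> 2^-1 <= modulus (x - z).
Proof.
by have T32 := t32; rewrite subr0 => /K1 h1 hx; have := ler_modulusB x z; rewrite hx; lra.
Qed.

Lemma holed_disc_K z : K z -> holed_disc z.
Proof.
move=> Kz; have T32 := t32; split; first by have := K1 Kz; lra.
by move=> c cs; have [h1 h2] := cluster_far cs Kz; have := cscale_gt0 (vs cs); lra.
Qed.

Lemma holed_disc_outer x : modulus (x - 0) = t -> holed_disc x.
Proof.
rewrite subr0 => hx; split; first by rewrite hx.
by move=> c /ins; have := ler_modulusB x (ccenter c); rewrite hx; lra.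
Qed.

Lemma holed_disc_inner c x : c \in s -> modulus (x - ccenter c) = cradius c -> holed_disc x.
Proof.
move=> cs hx; split.
  by have := ins cs; have := ler_modulusB x (ccenter c); rewrite hx; lra.
move=> c' c's; have [->|cc'] := eqVneq c' c; first by rewrite hx.
have h : cdisjoint c c'.
  move: cs c's cc'; move: (ss); rewrite /separated; elim: (s) => // y l IH.
  rewrite pairwise_cons !inE => /andP[/allP hy hl] /predU1P[->|cl] /predU1P[->|c'l] cc'.
  - by rewrite eqxx in cc'.
  - exact: hy.
  - by rewrite cdisjointC; exact: hy.
  - exact: IH.
move: h; rewrite /cdisjoint; have := ler_modulus_distD x (ccenter c) (ccenter c').
by rewrite (modulusBC (ccenter c) x) hx; lra.
Qed.

Lemma not_holed_disc b : ~ holed_disc b -> t < modulus b \/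
  exists2 c, c \in s & modulus (b - ccenter c) < cradius c.
Proof.
move=> nb; have [h|h] := ltP t (modulus b); [by left|right].
apply: contrapT => H; apply: nb; split=> // c cs; rewrite leNgt; apply/negP => hc.
by apply: H; exists c.
Qed.

Lemma holed_disc_far_off b : ~ holed_disc b ->
  exists2 e : R, 0 < e & forall w, holed_disc w -> e <= modulus (b - w).
Proof.
case/not_holed_disc => [h|[c cs h]].
  exists (modulus b - t) => [|w [wt _]]; first by rewrite subr_gt0.
  by have := ler_modulusB b w; lra.
exists (cradius c - modulus (b - ccenter c)) => [|w [_ /(_ c cs)]]; first by rewrite subr_gt0.
by have := ler_modulus_distD b w (ccenter c); rewrite (modulusBC w b); lra.
Qed.

(** The Riemann sum of the Cauchy integral over the boundary of the holed disc. *)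
Definition cauchy_sum (q : C -> C) m (z : C) : C :=
  fractions (circle_terms q 0 t m) z -
  \sum_(c <- s) fractions (circle_terms q (ccenter c) (cradius c) m) z.

Let t0 : 0 < t. Proof. by have T32 := t32; lra. Qed.

(** The Cauchy formula for [1 / (b - w)] with [b] off the holed disc.  Every
circle contributes the difference of the winding numbers around [z] and around
[b]; their sum, with the holes counted negatively, is 1, whether [b] is in one
of the holes or outside the big disc. *)
Lemma cauchy_sum_gen b : ~ holed_disc b ->
  uniform_lim K (cauchy_sum (fun w => (b - w)^-1)) (fun z => (b - z)^-1).
Proof.
move=> nb; have T32 := t32; have [e e0 he] := holed_disc_far_off nb.
have bt : modulus (b - 0) != t by apply/eqP => /holed_disc_outer.
have br c : c \in s -> modulus (b - ccenter c) != cradius c.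
  by move=> cs; apply/eqP => /(holed_disc_inner cs).
have outer : uniform_lim K (fun m => fractions (circle_terms (fun w => (b - w)^-1) 0 t m))
    (fun z => (1 - (modulus (b - 0) < t)%R%:R) / (b - z)).
  move=> eta eta0; have [k /andP[k0 k1] hk] := on_side_exists t0 bt.
  pose k' := Num.max k (2 / 3).
  have kk : k <= k' by rewrite le_max lexx.
  have k3 : 2 / 3 <= k' by rewrite le_max lexx orbT.
  apply: (circle_terms_gen_lim (iz := true) (k := k') (e := e)) => //.
  - exact: le_trans kk.
  - by rewrite gt_max k1; lra.
  - move=> z Kz; split; last by apply: he; exact: holed_disc_K.
    by rewrite /on_side subr0; have := K1 Kz; nra.
  - exact: on_side_le hk.
have inner c : c \in s -> uniform_lim K
    (fun m => fractions (circle_terms (fun w => (b - w)^-1) (ccenter c) (cradius c) m))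
    (fun z => (- (modulus (b - ccenter c) < cradius c)%R%:R) / (b - z)).
  move=> cs eta eta0; have r0 := cradius_gt0 (vs cs).
  have [k /andP[k0 k1] hk] := on_side_exists r0 (br _ cs).
  pose k' := Num.max k 2^-1.
  have kk : k <= k' by rewrite le_max lexx.
  have k3 : 2^-1 <= k' by rewrite le_max lexx orbT.
  have := @circle_terms_gen_lim R K false (modulus (b - ccenter c) < cradius c) (ccenter c)
    (cradius c) k' e b eta r0.
  rewrite /= sub0r; apply => //.
  - exact: le_trans kk.
  - by rewrite gt_max k1; lra.
  - move=> z Kz; split; last by apply: he; exact: holed_disc_K.
    by rewrite /on_side; have [h1 h2] := cluster_far cs Kz; have := cscale_gt0 (vs cs); nra.
  - exact: on_side_le hk.
have := uniform_limD outer (uniform_limZ (-1) (uniform_lim_sum inner)).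
apply: uniform_lim_ext => [m z _|z Kz]; first by rewrite mulN1r.
rewrite -mulr_suml mulN1r -mulNr -mulrDl sumrN opprK separated_sum //.
suff -> : has (fun c => modulus (b - ccenter c) < cradius c) s = (modulus (b - 0) < t).
  by rewrite subrK mul1r.
rewrite subr0; apply/hasP/idP => [[c cs hc]|bt'].
  by have := ins cs; have := ler_modulusB b (ccenter c); lra.
have [|[c cs hc]] := not_holed_disc nb; last by exists c.
by rewrite ltNge (ltW bt').
Qed.

Lemma cauchy_sum_fractions L : fractions_off holed_disc L ->
  uniform_lim K (cauchy_sum (fractions L)) (fractions L).
Proof.
move=> oL; have h p : p \in L -> uniform_lim K
    (fun m z => p.1 * cauchy_sum (fun w => (p.2 - w)^-1) m z) (fun z => p.1 * (p.2 - z)^-1).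
  by move=> /oL hp; apply: uniform_limZ; exact: cauchy_sum_gen.
apply: uniform_lim_ext (uniform_lim_sum h) => // m z _.
rewrite /cauchy_sum /fractions.
under eq_bigr do rewrite mulrBr.
rewrite sumrB; congr (_ - _); first by rewrite -circle_terms_sum.
under eq_bigr do rewrite mulr_sumr.
rewrite exchange_big /=; apply: eq_bigr => c _.
by rewrite -circle_terms_sum.
Qed.

Lemma cauchy_sum_bound q m z e : 0 <= e -> (forall w, holed_disc w -> modulus (q w) <= e) -> K z ->
  modulus (cauchy_sum q m z) <= 5 * e.
Proof.
move=> e0 hq Kz; have T32 := t32; have T2 := t2; have S8 := small; apply: le_trans (ler_modulusD _ _) _; rewrite modulusN.
have h1 : modulus (fractions (circle_terms q 0 t m) z) <= 4 * e.
  have h : total_weight (circle_terms q 0 t m) <= t * e.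
    by apply: circle_terms_weight => // x /holed_disc_outer; exact: hq.
  apply: le_trans (fractions_bound (e := 2^-1) _ _) _ => //.
    by move=> p /(circle_terms_poles t0); exact: outer_far.
  by rewrite invrK; nra.
have h2 : modulus (\sum_(c <- s) fractions (circle_terms q (ccenter c) (cradius c) m) z) <=
    \sum_(c <- s) cweight c * (2 * e).
  apply: le_trans (ler_modulus_sum _ _ _) _; rewrite big_seq [leRHS]big_seq.
  apply: ler_sum => c cs; have [r0 s0 s1 _ rle _ _] := vs cs.
  have h : total_weight (circle_terms q (ccenter c) (cradius c) m) <= cradius c * e.
    by apply: circle_terms_weight => // x /(holed_disc_inner cs); exact: hq.
  apply: le_trans (fractions_bound (e := cscale c / 2) _ _) _.
  - by rewrite divr_gt0.
  - by move=> p /(circle_terms_poles r0); exact: circ_far.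
  rewrite ler_pdivrMr ?divr_gt0 //; apply: le_trans h _.
  have : 0 <= (cscale c * cweight c - cradius c) * e by rewrite mulr_ge0 ?subr_ge0.
  by lra.
rewrite -mulr_suml in h2; nra.
Qed.

(** The Cauchy formula for a uniform limit of simple fractions: it holds for each
fraction, and the averages are bounded by a multiple of the supremum of the
function. *)
Lemma cauchy_sum_lim q : fractionable holed_disc q -> uniform_lim K (cauchy_sum q) q.
Proof.
move=> hq e e0; (* 12 = 2 * (1 + 5), where 5 is the norm of the averages. *)
have [|L oL hL] := hq (e / 12); first by rewrite divr_gt0.
have e2 : 0 < e / 2 by rewrite divr_gt0.
apply: filterS (cauchy_sum_fractions oL e2) => m hm z Kz.
have h1 := hm z Kz; have h2 := hL z (holed_disc_K Kz).
have h3 : modulus (cauchy_sum (fun w => q w - fractions L w) m z) <= 5 * (e / 12).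
  by apply: cauchy_sum_bound => //; rewrite divr_ge0 // ltW.
have e3 : cauchy_sum (fun w => q w - fractions L w) m z =
    cauchy_sum q m z - cauchy_sum (fractions L) m z.
  rewrite /cauchy_sum circle_terms_sub.
  under eq_bigr do rewrite circle_terms_sub.
  by rewrite sumrB; ring.
rewrite e3 in h3.
have k1 := ler_modulus_distD (cauchy_sum (fractions L) m z) (cauchy_sum q m z) (q z).
have k2 := ler_modulus_distD (fractions L z) (cauchy_sum (fractions L) m z) (q z).
by move: k2; rewrite (modulusBC (fractions L z) (q z)); lra.
Qed.

(** The circles at a distance of order at least [d] from [K] are kept; the
contribution of a hole closer to [K] is at most twice its radius divided by
its distance from [K], times [M]. *)
Lemma cauchy_sum_split q M eta : 0 < d -> d <= 1 -> 0 < M -> 0 < eta -> fractionable holed_disc q ->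
  (forall w, holed_disc w -> modulus (q w) <= M) ->
  exists L : seq (C * C), [/\ forall p z, p \in L -> K z -> d / 2 <= modulus (p.2 - z),
    total_weight L <= 3 * M &
    forall z, K z -> modulus (q z - fractions L z) <= 2 * M * (\sum_(c <- s) ctail c) + eta].
Proof.
move=> d0 d1 M0 eta0 fq qM; have T32 := t32; have T2 := t2.
have [m _ /(_ m (leqnn m)) hm] := cauchy_sum_lim fq eta0.
pose inn := [seq c <- s | d <= cscale c].
pose ct c := circle_terms q (ccenter c) (cradius c) m.
pose L := circle_terms q 0 t m ++ scale_fractions (-1) (flatten [seq ct c | c <- inn]).
have fL z : fractions L z = fractions (circle_terms q 0 t m) z - \sum_(c <- s | d <= cscale c) fractions (ct c) z.
  rewrite fractions_cat fractions_scale mulN1r; congr (_ - _).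
  rewrite -big_filter -/inn; elim: (inn) => [|c l IH]; first by rewrite /fractions !big_nil.
  by rewrite /= fractions_cat IH big_cons.
exists L; split.
- move=> p z; rewrite mem_cat => /orP[/(circle_terms_poles t0) h Kz|].
    by have := outer_far Kz h; lra.
  move=> /mapP[p' /flatten_mapP[c]]; rewrite mem_filter => /andP[dc cs].
  move=> /(circle_terms_poles (cradius_gt0 (vs cs))) h -> Kz /=.
  by have := circ_far cs Kz h; lra.
- rewrite total_weight_cat total_weight_scale modulusN modulus1 mul1r.
  have h1 : total_weight (circle_terms q 0 t m) <= t * M.
    by apply: circle_terms_weight => // x /holed_disc_outer; exact: qM.
  have h2 : total_weight (flatten [seq ct c | c <- inn]) <= \sum_(c <- inn) cradius c * M.
    have : {subset inn <= s} by move=> c; rewrite mem_filter => /andP[].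
    elim: (inn) => [|c l IH] sub; first by rewrite /total_weight !big_nil.
    rewrite /= total_weight_cat big_cons lerD //.
      have cs : c \in s by apply: sub; rewrite mem_head.
      apply: circle_terms_weight; first exact: cradius_gt0 (vs cs).
      by move=> x /(holed_disc_inner cs); exact: qM.
    by apply: IH => x xl; apply: sub; rewrite inE xl orbT.
  have h3 : \sum_(c <- inn) cradius c <= 8^-1.
    apply: le_trans small; rewrite big_filter big_mkcond big_seq [leRHS]big_seq.
    apply: ler_sum => c cs; have w0 := cweight_ge0 cs; case: ifP => // _.
    have [_ s0 s1 _ rle _ _] := vs cs.
    by apply: le_trans rle _; rewrite ler_piMl.
  rewrite -mulr_suml in h2; nra.
move=> z Kz; have h1 := hm z Kz.
have e : cauchy_sum q m z = fractions L z - \sum_(c <- s | ~~ (d <= cscale c)) fractions (ct c) z.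
  by rewrite fL /cauchy_sum (bigID (fun c => d <= cscale c)) /= opprD addrA.
have h2 : modulus (\sum_(c <- s | ~~ (d <= cscale c)) fractions (ct c) z) <=
    2 * M * (\sum_(c <- s) ctail c).
  apply: le_trans (ler_modulus_sum _ _ _) _; rewrite mulr_sumr big_mkcond.
  rewrite big_seq [leRHS]big_seq; apply: ler_sum => c cs.
  have [r0 s0 s1 tl0 rle wt _] := vs cs.
  case: ifPn => [|_]; last by rewrite !mulr_ge0 // ltW.
  rewrite -ltNge => /wt wt'.
  have h : total_weight (ct c) <= cradius c * M.
    by apply: circle_terms_weight => // x /(holed_disc_inner cs); exact: qM.
  apply: le_trans (fractions_bound (e := cscale c / 2) _ _) _.
  - by rewrite divr_gt0.
  - by move=> p /(circle_terms_poles r0); exact: circ_far.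
  rewrite ler_pdivrMr ?divr_gt0 //; apply: le_trans h _.
  have : 0 <= (cscale c * cweight c - cradius c) * M by rewrite mulr_ge0 ?subr_ge0 // ltW.
  have : 0 <= (ctail c - cweight c) * (cscale c * M).
    by rewrite mulr_ge0 ?subr_ge0 // mulr_ge0 // ltW.
  by lra.
rewrite e in h1.
set S := \sum_(c <- s | _) _ in h1 h2.
have -> : q z - fractions L z = - (fractions L z - S - q z) - S by ring.
by rewrite (le_trans (ler_modulusD _ _)) // !modulusN addrC lerD.
Qed.

End Cauchy.

(** A rational function bounded by [M] off the discs [s] is on [K] a sum of
simple fractions with poles far from [K] and coefficients under control, up to
an error governed by the discs that are close to [K].  The discs may overlap;
they are first merged into separated ones, and the radius of the outer circle
is chosen so that this circle meets none of them. *)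
Lemma cauchy_decomposition (K : set C) (d M eta : R) (s : seq (cluster R)) (P Q : {poly C}) :
  0 < d -> d <= 1 -> 0 < M -> 0 < eta ->
  (forall z, K z -> modulus z <= 1) ->
  (forall c, c \in s -> valid_cluster K d c) ->
  \sum_(c <- s) cweight c <= 8^-1 ->
  (forall w, modulus w <= 2 -> (forall c, c \in s -> cradius c <= modulus (w - ccenter c)) ->
    Q.[w] != 0 /\ modulus (P.[w] / Q.[w]) <= M) ->
  exists L : seq (C * C), [/\ forall p z, p \in L -> K z -> d / 2 <= modulus (p.2 - z),
    total_weight L <= 3 * M &
    forall z, K z -> modulus (P.[z] / Q.[z] - fractions L z) <= 2 * M * (\sum_(c <- s) ctail c) + eta].
Proof.
move=> d0 d1 M0 eta0 K1 vs small hPQ.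
have [s1 [v1 sep1 w1 t1 in1]] := separate_clusters vs.
have w10 c : c \in s1 -> 0 <= cweight c.
  move=> /v1[r0 s0 _ _ h _ _]; rewrite -(pmulr_rge0 _ s0); apply: le_trans h; exact: ltW.
have r1 : \sum_(c <- s1) cradius c <= 8^-1.
  apply: le_trans small; rewrite -w1 big_seq [leRHS]big_seq; apply: ler_sum => c cs.
  have [_ s0 s1' _ rle _ _] := v1 c cs.
  by apply: le_trans rle _; rewrite ler_piMl ?w10.
have [||t [t32 t2 ht]] := @avoid_intervals R [seq (modulus (ccenter c), cradius c) | c <- s1] (3 / 2) 2.
- by move=> _ /mapP[c /v1 [r0 _ _ _ _ _ _] -> /=]; exact: ltW.
- by rewrite big_map /=; lra.
pose s2 := [seq c <- s1 | modulus (ccenter c) + cradius c < t].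
have s21 c : c \in s2 -> c \in s1 by rewrite mem_filter => /andP[].
have v2 c : c \in s2 -> valid_cluster K d c by move=> /s21 /v1.
have sep2 : separated s2 by apply: subseq_pairwise sep1; exact: filter_subseq.
have le2 (F : cluster R -> R) : (forall c, c \in s1 -> 0 <= F c) ->
    \sum_(c <- s2) F c <= \sum_(c <- s1) F c.
  move=> F0; rewrite big_filter big_mkcond big_seq [leRHS]big_seq; apply: ler_sum => c cs.
  by case: ifP => // _; exact: F0.
have small2 : \sum_(c <- s2) cweight c <= 8^-1 by apply: le_trans small; rewrite -w1; exact: le2.
have ins2 c : c \in s2 -> modulus (ccenter c) + cradius c < t by rewrite mem_filter => /andP[].
have hY w : holed_disc s2 t w -> Q.[w] != 0 /\ modulus (P.[w] / Q.[w]) <= M.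
  move=> [wt ws]; apply: hPQ; first by rewrite (le_trans wt) // ltW.
  move=> c /in1[c1 c1s]; rewrite /cinside => h.
  have k1 := ler_modulus_distD (ccenter c) w (ccenter c1).
  have /= [out|ins] := ht _ (map_f _ c1s).
    have k2 := ler_modulusB (ccenter c1) w; rewrite (modulusBC (ccenter c1) w) in k2; lra.
  by have := ws c1; rewrite mem_filter ins c1s => /(_ isT); lra.
have [[z0 Kz0]|noK] := pselect (K !=set0); last first.
  exists [::]; split=> //; first by rewrite /total_weight big_nil mulr_ge0 // ltW.
  by move=> z Kz; case: noK; exists z.
have Q0 : Q != 0.
  have [Qz _] := hY z0 (holed_disc_K K1 v2 small2 t32 Kz0).
  by apply: contraNneq Qz => ->; rewrite horner0.
have fq : fractionable (holed_disc s2 t) (fun w => P.[w] / Q.[w]).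
  apply: (@fractionable_rational R _ t) => //.
  - by move=> w [].
  - by lra.
  - exact: holed_disc_far_off.
  - by move=> b rb /hY [/negP]; rewrite -/(root Q b).
have [L [h1 h2 h3]] := cauchy_sum_split K1 v2 sep2 small2 t32 (ltW t2) ins2 d0 d1 M0 eta0 fq
  (fun w hw => (hY w hw).2).
exists L; split=> // z Kz; apply: le_trans (h3 z Kz) _; rewrite lerD2r ler_pM2l ?mulr_gt0 //.
by rewrite -t1; apply: le2 => c /v1[].
Qed.

End Decomposition.

(** * Propagation of smallness along a vertical segment *)

Section Propagation.
Variable R : realType.
Local Notation C := R[i].
Local Open Scope complex_scope.

(** Lagrange interpolation of [1 / (b - z)] at the nodes [xs].  What matters is
that the coefficients depend on [z] and on the nodes but not on the pole [b],
so that the same formula applies to every sum of simple fractions. *)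
Lemma interpolation (g D : R) (n : nat) : 0 < g -> 0 < D -> exists2 La : R, 0 <= La &
  forall (xs : seq C) z, size xs = n ->
    pairwise (fun x y => g <= modulus (x - y) <= D) xs ->
    (forall x, x \in xs -> modulus (z - x) <= D) ->
  exists l : seq (C * C), [/\ forall p, p \in l -> p.2 \in xs, total_weight l <= La &
    forall b, b != z -> (forall x, x \in xs -> b != x) ->
      (b - z)^-1 - \sum_(p <- l) p.1 / (b - p.2) =
      (b - z)^-1 * \prod_(x <- xs) ((z - x) / (b - x))].
Proof.
move=> g0 D0; elim: n => [|n [La La0 IH]].
  exists 0 => // -[|//] z _ _ _; exists [::]; split=> //; first by rewrite /total_weight big_nil.
  by move=> b _ _; rewrite !big_nil subr0 mulr1.
have kap0 : 0 <= (D / g) ^+ n by rewrite exprn_ge0 // divr_ge0 // ltW.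
exists (La + (D / g) ^+ n * (1 + La)); first by rewrite addr_ge0 // mulr_ge0 // addr_ge0.
move=> [//|x xs] z /= [sn] /andP[/allP hx pw] hz.
have [|lz [oz wz ez]] := IH xs z sn pw; first by move=> y ys; apply: hz; rewrite inE ys orbT.
have [|lx [ox wx ex]] := IH xs x sn pw; first by move=> y /hx /andP[].
pose kap := \prod_(y <- xs) ((z - y) / (x - y)).
have hkap : modulus kap <= (D / g) ^+ n.
  rewrite modulus_prod -sn -(size_map id xs) map_id.
  have h y : y \in xs -> modulus ((z - y) / (x - y)) <= D / g.
    move=> ys; have /andP[h1 _] := hx y ys; rewrite modulusfV ler_pM ?modulus_ge0 ?invr_ge0 ?modulus_ge0 //.
      by apply: hz; rewrite inE ys orbT.
    by rewrite lef_pV2 ?posrE // (lt_le_trans g0).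
  elim: (xs) h => [|y l IHl] h; first by rewrite big_nil.
  rewrite big_cons exprS ler_pM ?modulus_ge0 ?h ?mem_head //.
    by apply: prodr_ge0 => i _; exact: modulus_ge0.
  by apply: IHl => i il; apply: h; rewrite inE il orbT.
exists (lz ++ (kap, x) :: scale_fractions (- kap) lx); split.
- move=> p; rewrite mem_cat inE => /or3P[/oz h|/eqP->|/mapP[q /ox h ->]].
  + by rewrite inE h orbT.
  + by rewrite inE eqxx.
  + by rewrite inE h orbT.
- rewrite total_weight_cat lerD // /total_weight big_cons -/(total_weight _) total_weight_scale /=.
  rewrite modulusN -{1}(mulr1 (modulus kap)) -mulrDr ler_pM ?modulus_ge0 // ?lerD2l //.
  by rewrite addr_ge0 // sumr_ge0 // => i _; exact: modulus_ge0.
move=> b bz bxs.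
have bx : b - x != 0 by rewrite subr_eq0; apply: bxs; rewrite mem_head.
have bz0 : b - z != 0 by rewrite subr_eq0.
have bxs' y : y \in xs -> b != y by move=> ys; apply: bxs; rewrite inE ys orbT.
have {}ez := ez b bz bxs'; have {}ex := ex b; rewrite -subr_eq0 in ex; have {}ex := ex bx bxs'.
rewrite big_cat big_cons big_cons /= big_map /=.
have -> : \sum_(p <- lx) - kap * p.1 / (b - p.2) = - kap * \sum_(p <- lx) p.1 / (b - p.2).
  by rewrite mulr_sumr; apply: eq_bigr => p _; rewrite mulrA.
have hp : kap * \prod_(y <- xs) ((x - y) / (b - y)) = \prod_(y <- xs) ((z - y) / (b - y)).
  rewrite -big_split big_seq [RHS]big_seq; apply: eq_bigr => y ys /=.
  have /andP[h1 _] := hx y ys.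
  have xy : x - y != 0 by rewrite -modulus_gt0 (lt_le_trans g0).
  have by0 : b - y != 0 by rewrite subr_eq0 bxs'.
  by field; rewrite xy by0.
set Sz := \sum_(p <- lz) _ in ez *; set Sx := \sum_(p <- lx) _ in ex *.
set Pz := \prod_(y <- xs) ((z - y) / (b - y)) in ez hp *.
set Px := \prod_(y <- xs) _ in ex hp.
have e1 : (b - z)^-1 * ((z - x) / (b - x) * Pz) = (b - z)^-1 * Pz - (b - x)^-1 * Pz.
  by field; rewrite bz0 bx.
rewrite e1 -ez -[in X in _ = _ - _ * X]hp mulrCA -ex; ring.
Qed.

Definition vert (a s : R) : C := a +i* s.

Lemma modulus_vert a s s' : modulus (vert a s - vert a s') = `|s - s'|.
Proof. by rewrite modulusE ReB ImB /= subrr expr0n add0r sqrtr_sqr. Qed.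

(** Interpolate at [n + 1] equidistant nodes of the interval: a pole at distance
[de >= 4 l] contributes to the remainder at most [2 ^ - n / de] times the
modulus of its coefficient, and the interpolating sum is small when the
function is small at the nodes. *)
Lemma propagation_step (de l eta : R) : 0 < de -> 0 < l -> 4 * l <= de -> 0 < eta ->
  exists2 tau : R, 0 < tau &
  forall (L : seq (C * C)) a u t, total_weight L <= 1 -> u - l <= t <= u + 2 * l ->
    (forall p s, p \in L -> s \in `[u, u + l] -> de <= modulus (p.2 - vert a s)) ->
    (forall p, p \in L -> de <= modulus (p.2 - vert a t)) ->
    (forall s, s \in `[u, u + l] -> modulus (fractions L (vert a s)) <= tau) ->
    modulus (fractions L (vert a t)) <= eta.
Proof.
move=> de0 l0 l4 eta0.
have [n hn] : exists n, (2 ^+ n)^-1 <= eta / 2 * de.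
  by apply: exists_pow2_lt; rewrite mulr_gt0 // divr_gt0.
have [La La0 hLa] := @interpolation (l / n.+1%:R) (2 * l) n.+1 (divr_gt0 l0 (ltr0Sn _ _)) (mulr_gt0 (ltr0Sn _ _) l0).
have La1 : 0 < 2 * (La + 1) by lra.
exists (eta / (2 * (La + 1))); first by rewrite divr_gt0.
move=> L a u t L1 /andP[t1 t2] hs ht Gs.
pose node (i : nat) := u + l * (i%:R / n.+1%:R).
pose xs := [seq vert a (node i) | i <- iota 0 n.+1].
have node_in i : (i < n.+1)%N -> node i \in `[u, u + l].
  move=> i1; have n0 : 0 < n.+1%:R :> R by rewrite ltr0Sn.
  rewrite in_itv /= /node lerDl mulr_ge0 ?divr_ge0 ?(ltW l0) //= lerD2l ler_piMr ?(ltW l0) //.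
  by rewrite ler_pdivrMr // mul1r ler_nat ltnW.
have xsP x : x \in xs -> exists2 i, (i < n.+1)%N & x = vert a (node i).
  by move=> /mapP[j]; rewrite mem_iota add0n => /andP[_ h] ->; exists j.
have [|||q [oq wq qE]] := hLa xs (vert a t) _ _ _.
- by rewrite size_map size_iota.
- rewrite /xs pairwise_map.
  apply: (@sub_in_pairwise _ (fun k => (k < n.+1)%N) ltn) _; last first.
  + by rewrite -sorted_pairwise ?iota_ltn_sorted //; exact: ltn_trans.
  + by apply/allP => k; rewrite mem_iota.
  move=> i j hi hj ij.
  rewrite /relpre /= modulus_vert distrC.
  have n0 : 0 < n.+1%:R :> R by rewrite ltr0Sn.
  have -> : node j - node i = (j - i)%:R * (l / n.+1%:R).
    by rewrite /node natrB 1?ltnW //; field; rewrite gt_eqF.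
  have q0 : 0 < l / n.+1%:R by rewrite divr_gt0.
  have ji : 1 <= (j - i)%:R :> R by rewrite ler1n subn_gt0.
  have jn : (j - i)%:R <= n.+1%:R :> R by rewrite ler_nat leq_subLR (leq_trans (ltnW hj)) // leq_addl.
  have p0 : 0 <= (j - i)%:R * (l / n.+1%:R) by rewrite mulr_ge0 // ltW.
  rewrite ger0_norm //; apply/andP; split; first by rewrite ler_peMl // ltW.
  apply: (@le_trans _ _ (n.+1%:R * (l / n.+1%:R))); first by rewrite ler_pM2r.
  by rewrite mulrCA mulfV ?gt_eqF // mulr1; lra.
- move=> x /xsP[i /node_in]; rewrite in_itv /= => /andP[h1 h2] ->.
  by rewrite modulus_vert ler_norml; apply/andP; split; lra.
have step p : p \in L -> (p.2 - vert a t)^-1 - \sum_(r <- q) r.1 / (p.2 - r.2) =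
    (p.2 - vert a t)^-1 * \prod_(x <- xs) ((vert a t - x) / (p.2 - x)).
  move=> pL; apply: qE; first by rewrite -subr_eq0 -modulus_gt0 (lt_le_trans de0) ?ht.
  by move=> x /xsP[i /node_in h ->]; rewrite -subr_eq0 -modulus_gt0 (lt_le_trans de0) ?hs.
have e : fractions L (vert a t) - \sum_(r <- q) r.1 * fractions L r.2 =
    \sum_(p <- L) p.1 * ((p.2 - vert a t)^-1 * \prod_(x <- xs) ((vert a t - x) / (p.2 - x))).
  under [X in _ - X]eq_bigr do rewrite mulr_sumr.
  rewrite exchange_big /= /fractions -sumrB big_seq [RHS]big_seq; apply: eq_bigr => p pL.
  rewrite -step // mulrBr mulr_sumr; congr (_ - _); apply: eq_bigr => r _; by rewrite mulrCA.
have h1 : modulus (\sum_(r <- q) r.1 * fractions L r.2) <= La * (eta / (2 * (La + 1))).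
  apply: le_trans (ler_modulus_sum _ _ _) _.
  apply: le_trans (ler_wpM2r _ wq); last by rewrite divr_ge0 // ltW.
  rewrite /total_weight mulr_suml big_seq [leRHS]big_seq; apply: ler_sum => r rq.
  rewrite modulusM ler_wpM2l ?modulus_ge0 //.
  by have [i /node_in h ->] := xsP _ (oq r rq); exact: Gs.
have h2 : modulus (fractions L (vert a t) - \sum_(r <- q) r.1 * fractions L r.2) <= eta / 2.
  rewrite e; apply: le_trans (ler_modulus_sum _ _ _) _.
  apply: (@le_trans _ _ (total_weight L * (eta / 2))); last by rewrite ler_piMl // divr_ge0 // ltW.
  rewrite /total_weight mulr_suml big_seq [leRHS]big_seq; apply: ler_sum => p pL.
  rewrite modulusM ler_wpM2l ?modulus_ge0 // modulusM modulusV.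
  have hpr : modulus (\prod_(x <- xs) ((vert a t - x) / (p.2 - x))) <= (2 ^+ n)^-1.
    rewrite modulus_prod; apply: (@le_trans _ _ (\prod_(x <- xs) 2^-1)).
      rewrite big_seq [leRHS]big_seq; apply: ler_prod => x xxs; rewrite modulus_ge0 /=.
      have [i /node_in h ex] := xsP _ xxs.
      have k1 := hs p _ pL h; rewrite -ex in k1.
      rewrite modulusfV ler_pdivrMr; last by apply: lt_le_trans k1.
      move: h; rewrite in_itv /= => /andP[g1 g2].
      have : modulus (vert a t - x) <= 2 * l.
        by rewrite ex modulus_vert ler_norml; apply/andP; split; lra.
      by lra.
    rewrite big_const_seq count_predT size_map size_iota iter_mulr_1 exprVn.
    by rewrite lef_pV2 ?posrE ?exprn_gt0 // ler_eXn2l ?ltr1n.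
  have k1 := ht p pL; apply: (@le_trans _ _ (de^-1 * (eta / 2 * de))).
    by rewrite ler_pM ?invr_ge0 ?modulus_ge0 ?(le_trans hpr) // lef_pV2 ?posrE // (lt_le_trans de0).
  by rewrite mulrCA mulVf ?mulr1 // gt_eqF.
have h3 : La * (eta / (2 * (La + 1))) <= eta / 2.
  rewrite mulrA ler_pdivrMr //; nra.
rewrite -(subrK (\sum_(r <- q) r.1 * fractions L r.2) (fractions L _)).
by rewrite (le_trans (ler_modulusD _ _)) //; lra.
Qed.

Lemma propagation_iter (de l : R) (k : nat) : 0 < de -> 0 < l -> 4 * l <= de -> forall eta : R, 0 < eta ->
  exists2 tau : R, 0 < tau &
  forall (L : seq (C * C)) a lo hi u t, total_weight L <= 1 -> lo <= u -> u + l <= hi ->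
    (forall p s, p \in L -> s \in `[lo, hi] -> de <= modulus (p.2 - vert a s)) ->
    (forall s, s \in `[u, u + l] -> modulus (fractions L (vert a s)) <= tau) ->
    t \in `[lo, hi] -> u - k%:R * l <= t <= u + l + k%:R * l ->
    modulus (fractions L (vert a t)) <= eta.
Proof.
move=> de0 l0 l4; elim: k => [|k IH] eta eta0.
  exists eta => // L a lo hi u t _ _ _ _ h _; rewrite mul0r subr0 addr0 => /h; apply.
have [tau1 tau10 h1] := propagation_step de0 l0 l4 eta0.
have m0 : 0 < Num.min eta tau1 by rewrite lt_min eta0.
have [tau tau0 h2] := IH _ m0.
exists tau => // L a lo hi u t L1 lou uhi hL hG tI; have tI' := tI.
move: tI'; rewrite in_itv /= -natr1 mulrDl mul1r => /andP[lt th] /andP[t1 t2].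
have {}h2 s : s \in `[lo, hi] -> u - k%:R * l <= s <= u + l + k%:R * l ->
    modulus (fractions L (vert a s)) <= Num.min eta tau1 by exact: h2 L1 lou uhi hL hG.
have kl : 0 <= k%:R * l by rewrite mulr_ge0 // ltW.
have step v : lo <= v -> v + l <= hi -> u - k%:R * l <= v -> v <= u + k%:R * l ->
    v - l <= t <= v + 2 * l -> modulus (fractions L (vert a t)) <= eta.
  move=> v1 v2 v3 v4 tv; apply: (h1 L a v t L1 tv).
  - move=> p s pL; rewrite in_itv /= => /andP[s1 s2]; apply: hL => //.
    by rewrite in_itv /=; apply/andP; split; lra.
  - by move=> p pL; apply: hL.
  move=> s; rewrite in_itv /= => /andP[s1 s2].
  apply: (le_trans (h2 s _ _)); last by rewrite ge_min lexx orbT.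
    by rewrite in_itv /=; apply/andP; split; lra.
  by apply/andP; split; lra.
have [tr|tr] := leP t (u + l + k%:R * l); last by apply: (step (u + k%:R * l)); lra.
have [tl|tl] := leP (u - k%:R * l) t; last by apply: (step (u - k%:R * l)); lra.
apply: (le_trans (h2 t tI _)); last by rewrite ge_min lexx.
by rewrite tl tr.
Qed.

(** A quantitative uniqueness principle: the bound [tau] depends on the distance
of the poles from the segment, but neither on their number nor on the
position of the subsegment. *)
Lemma propagation (de l eta : R) : 0 < de -> 0 < l -> 0 < eta ->
  exists2 tau : R, 0 < tau &
  forall (L : seq (C * C)) a u, total_weight L <= 1 -> - 2^-1 <= u -> u + l <= 2^-1 ->
    (forall p s, p \in L -> s \in `[- 2^-1, 2^-1] -> de <= modulus (p.2 - vert a s)) ->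
    (forall s, s \in `[u, u + l] -> modulus (fractions L (vert a s)) <= tau) ->
    forall t, t \in `[- 2^-1, 2^-1] -> modulus (fractions L (vert a t)) <= eta.
Proof.
move=> de0 l0 eta0; pose l' := Num.min l (de / 4).
have l'0 : 0 < l' by rewrite lt_min l0 divr_gt0.
have [l1 l2] : l' <= l /\ l' <= de / 4 by split; rewrite ge_min lexx ?orbT.
have l4 : 4 * l' <= de by lra.
pose k := (Num.trunc (l'^-1)).+1.
have kl : 1 <= k%:R * l'.
  by rewrite -ler_pdivrMr // mul1r ltW // truncnS_gt.
have [tau tau0 h] := @propagation_iter de l' k de0 l'0 l4 eta eta0.
exists tau => // L a u L1 u1 u2 hL hG t tI; apply: (h L a (- 2^-1) 2^-1 u t) => //.
- by lra.
- by move=> s; rewrite in_itv /= => /andP[s1 s2]; apply: hG; rewrite in_itv /=; apply/andP; split; lra.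
move: tI; rewrite in_itv /= => /andP[s1 s2]; apply/andP; split; lra.
Qed.

End Propagation.

(** * The Swiss cheese and its finite stages *)

Section Swiss.
Variable R : realType.
Local Notation C := R[i].
Local Open Scope complex_scope.

Variables (D : nat -> nat -> seq C) (r : nat -> nat -> R).
Hypothesis D_neq0 : forall n k, D n k != [::].
Hypothesis r_gt0 : forall n k, 0 < r n k.

Definition swiss : set C :=
  [set z | modulus z <= 2 /\ forall n k a, a \in D n k -> r n k <= modulus (z - a)].

Lemma closed_swiss : closed swiss.
Proof.
rewrite -openC; apply/open_modulusP => x nx.
have [h|h] := leP (modulus x) 2.
  have [n [k [a [aD ha]]]] : exists n k a, a \in D n k /\ modulus (x - a) < r n k.
    apply: contrapT => H; apply: nx; split=> // n k a aD; rewrite leNgt; apply/negP => ha.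
    by apply: H; exists n, k, a.
  exists (r n k - modulus (x - a)); first by rewrite subr_gt0.
  move=> y yx [_ /(_ n k a aD)]; apply/negP; rewrite -ltNge.
  by have := ler_modulus_distD x y a; lra.
exists (modulus x - 2); first by rewrite subr_gt0.
move=> y yx [+ _]; apply/negP; rewrite -ltNge.
by have := ler_modulusB x y; rewrite modulusBC; lra.
Qed.

Lemma compact_swiss : compact swiss.
Proof. by apply: (closed_bounded_compact (r := 2) closed_swiss) => z []. Qed.

Lemma swiss_cheese_swiss : swiss !=set0 -> swiss_cheese_set swiss.
Proof.
move=> X0; split; first by split=> //; exact: compact_swiss.
pose dec j : nat * nat * nat := odflt (0%N, 0%N, 0%N) (unpickle j).
pose cen t : C := nth (nth 0 (D t.1.1 t.1.2) 0) (D t.1.1 t.1.2) t.2.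
have cenD t : cen t \in D t.1.1 t.1.2.
  rewrite /cen; have D0 := D_neq0 t.1.1 t.1.2.
  have [h|h] := ltnP t.2 (size (D t.1.1 t.1.2)); first exact: mem_nth.
  by rewrite nth_default // mem_nth // lt0n size_eq0.
exists 0, 2, (fun j => cen (dec j)), (fun j => r (dec j).1.1 (dec j).1.2); split=> //.
apply/seteqP; split=> z.
  move=> [z2 hz]; split; first by rewrite /closed_disc /= subr0.
  by move=> [j _] /=; apply/negP; rewrite -leNgt; apply: hz; exact: cenD.
move=> [/=]; rewrite /closed_disc /= subr0 => z2 hz; split=> // n k a aD.
rewrite leNgt; apply/negP => ha; apply: hz.
exists (pickle (n, k, index a (D n k))) => //.
by rewrite /open_disc /= /dec pickleK /= /cen /= nth_index.
Qed.

(** By compactness of the closed disc, since the condition [|P| < (M + 1) |Q|] is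
open and holds on the intersection of the finite stages. *)
Lemma finite_stage (P Q : {poly C}) (M : R) : (forall z, swiss z -> Q.[z] != 0) ->
  (forall z, swiss z -> modulus (P.[z] / Q.[z]) <= M) ->
  exists A : nat, forall w, modulus w <= 2 ->
    (forall n k a, (n < A)%N -> (k < A)%N -> a \in D n k -> r n k <= modulus (w - a)) ->
    Q.[w] != 0 /\ modulus (P.[w] / Q.[w]) <= M + 1.
Proof.
move=> Q0 hM.
pose good (A : nat) (w : C) :=
  (forall n k a, (n < A)%N -> (k < A)%N -> a \in D n k -> r n k <= modulus (w - a)) ->
  modulus P.[w] < (M + 1) * modulus Q.[w].
have /compact_near_coveringP cov : compact (closed_disc (0 : C) 2).
  apply: (closed_bounded_compact (r := 2) (@closed_closed_disc _ _ _)) => z.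
  by rewrite /closed_disc /= subr0.
have [|A _ hA] := cov _ \oo good _.
  move=> x; rewrite /closed_disc /= subr0 => x2.
  have [Xx|nx] := pselect (swiss x).
    have lt0 : 0 < (M + 1) * modulus Q.[x] - modulus P.[x].
      have q0 : 0 < modulus Q.[x] by rewrite modulus_gt0 Q0.
      by have := hM x Xx; rewrite modulusfV ler_pdivrMr //; nra.
    have cont : continuous (fun w : C => (M + 1) * modulus Q.[w] - modulus P.[w]).
      have cm (p : {poly C}) : continuous (fun w : C => modulus p.[w]).
        move=> w; apply: (@continuous_comp _ _ _ (fun w : C => p.[w]) (@modulus R)).
          exact: continuous_poly.
        exact: continuous_modulus.
      move=> w; apply: (@continuousB R R C (fun w => (M + 1) * modulus Q.[w]) (fun w => modulus P.[w])).
        apply: (@continuousM R C (fun=> M + 1) (fun w => modulus Q.[w])); first exact: cst_continuous.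
        exact: cm.
      exact: cm.
    have := cont x [set u | 0 < u]; move=> /(_ (lt_nbhsr lt0)) nx.
    exists ([set w | 0 < (M + 1) * modulus Q.[w] - modulus P.[w]], setT).
      by split; [exact: nx|exact: filterT].
    by move=> [w A] /= [h _] _; rewrite -subr_gt0.
  have [n [k [a [aD ha]]]] : exists n k a, a \in D n k /\ modulus (x - a) < r n k.
    apply: contrapT => H; apply: nx; split=> // n k a aD; rewrite leNgt; apply/negP => ha.
    by apply: H; exists n, k, a.
  exists (open_disc a (r n k), [set A | (maxn n k < A)%N]).
    split; last by exists (maxn n k).+1.
    by apply: open_nbhs_nbhs; split => //; exact: open_open_disc.
  move=> [w A] /= [wa]; rewrite gtn_max => /andP[nA kA] h.
  by have := h n k a nA kA aD; rewrite leNgt wa.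
exists A => w w2 hw; have := hA A (leqnn A) w.
rewrite /closed_disc /= subr0 => /(_ w2 hw) h.
have q0 : Q.[w] != 0.
  by apply/eqP => q0; move: h; rewrite q0 modulus0 mulr0; have := modulus_ge0 P.[w]; lra.
by split=> //; rewrite modulusfV ler_pdivrMr ?modulus_gt0 // ltW.
Qed.

Variables (K : set C) (s w : nat -> R).
Hypothesis K1 : forall z, K z -> modulus z <= 1.
Hypothesis s_gt0 : forall n, 0 < s n.
Hypothesis s_le1 : forall n, s n <= 1.
Hypothesis D_far : forall n k a z, a \in D n k -> K z -> s n <= modulus (a - z).
Hypothesis D_sum : forall n A, \sum_(k < A) (size (D n k))%:R * r n k <= s n * w n.

Definition disc_item (d : R) n k (a : C) : cluster R :=
  (a, (r n k, s n), (r n k / s n, if s n < d then r n k / s n else 0)).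

Definition disc_items d A : seq (cluster R) :=
  flatten [seq flatten [seq [seq disc_item d n k a | a <- D n k] | k <- iota 0 A] | n <- iota 0 A].

Lemma disc_itemsP d A c : c \in disc_items d A <->
  exists n k a, [/\ (n < A)%N, (k < A)%N, a \in D n k & c = disc_item d n k a].
Proof.
split=> [/flatten_mapP[n nA /flatten_mapP[k kA /mapP[a aD ->]]]|[n [k [a [nA kA aD ->]]]]].
  exists n, k, a; move: nA kA; rewrite !mem_iota !add0n => /andP[_ nA] /andP[_ kA].
  by split.
apply/flatten_mapP; exists n; first by rewrite mem_iota add0n.
by apply/flatten_mapP; exists k; [rewrite mem_iota add0n|exact: map_f].
Qed.

Lemma disc_item_valid d n k a : a \in D n k -> valid_cluster K d (disc_item d n k a).
Proof.
move=> aD; have r0 := r_gt0 n k; have s0 := s_gt0 n; have s1 := s_le1 n.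
have q0 : 0 < r n k / s n by rewrite divr_gt0.
split; rewrite /cradius /cscale /ctail /cweight /ccenter /=.
- by [].
- by [].
- by [].
- by case: (s n < d) => //; apply: ltW q0.
- by rewrite mulrCA mulfV ?gt_eqF // mulr1.
- by move=> ->.
exists a; first by rewrite subrr modulus0 ltW.
by move=> z Kz; exact: D_far aD Kz.
Qed.

Lemma disc_items_sum (F : cluster R -> R) d A (h : nat -> R) :
  (forall n k a, F (disc_item d n k a) = r n k * h n) ->
  \sum_(c <- disc_items d A) F c = \sum_(n < A) h n * \sum_(k < A) (size (D n k))%:R * r n k.
Proof.
move=> hF; rewrite big_flatten big_map -{1}(subn0 A) -/(index_iota 0 A) big_mkord.
apply: eq_bigr => n _; rewrite big_flatten big_map -{1}(subn0 A) -/(index_iota 0 A) big_mkord.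
rewrite mulr_sumr; apply: eq_bigr => k _; rewrite big_map.
under eq_bigr do rewrite hF.
by rewrite big_const_seq count_predT iter_addr_0 -mulr_natl; ring.
Qed.

Lemma disc_items_weight d A : \sum_(c <- disc_items d A) cweight c <= \sum_(n < A) w n.
Proof.
rewrite (@disc_items_sum _ _ _ (fun n => (s n)^-1)) //; apply: ler_sum => n _.
by rewrite ler_pdivrMl.
Qed.

Lemma disc_items_tail d A :
  \sum_(c <- disc_items d A) ctail c <= \sum_(n < A | s n < d) w n.
Proof.
rewrite (@disc_items_sum _ _ _ (fun n => if s n < d then (s n)^-1 else 0)); last first.
  by move=> n k a; rewrite /ctail /=; case: ifP => // _; rewrite mulr0.
rewrite [leRHS]big_mkcond; apply: ler_sum => n _; case: ifP => _; last by rewrite mul0r.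
by rewrite ler_pdivrMl.
Qed.

Lemma cheese_approx (P Q : {poly C}) (M d V eta : R) : 0 < d -> d <= 1 -> 0 < M -> 0 < eta ->
  (forall A, \sum_(n < A) w n <= 8^-1) ->
  (forall A, \sum_(n < A | s n < d) w n <= V) ->
  (forall z, swiss z -> Q.[z] != 0) ->
  (forall z, swiss z -> modulus (P.[z] / Q.[z]) <= M) ->
  exists L : seq (C * C), [/\ forall p z, p \in L -> K z -> d / 2 <= modulus (p.2 - z),
    total_weight L <= 3 * (M + 1) &
    forall z, K z -> modulus (P.[z] / Q.[z] - fractions L z) <= 2 * (M + 1) * V + eta].
Proof.
move=> d0 d1 M0 eta0 W8 WV Q0 hM; have [A hA] := finite_stage Q0 hM.
have M1 : 0 < M + 1 by rewrite addr_gt0.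
have [||w0 w2 hw|L [h1 h2 h3]] := @cauchy_decomposition R K d (M + 1) eta (disc_items d A) P Q d0 d1 M1 eta0 K1.
- by move=> c /disc_itemsP[n [k [a [_ _ aD ->]]]]; exact: disc_item_valid.
- exact: le_trans (disc_items_weight _ _) (W8 A).
- apply: hA => // n k a nA kA aD.
  by apply: (hw (disc_item d n k a)); apply/disc_itemsP; exists n, k, a.
exists L; split=> // z Kz; apply: le_trans (h3 z Kz) _; rewrite lerD2r ler_pM2l ?mulr_gt0 //.
exact: le_trans (disc_items_tail _ _) (WV A).
Qed.

Lemma K_sub_swiss : (forall n k, r n k <= s n) -> K `<=` swiss.
Proof.
move=> rs z Kz; split; first by have := K1 Kz; lra.
by move=> n k a aD; rewrite modulusBC (le_trans (rs n k)) // (D_far aD).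
Qed.

End Swiss.

(** * Uniqueness on vertical segments *)

Section Bounded.
Variable R : realType.
Local Notation C := R[i].
Local Open Scope complex_scope.

Lemma CX_bounded (X : set C) (f : C -> C) : compact X -> CX X f ->
  exists2 M : R, 0 < M & forall z, X z -> modulus (f z) <= M.
Proof.
move=> cX cf; have /compact_near_coveringP cov := cX.
have [|A _ hA] := cov _ \oo (fun A z => X z -> modulus (f z) <= A%:R) _.
  move=> x Xx; have /within_modulusP h := cf.
  have [d d0 hd] := h x Xx 1 ltr01.
  exists (open_disc x d, [set A | (Num.trunc (modulus (f x) + 1) < A)%N]).
    split; last by exists (Num.trunc (modulus (f x) + 1)).+1.
    apply: open_nbhs_nbhs; split; first exact: open_open_disc.
    by rewrite /open_disc /= subrr modulus0.
  move=> [z A] /= [zx hA] Xz; have h1 := hd z Xz zx; have h2 := ler_modulusB (f z) (f x).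
  have h3 : modulus (f x) + 1 < A%:R by apply: lt_le_trans (truncnS_gt _) _; rewrite ler_nat.
  lra.
exists A.+1%:R => // z Xz; apply: le_trans (hA A (leqnn A) z Xz Xz) _.
by rewrite ler_nat.
Qed.

End Bounded.

Section Uniqueness.
Variable R : realType.
Local Notation C := R[i].
Local Open Scope complex_scope.
Variables (D : nat -> nat -> seq C) (r : nat -> nat -> R).
Variables (K : set C) (s w d tau : nat -> R).

(** The discs of level [n] are at distance at least [s n] from [K], and the sum of
their ratios radius / distance is at most [w n].  For every [N], the levels
closer to [K] than [d N] contribute so little to these sums that they cannot
spoil the propagation principle for poles at distance [d N / 2], whose
constant is [tau N]. *)
Record cheese_data : Prop := CheeseData {
  cd_nonempty : forall n k, D n k != [::];
  cd_radius : forall n k, 0 < r n k;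
  cd_K1 : forall z, K z -> modulus z <= 1;
  cd_scale : forall n, 0 < s n;
  cd_scale1 : forall n, s n <= 1;
  cd_far : forall n k a z, a \in D n k -> K z -> s n <= modulus (a - z);
  cd_sum : forall n A, \sum_(k < A) (size (D n k))%:R * r n k <= s n * w n;
  cd_total : forall A, \sum_(n < A) w n <= 8^-1;
  cd_d : forall N, 0 < d N;
  cd_d1 : forall N, d N <= 1;
  cd_tail : forall N A, \sum_(n < A | s n < d N) w n <= tau N / 8;
  cd_tau : forall N, 0 < tau N;
  cd_tau1 : forall N, tau N <= N.+1%:R^-1;
  cd_propagation : forall N (L : seq (C * C)) a u, total_weight L <= 1 ->
    - 2^-1 <= u -> u + N.+1%:R^-1 <= 2^-1 ->
    (forall p t, p \in L -> t \in `[- 2^-1, 2^-1] -> d N / 2 <= modulus (p.2 - vert a t)) ->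
    (forall t, t \in `[u, u + N.+1%:R^-1] -> modulus (fractions L (vert a t)) <= tau N) ->
    forall t, t \in `[- 2^-1, 2^-1] -> modulus (fractions L (vert a t)) <= N.+1%:R^-1 }.

Hypothesis cd : cheese_data.

(** On [K], the function is, up to a multiple of [tau N], a sum of simple fractions
with poles at distance at least [d N / 2].  Where the function vanishes this sum is small,
hence it is small on the whole segment; let [N] go to infinity. *)
Lemma unique_on_segment (f : C -> C) (a t0 : R) :
  (forall t, t \in `[- 2^-1, 2^-1] -> K (vert a t)) -> t0 \in `[- 2^-1, 2^-1] ->
  K `<=` swiss D r ->
  RX (swiss D r) f -> (\forall z \near within (swiss D r) (nbhs (vert a t0)), f z = 0) ->
  forall t, t \in `[- 2^-1, 2^-1] -> f (vert a t) = 0.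
Proof.
case: cd => Dn0 r0 K1 s0 s1 Dfar Dsum tot d0 d1 tail tau0 tau1 prop.
move=> aK t0I KX [fC fR] f0 t tI.
have [M M0 fM] := CX_bounded (@compact_swiss _ D r) fC.
have [e e0 fe] : exists2 e : R, 0 < e & forall z, modulus (z - vert a t0) < e -> swiss D r z -> f z = 0.
  have : nbhs (vert a t0) [set z | swiss D r z -> f z = 0] by exact: f0.
  by move=> /nbhs_modulusP[e e0 he]; exists e.
pose M' := M + 2.
have M'0 : 0 < M' by rewrite /M'; lra.
have key N : (1 <= N)%N -> N.+1%:R^-1 < e -> modulus (f (vert a t)) <= 6 * M' / N.+1%:R.
  move=> N1 Ne; set l := N.+1%:R^-1 in Ne *.
  have l0 : 0 < l by rewrite invr_gt0 ltr0Sn.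
  have l2 : l <= 2^-1 by rewrite lef_pV2 ?posrE ?ltr0Sn // ler_nat.
  have tN := tau0 N; have tN1 := tau1 N.
  have mt : 0 < M' * tau N by rewrite mulr_gt0.
  (* e1 <= 1 keeps the rational approximants of f bounded by M + 1. *)
pose e1 := Num.min 1 (M' * tau N).
  have e10 : 0 < e1 by rewrite lt_min ltr01.
  have [e11 e12] : e1 <= 1 /\ e1 <= M' * tau N by split; rewrite ge_min lexx ?orbT.
  have [P [Q [Q0 PQ]]] := fR e1 e10.
  have PQM z : swiss D r z -> modulus (P.[z] / Q.[z]) <= M + 1.
    move=> Xz; have h1 := PQ z Xz; have h2 := fM z Xz.
    have := ler_modulusB (P.[z] / Q.[z]) (f z); rewrite modulusBC; lra.
  have M1 : 0 < M + 1 by lra.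
  have [L [L1 L2 L3]] := cheese_approx r0 K1 s0 s1 Dfar Dsum (d0 N) (d1 N) M1 mt
    tot (tail N) Q0 PQM.
  have M'E : M + 1 + 1 = M' by rewrite /M' -addrA.
  rewrite M'E in L2 L3.
  pose k : C := ((3 * M')^-1)%:C.
  have kpos : 0 < (3 * M')^-1 by rewrite invr_gt0 mulr_gt0.
  have kmod : modulus k = (3 * M')^-1 by rewrite modulus_real gtr0_norm.
  have GfK z : K z -> modulus (fractions L z - f z) <= e1 + (2 * M' * (tau N / 8) + M' * tau N).
    move=> Kz; have h1 := PQ z (KX z Kz); have h2 := L3 z Kz.
    have := ler_modulus_distD (P.[z] / Q.[z]) (fractions L z) (f z).
    by rewrite (modulusBC (fractions L z) (P.[z] / Q.[z])) (modulusBC (P.[z] / Q.[z]) (f z)); lra.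
  have GK z : modulus (fractions (scale_fractions k L) z) = modulus (fractions L z) / (3 * M').
    by rewrite fractions_scale modulusM kmod mulrC.
  have [u [u1 u2 u3]] : exists u, [/\ - 2^-1 <= u, u + l <= 2^-1 &
      forall v, v \in `[u, u + l] -> `|v - t0| <= l].
    move: t0I; rewrite in_itv /= => /andP[g1 g2].
    have [tn|tp] := leP t0 0.
      exists t0; split=> //; first by lra.
      by move=> v; rewrite in_itv /= => /andP[v1 v2]; rewrite ger0_norm; lra.
    exists (t0 - l); split; [lra|lra|].
    by move=> v; rewrite in_itv /= => /andP[v1 v2]; rewrite ler0_norm; lra.
  have small v : v \in `[u, u + l] -> modulus (fractions (scale_fractions k L) (vert a v)) <= tau N.
    move=> vI; have vI' : v \in `[- 2^-1, 2^-1].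
      by move: vI; rewrite !in_itv /= => /andP[v1 v2]; apply/andP; split; lra.
    have fv : f (vert a v) = 0.
      apply: fe; last exact/KX/aK.
      by rewrite modulus_vert (le_lt_trans (u3 v vI)).
    have := GfK _ (aK v vI'); rewrite fv subr0 GK ler_pdivrMr ?mulr_gt0 //; lra.
  have w1 : total_weight (scale_fractions k L) <= 1.
    by rewrite total_weight_scale kmod mulrC ler_pdivrMr ?mulr_gt0 // mul1r.
  have far p v : p \in scale_fractions k L -> v \in `[- 2^-1, 2^-1] -> d N / 2 <= modulus (p.2 - vert a v).
    by move=> /mapP[q qL ->] vI /=; apply: L1 => //; exact: aK.
  have := prop N _ a u w1 u1 u2 far small t tI.
  rewrite -/l GK ler_pdivrMr ?mulr_gt0 // => h1.
  have h2 := GfK _ (aK t tI).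
  have := ler_modulusB (f (vert a t)) (fractions L (vert a t)); rewrite modulusBC => h3.
  have : M' * tau N <= M' * l by rewrite ler_pM2l.
  by rewrite -/l; lra.
apply: modulus_le_eps => eta eta0.
have m0 : 0 < Num.min e (eta / (6 * M')) by rewrite lt_min e0 divr_gt0 // mulr_gt0.
pose N := (Num.trunc (Num.min e (eta / (6 * M')))^-1).+1.
have hN : N.+1%:R^-1 < Num.min e (eta / (6 * M')).
  rewrite -[ltRHS]invrK ltf_pV2 ?posrE ?invr_gt0 ?ltr0Sn //.
  by apply: lt_trans (truncnS_gt _) _; rewrite ltr_nat.
move: hN; rewrite lt_min => /andP[h1 h2].
apply: le_trans (key N _ h1) _ => //.
by move: h2; rewrite ltr_pdivlMr ?mulr_gt0 // => /ltW; rewrite mulrC.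
Qed.

End Uniqueness.

(** * Null sets of Jensen measures *)

Section Jensen.
Variable R : realType.
Local Notation C := R[i].
Local Open Scope complex_scope.
Implicit Types (X A : set C) (f : C -> C).

Lemma open_borelC (U : set C) : open U -> measurable (U : set (borelC R)).
Proof. by move=> oU; exact: sub_sigma_algebra. Qed.

Lemma closed_borelC (U : set C) : closed U -> measurable (U : set (borelC R)).
Proof.
move=> cU; rewrite -(setCK U); apply: measurableC; apply: open_borelC.
by rewrite openC.
Qed.

Definition log_modulus f (z : C) : \bar R := lne (modulus (f z))%:E.

Lemma lt_log_modulus f z (a : R) : (a%:E < log_modulus f z)%E = (expR a < modulus (f z)).
Proof.
rewrite /log_modulus /lne; case: (leP (modulus (f z)) 0) => f0; last by rewrite lte_fin -{1}(expRK a) ltr_ln ?posrE ?expR_gt0.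
apply/esym/negbTE; rewrite -leNgt; apply: le_trans f0 _; exact: expR_ge0.
Qed.

Lemma measurable_log_modulus X f : closed X -> CX X f ->
  measurable_fun (X : set (borelC R)) (log_modulus f).
Proof.
move=> cX cf; apply: (measurability _ (ErealGenOInfty.measurableE R)).
move=> _ [_ [a ->] <-].
pose V : set C := [set z | exists x d, [/\ modulus (z - x) < d &
  forall y, X y -> modulus (y - x) < d -> expR a < modulus (f y)]].
have oV : open V.
  apply/open_modulusP => z [x [d [zx hd]]]; exists (d - modulus (z - x)).
    by rewrite subr_gt0.
  move=> y yz; exists x, d; split=> //.
  by have := ler_modulus_distD z y x; lra.
have -> : X `&` (log_modulus f @^-1` `]a%:E, +oo[) = V `&` X.
  apply/seteqP; split=> z /=; rewrite in_itv /= andbT lt_log_modulus.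
    move=> [Xz fz]; split=> //; have /within_modulusP := cf.
    have e0 : 0 < modulus (f z) - expR a by rewrite subr_gt0.
    move=> /(_ z Xz _ e0)[d d0 hd]; exists z, d; split; first by rewrite subrr modulus0.
    move=> y Xy yz; have := hd y Xy yz; have := ler_modulusB (f z) (f y).
    by rewrite modulusBC; lra.
  by move=> [[x [d [zx hd]]] Xz]; split=> //; exact: hd.
by apply: measurableI; [exact: open_borelC|exact: closed_borelC].
Qed.

Lemma le_log_modulus f z (M : R) : 0 < M -> modulus (f z) <= M -> (log_modulus f z <= (ln M)%:E)%E.
Proof.
move=> M0 fM; rewrite leNgt; apply/negP; rewrite lt_log_modulus lnK ?posrE // => h.
by move: (lt_le_trans h fM); rewrite ltxx.
Qed.

(** Otherwise the integral of [log |f|] is [-oo], because its negative part is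
infinite on [A], whereas [log |f x|] is finite. *)
Lemma jensen_null_zero X x f A (mu : probability (borelC R) R) :
  closed X -> RX X f ->
  Jensen_measure X x mu -> f x != 0 ->
  measurable (A : set (borelC R)) -> A `<=` X -> (forall z, A z -> f z = 0) -> mu A = 0%E.
Proof.
move=> cX fX [_ jen] fx mA AX Af; apply: contrapT => /eqP muA.
have mX := closed_borelC cX; have mf := measurable_log_modulus cX fX.1.
have inf : (\int[mu]_(w in X) (log_modulus f)^\- w = +oo)%E.
  apply/eqP; rewrite -leye_eq.
  have <- : (\int[mu]_(w in A) (cst +oo w) = +oo)%E.
    by rewrite integral_cst // gt0_mulye // lt0e muA measure_ge0.
  apply: (@le_trans _ _ (\int[mu]_(w in A) (log_modulus f)^\- w)%E).
    apply: ge0_le_integral => //.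
    - by move=> z _; exact: leey.
    - by apply: measurable_funeneg; exact: measurable_funS mf.
    move=> w Aw; rewrite funenegE /log_modulus Af // modulus0 /lne lexx /=.
    by rewrite le_max lexx.
  by apply: ge0_subset_integral => //; exact: measurable_funeneg.
have := jen f fX; rewrite integralE inf /= addeNy.
have fx0 : (modulus (f x) <= 0) = false by rewrite leNgt modulus_gt0 fx.
by rewrite /lne fx0 leeNy_eq.
Qed.

(** If [|f| <= 1 = f x] almost everywhere, the integral of [log |f|] is both
nonpositive and at least [log |f x| = 0]. *)
Lemma jensen_null_peak X x f N (mu : probability (borelC R) R) :
  closed X -> RX X f -> Jensen_measure X x mu -> f x = 1 ->
  mu.-negligible (N : set (borelC R)) -> (forall z, X z -> ~ N z -> modulus (f z) <= 1) ->
  mu.-negligible ([set z | X z /\ modulus (f z) < 1] : set (borelC R)).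
Proof.
move=> cX fX [_ jen] fx nN Nf.
have mX := closed_borelC cX; have mf := measurable_log_modulus cX fX.1.
have pos0 : (\int[mu]_(w in X) (log_modulus f)^\+ w = 0)%E.
  rewrite (@ge0_ae_eq_integral _ _ _ mu X _ (cst 0%E)) ?integral0 //.
    exact: measurable_funepos.
  apply: negligibleS nN => z /= /not_implyP[Xz hz].
  apply: contrapT => Nz; apply: hz; rewrite funeposE; apply/max_idPr.
  by have := le_log_modulus ltr01 (Nf z Xz Nz); rewrite ln1.
have := jen f fX; rewrite integralE pos0 sub0e fx modulus1 /lne ler10 ln1 leeNr oppe0 => neg0.
have {}neg0 : (\int[mu]_(w in X) (log_modulus f)^\- w = 0)%E.
  by apply/le_anti; rewrite neg0 integral_ge0.
have mneg := measurable_funeneg mf.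
have : (\int[mu]_(w in X) `|(log_modulus f)^\- w| = 0)%E.
  rewrite -[RHS]neg0; apply: eq_integral => w _; rewrite gee0_abs //.
move=> /(ae_eq_integral_abs mu mX mneg); apply: negligibleS => z /= [Xz fz] /(_ Xz).
rewrite funenegE => /max_idPr; rewrite leeNl oppe0 leNgt => /negP; apply.
by rewrite /log_modulus lne_lt0 lte_fin.
Qed.

End Jensen.

(** * Separating points by circles that miss a compact set *)

Section Separation.
Variable R : realType.
Local Notation C := R[i].
Local Open Scope complex_scope.

Definition rat_center (t : rat * rat * rat) : C := ratr t.1.1 +i* ratr t.1.2.
Definition rat_radius (t : rat * rat * rat) : R := ratr t.2.

Variable K : set C.

Definition admissible (t : rat * rat * rat) :=
  0 < rat_radius t /\ forall z, K z -> modulus (z - rat_center t) != rat_radius t.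

Definition separates (t : rat * rat * rat) (x y : C) :=
  modulus (x - rat_center t) < rat_radius t /\ rat_radius t < modulus (y - rat_center t).

Lemma ltr_modulus_sqr (z : C) (q : R) : 0 <= q ->
  (modulus z < q) = (complex.Re z ^+ 2 + complex.Im z ^+ 2 < q ^+ 2).
Proof. by move=> q0; rewrite -sqr_modulus ltr_pXn2r ?nnegrE ?modulus_ge0. Qed.

Lemma gtr_modulus_sqr (z : C) (q : R) : 0 <= q ->
  (q < modulus z) = (q ^+ 2 < complex.Re z ^+ 2 + complex.Im z ^+ 2).
Proof. by move=> q0; rewrite -sqr_modulus ltr_pXn2r ?nnegrE ?modulus_ge0. Qed.

Lemma small_disc x y : closed K -> ~ K x -> y != x -> exists2 t, admissible t & separates t x y.
Proof.
move=> cK nKx yx.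
have [e e0 he] : exists2 e : R, 0 < e & forall z, modulus (z - x) < e -> ~ K z.
  have : open (~` K) by rewrite openC.
  by move=> /open_modulusP /(_ x nKx).
pose m := Num.min e (modulus (y - x)).
have m0 : 0 < m by rewrite lt_min e0 modulus_gt0 subr_eq0.
have m8 : 0 < m / 8 by rewrite divr_gt0.
have [|a] := @rat_in_itvoo R (complex.Re x) (complex.Re x + m / 8); first by lra.
rewrite in_itv /= => /andP[a1 a2].
have [|b] := @rat_in_itvoo R (complex.Im x) (complex.Im x + m / 8); first by lra.
rewrite in_itv /= => /andP[b1 b2].
have [|q] := @rat_in_itvoo R (m / 4) (m / 2); first by lra.
rewrite in_itv /= => /andP[q1 q2].
pose t := (a, b, q).
have xc : modulus (x - rat_center t) <= m / 4.
  apply: le_trans (modulus_le_ReIm _) _; rewrite ReB ImB /= ltr0_norm; last by lra.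
  by rewrite ltr0_norm; lra.
have far z : m <= modulus (z - x) -> rat_radius t < modulus (z - rat_center t).
  move=> h; have := ler_modulus_distD (rat_center t) z x.
  by rewrite (modulusBC (rat_center t) x) /rat_radius /=; lra.
exists t.
  split; first by rewrite /rat_radius /=; lra.
  move=> z Kz; apply/eqP => h; have : m <= modulus (z - x).
    rewrite leNgt; apply/negP => zm; apply: (he z) => //.
    by apply: lt_le_trans zm _; rewrite ge_min lexx.
  by move=> /far; rewrite h ltxx.
split; first by rewrite /rat_radius /=; lra.
by apply: far; rewrite ge_min lexx orbT.
Qed.

(** The level sets of the coordinate [h] are lines, [v] is the other coordinate,
and [cen u] is the point with coordinates [u] and 0.  If no value of [h] on [K]
lies strictly between [t1] and [t2], a huge circle tangent to a line
[h = p] with [t1 < p < t2] misses [K] and separates [x] from [y]. *)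
Lemma half_plane_disc (h v : C -> R) (cen : R -> C) x y (t1 t2 : R) :
  (forall z u, complex.Re (z - cen u) ^+ 2 + complex.Im (z - cen u) ^+ 2 = (h z - u) ^+ 2 + v z ^+ 2) ->
  (forall z, `|h z| <= modulus z) -> (forall z, `|v z| <= modulus z) ->
  (forall q : rat, exists a b : rat, cen (ratr q) = ratr a +i* ratr b) ->
  (forall z, K z -> modulus z <= 2) -> modulus x <= 2 -> modulus y <= 2 ->
  t1 < t2 -> h y <= t1 -> t2 <= h x -> (forall z, K z -> h z <= t1 \/ t2 <= h z) ->
  exists2 t, admissible t & separates t x y.
Proof.
move=> hcen hh hv hrat K2 x2 y2 t12 hy hx hK.
have [|p] := @rat_in_itvoo R t1 t2; first by lra.
rewrite in_itv /= => /andP[p1 p2].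
pose g := t2 - ratr p.
have g0 : 0 < g by rewrite subr_gt0.
(* Points of the disc of radius 2 at distance >= g beyond the line are inside
   the circle as soon as 4 ^ 2 + 2 ^ 2 < 2 * radius * g. *)
have [|q] := @rat_in_itvoo R (10 / g) (10 / g + 1); first by lra.
rewrite in_itv /= => /andP[q1 q2].
have q0 : 0 < (ratr q : R) by apply: lt_trans q1; rewrite divr_gt0.
have qg : 10 < ratr q * g by rewrite -ltr_pdivrMr.
have [a [b cE]] := hrat (p + q).
pose t := (a, b, q).
have ct : rat_center t = cen (ratr p + ratr q) by rewrite -rmorphD cE.
have h2 z : modulus z <= 2 -> [/\ -2 <= h z, h z <= 2, -2 <= v z & v z <= 2].
  move=> z2; have := le_trans (hh z) z2; have := le_trans (hv z) z2.
  by rewrite !ler_norml => /andP[? ?] /andP[? ?].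
have [hx1 hx2 _ _] := h2 x x2; have [hy1 hy2 _ _] := h2 y y2.
have inside z : modulus z <= 2 -> t2 <= h z -> modulus (z - rat_center t) < rat_radius t.
  move=> /h2[z1 z2 z3 z4] hz; rewrite ltr_modulus_sqr ?ct ?hcen ?(ltW q0) // /rat_radius /=.
  have k1 : g <= h z - ratr p by rewrite /g; lra.
  have k2 : ratr q * g <= ratr q * (h z - ratr p) by rewrite ler_pM2l.
  set u := h z - ratr p in k1 k2; set Q : R := ratr q in q0 qg k2 *.
  have -> : h z - (ratr p + Q) = u - Q by rewrite /u; ring.
  have u4 : u <= 4 by rewrite /u; lra.
  have u0 : 0 < u by lra.
  have : u ^+ 2 <= 16 by nra.
  have : v z ^+ 2 <= 4 by nra.
  by nra.
have outside z : h z <= t1 -> rat_radius t < modulus (z - rat_center t).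
  move=> hz; rewrite gtr_modulus_sqr ?ct ?hcen ?(ltW q0) // /rat_radius /=.
  set Q : R := ratr q in q0 *.
  have u0 : 0 < ratr p - h z by lra.
  have := sqr_ge0 (v z); nra.
exists t.
  split=> // z Kz; apply/eqP => e; case: (hK z Kz) => [/outside|/inside].
    by rewrite e ltxx.
  by move=> /(_ (K2 z Kz)); rewrite e ltxx.
by split; [exact: inside|exact: outside].
Qed.

Lemma left_disc x y t1 t2 : (forall z, K z -> modulus z <= 2) -> modulus x <= 2 -> modulus y <= 2 ->
  t1 < t2 -> complex.Re y <= t1 -> t2 <= complex.Re x ->
  (forall z, K z -> complex.Re z <= t1 \/ t2 <= complex.Re z) ->
  exists2 t, admissible t & separates t x y.
Proof.
apply: (@half_plane_disc (@complex.Re R) (@complex.Im R) (fun u => u +i* 0)).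
- by move=> z u; rewrite ReB ImB /= subr0.
- exact: ler_Re_modulus.
- exact: ler_Im_modulus.
- by move=> q; exists q, 0; rewrite rmorph0.
Qed.

Lemma right_disc x y t1 t2 : (forall z, K z -> modulus z <= 2) -> modulus x <= 2 -> modulus y <= 2 ->
  t1 < t2 -> - complex.Re y <= t1 -> t2 <= - complex.Re x ->
  (forall z, K z -> - complex.Re z <= t1 \/ t2 <= - complex.Re z) ->
  exists2 t, admissible t & separates t x y.
Proof.
apply: (@half_plane_disc (fun z => - complex.Re z) (@complex.Im R) (fun u => (- u) +i* 0)).
- by move=> z u; rewrite ReB ImB /=; ring.
- by move=> z; rewrite normrN; exact: ler_Re_modulus.
- exact: ler_Im_modulus.
- by move=> q; exists (- q), 0; rewrite rmorph0 rmorphN.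
Qed.

Lemma below_disc x y t1 t2 : (forall z, K z -> modulus z <= 2) -> modulus x <= 2 -> modulus y <= 2 ->
  t1 < t2 -> complex.Im y <= t1 -> t2 <= complex.Im x ->
  (forall z, K z -> complex.Im z <= t1 \/ t2 <= complex.Im z) ->
  exists2 t, admissible t & separates t x y.
Proof.
apply: (@half_plane_disc (@complex.Im R) (@complex.Re R) (fun u => 0 +i* u)).
- by move=> z u; rewrite ReB ImB /=; ring.
- exact: ler_Im_modulus.
- exact: ler_Re_modulus.
- by move=> q; exists 0, q; rewrite rmorph0.
Qed.

Lemma above_disc x y t1 t2 : (forall z, K z -> modulus z <= 2) -> modulus x <= 2 -> modulus y <= 2 ->
  t1 < t2 -> - complex.Im y <= t1 -> t2 <= - complex.Im x ->
  (forall z, K z -> - complex.Im z <= t1 \/ t2 <= - complex.Im z) ->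
  exists2 t, admissible t & separates t x y.
Proof.
apply: (@half_plane_disc (fun z => - complex.Im z) (@complex.Re R) (fun u => 0 +i* (- u))).
- by move=> z u; rewrite ReB ImB /=; ring.
- by move=> z; rewrite normrN; exact: ler_Im_modulus.
- exact: ler_Re_modulus.
- by move=> q; exists 0, (- q); rewrite rmorph0 rmorphN.
Qed.

(** Compactness; the factor 2 leaves room for discs that are within [s] of the
circle. *)
Lemma circle_distance (c : C) (rho : R) : compact K -> (forall z, K z -> modulus (z - c) != rho) ->
  exists s : R, [/\ 0 < s, s <= 1 & forall z, K z -> 2 * s <= `|modulus (z - c) - rho|].
Proof.
move=> /compact_near_coveringP cov hc.
have [|A _ hA] := cov _ \oo (fun A z => 2 / A.+1%:R <= `|modulus (z - c) - rho|) _.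
  move=> x Kx; pose g := `|modulus (x - c) - rho|.
  have g0 : 0 < g by rewrite normr_gt0 subr_eq0 hc.
  exists (open_disc x (g / 2), [set A | (Num.trunc (4 / g) < A.+1)%N]).
    split; last by exists (Num.trunc (4 / g)) => // m /=; rewrite ltnS.
    apply: open_nbhs_nbhs; split; first exact: open_open_disc.
    by rewrite /open_disc /= subrr modulus0 divr_gt0.
  move=> [z A] /= [zx hA].
  have h1 : 4 / g < A.+1%:R by apply: lt_le_trans (truncnS_gt _) _; rewrite ler_nat.
  have h2 : 2 / A.+1%:R <= g / 2.
    by move: h1; rewrite ltr_pdivrMr // ler_pdivrMr ?ltr0Sn // => h1; lra.
  apply: (le_trans h2).
  have k1 := ler_modulus_distD x z c; have k2 := ler_modulus_distD z x c.
  rewrite (modulusBC x z) in k2; rewrite /open_disc /= in zx.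
  have gE : g = `|modulus (x - c) - rho| by [].
  have [s1|s1] := leP 0 (modulus (x - c) - rho).
    rewrite ger0_norm // in gE; apply: le_trans (ler_norm _); lra.
  rewrite ltr0_norm // in gE; rewrite -normrN; apply: le_trans (ler_norm _); lra.
exists (A.+1%:R^-1); split; first by rewrite invr_gt0 ltr0Sn.
  by rewrite invf_le1 ?ltr0Sn // ler1n.
by move=> z Kz; exact: hA A (leqnn A) z Kz.
Qed.

End Separation.

Section Gap.
Variable R : realType.

Lemma nowhere_dense_gap (F : set R) (a b : R) : closed F -> nowhere_dense F -> a < b ->
  exists t1 t2, [/\ a <= t1, t1 < t2, t2 <= b & forall u, F u -> u <= t1 \/ t2 <= u].
Proof.
move=> cF nF ab.
have [p [ap pb nFp]] : exists p, [/\ a < p, p < b & ~ F p].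
  apply: contrapT => H.
  have : (closure F)° ((a + b) / 2).
    have -> : closure F = F by rewrite -(closure_id F).1.
    suff : nbhs ((a + b) / 2) F by [].
    apply: (@filterS _ _ _ `]a, b[%classic).
      move=> p; rewrite /= in_itv /= => /andP[ap pb].
      by apply: contrapT => nFp; apply: H; exists p.
    by apply: near_in_itvoo; rewrite in_itv /=; apply/andP; split; lra.
  by rewrite nF.
have : nbhs p (~` F) by apply: open_nbhs_nbhs; split => //; exact: closed_openC.
move=> /nbhs_ballP[e /= e0 he].
pose m := Num.min (e / 2) (Num.min (p - a) (b - p)).
have m0 : 0 < m by rewrite !lt_min divr_gt0 // !subr_gt0 ap pb.
have [m1 [m2 m3]] : m <= e / 2 /\ m <= p - a /\ m <= b - p.
  by rewrite /m !ge_min !lexx !orbT.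
exists (p - m), (p + m); split; [lra|lra|lra|].
move=> u Fu; have [h|h] := leP u (p - m); [by left|right].
rewrite leNgt; apply/negP => h2; apply: (he u) => //.
rewrite -ball_normE /ball_ /= ltr_norml; apply/andP; split; lra.
Qed.
End Gap.

(** * Choice of the radii, and the strip over a fat Cantor set *)

Section LevelData.
Variable R : realType.
Local Notation C := R[i].
Local Open Scope complex_scope.

(** The indices whose circle meets [K] are sent to the circle of centre 3 and
radius 1, which misses the unit disc. *)
Lemma circle_sequence (K : set C) : (forall z, K z -> modulus z <= 1) -> exists (c : nat -> C) (rho : nat -> R),
  [/\ forall n, 0 < rho n, forall n z, K z -> modulus (z - c n) != rho n &
      forall x y, (exists2 t, admissible K t & separates t x y) ->
        exists n, modulus (x - c n) < rho n < modulus (y - c n)].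
Proof.
move=> K1.
pose dec n : rat * rat * rat := odflt (3, 0, 1) (unpickle n).
pose sel n := if pselect (admissible K (dec n)) then dec n else (3, 0, 1).
have adm0 : admissible K (3, 0, 1).
  split; first by rewrite /rat_radius /= rmorph1.
  move=> z Kz; rewrite /rat_center /rat_radius /= rmorph1 rmorph0 rmorph_nat.
  have := ler_modulusB (3 +i* 0) z; rewrite modulus_real normr_nat modulusBC => h.
  by apply/eqP => e; have := K1 z Kz; lra.
have adm n : admissible K (sel n) by rewrite /sel; case: pselect.
exists (fun n => rat_center R (sel n)), (fun n => rat_radius R (sel n)); split.
- by move=> n; have [] := adm n.
- by move=> n; have [] := adm n.
move=> x y [t tK [h1 h2]]; exists (pickle t).
have -> : sel (pickle t) = t by rewrite /sel /dec pickleK /=; case: pselect.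
by rewrite h1.
Qed.

Fixpoint running_min (u : nat -> R) n : R :=
  if n is n'.+1 then Num.min (running_min u n') (u n) else u 0%N.

Lemma running_min_le u n k : (k <= n)%N -> running_min u n <= u k.
Proof.
elim: n => [|n IH]; first by rewrite leqn0 => /eqP ->.
by rewrite leq_eqVlt ge_min => /predU1P[->|/IH ->]; rewrite ?lexx ?orbT.
Qed.

Lemma running_min_gt0 u n : (forall k, 0 < u k) -> 0 < running_min u n.
Proof. by move=> u0; elim: n => //= n IH; rewrite lt_min IH u0. Qed.

Lemma sum_pow2_le (k : nat) (A : nat) : \sum_(n < A) (2 ^+ (n + k.+1))^-1 <= (2 ^+ k)^-1 :> R.
Proof.
have p0 : 0 < (2 ^+ k)^-1 :> R by rewrite invr_gt0 exprn_gt0.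
suff : \sum_(n < A) (2 ^+ (n + k.+1))^-1 <= (2 ^+ k)^-1 * (1 - (2 ^+ A)^-1) :> R.
  move/le_trans; apply; rewrite ler_piMr ?(ltW p0) // gerBl invr_ge0 exprn_ge0 //.
elim: A => [|A IH]; first by rewrite big_ord0 expr0 invr1 subrr mulr0.
rewrite big_ord_recr /=; apply: le_trans (lerD IH (lexx _)) _.
rewrite addnS exprS exprD exprS !invfM; set a := (2 ^+ A)^-1; set b := (2 ^+ k)^-1.
by lra.
Qed.

(** The circles come first, and with them the distances [s n], [d N] and the
constants [tau N]; only then are the total radii [s n * w n] chosen. *)
Lemma exists_cheese_data (K : set C) : compact K -> (forall z, K z -> modulus z <= 1) ->
  exists (D : nat -> nat -> seq C) (r : nat -> nat -> R) (s w d tau : nat -> R)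
    (c : nat -> C) (rho : nat -> R),
  [/\ cheese_data D r K s w d tau, K `<=` swiss D r,
    forall x y, (exists2 t, admissible K t & separates t x y) ->
        exists n, modulus (x - c n) < rho n < modulus (y - c n) &
    forall n, exists f, [/\ RX (swiss D r) f,
      forall z, swiss D r z -> rho n <= modulus (z - c n) -> f z = 0 &
      forall z, swiss D r z -> modulus (z - c n) < rho n -> f z != 0]].
Proof.
move=> cK K1; have [c [rho [rho0 Kc sep]]] := circle_sequence K1.
have [s hs] := choice (fun n => circle_distance cK (Kc n)).
have s0 n : 0 < s n by have [] := hs n.
have s1 n : s n <= 1 by have [] := hs n.
pose d N := running_min s N.
have d0 N : 0 < d N by exact: running_min_gt0.
have d1 N : d N <= 1 by apply: le_trans (running_min_le _ (leqnn N)) (s1 N).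
have prop N : exists t : R, 0 < t /\ forall (L : seq (C * C)) a u, total_weight L <= 1 ->
    - 2^-1 <= u -> u + N.+1%:R^-1 <= 2^-1 ->
    (forall p t, p \in L -> t \in `[- 2^-1, 2^-1] -> d N / 2 <= modulus (p.2 - vert a t)) ->
    (forall v, v \in `[u, u + N.+1%:R^-1] -> modulus (fractions L (vert a v)) <= t) ->
    forall t, t \in `[- 2^-1, 2^-1] -> modulus (fractions L (vert a t)) <= N.+1%:R^-1.
  have N0 : 0 < N.+1%:R^-1 :> R by rewrite invr_gt0 ltr0Sn.
  have d20 : 0 < d N / 2 by rewrite divr_gt0.
  by have [t t0 ht] := propagation d20 N0 N0; exists t.
have [tau0 htau0] := choice prop.
pose tau N := Num.min (tau0 N) N.+1%:R^-1.
have tau_gt0 N : 0 < tau N by rewrite lt_min (htau0 N).1 invr_gt0 ltr0Sn.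
have tau_le N : tau N <= N.+1%:R^-1 by rewrite ge_min lexx orbT.
have tau_le1 N : tau N <= 1 by apply: le_trans (tau_le N) _; rewrite invf_le1 ?ltr0Sn // ler1n.
(* A geometric factor for summability; the minimum makes w n small compared
   with tau N for all N <= n. *)
pose w n := (2 ^+ (n + 4))^-1 * running_min tau n.
have p0 n : 0 < (2 ^+ (n + 4))^-1 :> R by rewrite invr_gt0 exprn_gt0.
have w0 n : 0 < w n by rewrite mulr_gt0 // running_min_gt0.
have w_le N n : (N <= n)%N -> w n <= (2 ^+ (n + 4))^-1 * tau N.
  by move=> Nn; rewrite ler_pM2l // running_min_le.
have w_le' n : w n <= (2 ^+ (n + 4))^-1.
  by apply: le_trans (w_le n n (leqnn n)) _; rewrite ler_piMr ?(ltW (p0 n)).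
have sw0 n : 0 < s n * w n by rewrite mulr_gt0.
have [D hD] := choice (fun n => mckissick (c n) (rho0 n) (s0 n) (sw0 n)).
have [r hDr] := choice hD.
exists D, r, s, w, d, tau, c, rho.
have Dfar n k a z : a \in D n k -> K z -> s n <= modulus (a - z).
  have [h1 h2 _ _] := hDr n; move=> aD Kz; have [_ r0] := h1 k.
  have := h2 k a a aD; rewrite subrr modulus0 => /(_ (ltW r0)); rewrite ler_norml => /andP[k1 k2].
  have [_ _ /(_ z Kz)] := hs n.
  have k3 := ler_modulus_distD a z (c n); have k4 := ler_modulus_distD z a (c n).
  rewrite (modulusBC z a) in k3.
  by case: (leP 0 (modulus (z - c n) - rho n)) => h; [rewrite ger0_norm|rewrite ltr0_norm] => // h'; lra.
have data : cheese_data D r K s w d tau.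
  split=> //.
  - by move=> n k; have [/(_ k)[]] := hDr n.
  - by move=> n k; have [/(_ k)[]] := hDr n.
  - by move=> n A; have [_ _ h _] := hDr n; exact: h.
  - move=> A; have -> : 8^-1 = (2 ^+ 3)^-1 :> R by rewrite -natrX.
    by apply: le_trans (sum_pow2_le 3 A); apply: ler_sum => n _.
  - move=> N A; rewrite big_mkcond.
    have -> : tau N / 8 = (2 ^+ 3)^-1 * tau N by rewrite -natrX mulrC.
    apply: le_trans (ler_wpM2r (ltW (tau_gt0 N)) (sum_pow2_le 3 A)).
    rewrite mulr_suml; apply: ler_sum => n _; case: ifPn => [h|_].
      apply: w_le; rewrite leqNgt; apply/negP => /ltnW nN; move: h.
      by rewrite ltNge running_min_le.
    by rewrite mulr_ge0 ?(ltW (p0 n)) ?(ltW (tau_gt0 N)).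
  - move=> N L a u L1 u1 u2 far G; apply: ((htau0 N).2 L a u) => // v /G h.
    by apply: le_trans h _; rewrite ge_min lexx.
split=> //.
  apply: K_sub_swiss => //; first exact: Dfar.
  move=> n k; have [h1 _ h3 _] := hDr n; have [Dn r0] := h1 k.
  have rk j : 0 <= (size (D n j))%:R * r n j.
    by have [_ rj] := h1 j; rewrite mulr_ge0 // ltW.
  apply: (@le_trans _ _ (s n * w n)); last first.
    rewrite ler_piMr ?(ltW (s0 n)) //; apply: le_trans (w_le' n) _.
    by rewrite invf_le1 ?exprn_gt0 // exprn_ege1 // ler1n.
  apply: le_trans (h3 k.+1); rewrite big_ord_recr /=.
  apply: (@le_trans _ _ ((size (D n k))%:R * r n k)).
    by rewrite ler_peMl ?(ltW r0) // ler1n lt0n size_eq0.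
  by rewrite lerDr sumr_ge0 // => j _; exact: rk.
move=> n; have [_ _ _ h4] := hDr n; apply: h4 => z [_ hz] k a aD; exact: hz.
Qed.

End LevelData.

Section FatCantorStrip.
Variable R : realType.
Local Notation C := R[i].
Local Open Scope complex_scope.
Variables (F : set R) (K : set C).
Hypothesis hF : fat_cantor_set F.
Hypothesis hF2 : F `<=` `[- 2^-1, 2^-1].
Hypothesis hK : K = [set z | F (complex.Re z) /\ complex.Im z \in `[- 2^-1, 2^-1]%R].

Lemma strip_bounds z : K z -> [/\ -2^-1 <= complex.Re z, complex.Re z <= 2^-1,
  -2^-1 <= complex.Im z & complex.Im z <= 2^-1].
Proof.
by rewrite hK => -[/hF2]; rewrite /= !in_itv /= => /andP[? ?] /andP[? ?].
Qed.

Lemma strip_le1 z : K z -> modulus z <= 1.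
Proof.
move=> /strip_bounds[h1 h2 h3 h4]; apply: le_trans (modulus_le_ReIm _) _.
have : `|complex.Re z| <= 2^-1 by rewrite ler_norml h1.
have : `|complex.Im z| <= 2^-1 by rewrite ler_norml h3.
lra.
Qed.

Lemma closed_fat_cantor : closed F.
Proof. by have [cF _ _] := hF; apply: compact_closed => //; exact: Rhausdorff. Qed.

Lemma compact_strip : compact K.
Proof.
apply: (closed_bounded_compact (r := 1)); last exact: strip_le1.
have -> : K = (@complex.Re R @^-1` F) `&` (@complex.Im R @^-1` `[- 2^-1, 2^-1]%classic).
  by rewrite hK.
apply: closedI; apply: closed_comp.
- by move=> z _; exact: continuous_Re.
- exact: closed_fat_cantor.
- by move=> z _; exact: continuous_Im.
- exact: interval_closed.
Qed.

Lemma strip_neq0 : K !=set0.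
Proof.
have [_ _ F0] := hF; have [u Fu] : F !=set0.
  by apply/set0P/eqP => e; move: F0; rewrite e measure0 ltxx.
by exists (u +i* 0); rewrite hK /=; split=> //; rewrite in_itv /=; apply/andP; split; lra.
Qed.

(** A point off the strip is enclosed by a small circle.  Two points of different
abscissas are separated by a huge circle through a gap of the Cantor set, and a
point of the strip from a point above or below it by a huge circle through
the line in between. *)
Lemma strip_separated x y : modulus x <= 2 -> modulus y <= 2 -> y != x ->
  ~ (K x /\ K y /\ complex.Re x = complex.Re y) ->
  exists2 t, admissible K t & separates t x y.
Proof.
move=> x2 y2 yx H; have K2 z : K z -> modulus z <= 2 by move=> /strip_le1; lra.
have [Kx|nKx] := pselect (K x); last first.
  by apply: small_disc => //; exact: compact_closed (@norm_hausdorff _ _) compact_strip.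
have [_ nF _] := hF.
have FK z : K z -> F (complex.Re z) by rewrite hK => -[].
have [lt|lt|e] := ltgtP (complex.Re y) (complex.Re x).
- have [t1 [t2 [h1 h2 h3 h4]]] := nowhere_dense_gap closed_fat_cantor nF lt.
  by apply: (left_disc K2 x2 y2 h2 h1 h3) => z /FK /h4.
- have [t1 [t2 [h1 h2 h3 h4]]] := nowhere_dense_gap closed_fat_cantor nF lt.
  apply: (@right_disc _ K x y (- t2) (- t1)) => //; rewrite ?ltrN2 ?lerN2 //.
  by move=> z /FK /h4[]; rewrite !lerN2; [right|left].
have nKy : ~ K y by move=> Ky; apply: H.
have [k1 k2 k3 k4] := strip_bounds Kx.
have [lo|hi] : complex.Im y < - 2^-1 \/ 2^-1 < complex.Im y.
  have [h|h] := ltP (complex.Im y) (- 2^-1); [by left|right].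
  rewrite ltNge; apply/negP => h'; apply: nKy; rewrite hK /= e; split; first exact: FK.
  by rewrite in_itv /= h h'.
- apply: (@below_disc _ K x y (complex.Im y) (- 2^-1)) => //.
  by move=> z /strip_bounds[_ _ ? _]; right.
apply: (@above_disc _ K x y (- complex.Im y) (- 2^-1)) => //; rewrite ?ltrN2 ?lerN2 //.
by move=> z /strip_bounds[_ _ _ ?]; right; rewrite lerN2.
Qed.

Lemma trivial_of_negligible (X : set C) x (mu : probability (borelC R) R) :
  closed X -> mu X = 1%E -> mu.-negligible ((X `\ x) : set (borelC R)) -> trivial_measure x mu.
Proof.
move=> cX muX neg.
have mX : measurable (X : set (borelC R)) := closed_borelC cX.
have nX : mu.-negligible ((~` X) : set (borelC R)).
  apply/negligibleP; first exact: measurableC mX.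
  by have := probability_setC mu mX; rewrite muX subee.
have null (B : set (borelC R)) : measurable B -> ~ B x -> mu B = 0%E.
  move=> mB nBx; apply/negligibleP => //; apply: negligibleS (negligibleU neg nX) => z Bz.
  have [Xz|nXz] := pselect (X z); last by right.
  by left; split=> // zx; apply: nBx; rewrite -zx.
move=> A mA; rewrite diracE; have [Ax|nAx] := pselect (A x).
  rewrite mem_set //; have := probability_setC mu (measurableC mA).
  by rewrite setCK (null _ (measurableC mA)) ?sube0 //; apply.
by rewrite memNset // null.
Qed.

End FatCantorStrip.

Unset Implicit Arguments.

Theorem theorem4p7 (R : realType) (F : set R) (K : set R[i])
  (hF : fat_cantor_set F) (hF2 : F `<=` `[- 2^-1, 2^-1])
  (hK : K = [set z | F (complex.Re z) /\
                     complex.Im z \in `[- 2^-1, 2^-1]%R]) :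
  exists X : set R[i],
    [/\ swiss_cheese_set X,
        K `<=` X,
        forall x, (X `\` K) x -> point_of_continuity X x /\ R_point X x,
        forall x, K x -> non_R_point X x /\ point_of_discontinuity X x
      & no_nontrivial_Jensen_measures X].
Proof.
have cK := compact_strip hF hF2 hK; have K1 := strip_le1 hF2 hK.
have [D [r [s [w [d [tau [c [rho [cd KX sep fam]]]]]]]]] := exists_cheese_data cK K1.
set X := swiss D r in KX fam.
have X2 z : X z -> modulus z <= 2 by case.
have cX : closed X := @closed_swiss _ D r.
have separate x y : X x -> X y -> y != x ->
    ~ (K x /\ K y /\ complex.Re x = complex.Re y) ->
    exists n, modulus (x - c n) < rho n < modulus (y - c n).
  by move=> Xx Xy yx H; apply: sep; exact: (strip_separated hF hF2 hK (X2 x Xx) (X2 y Xy) yx H).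
have bump x y : X x -> X y -> y != x -> ~ (K x /\ K y /\ complex.Re x = complex.Re y) ->
    exists f, Jideal X y f /\ f x != 0.
  move=> Xx Xy yx H; have [n /andP[h1 h2]] := separate x y Xx Xy yx H.
  have [f [fX f0 f1]] := fam n; exists f; split; last exact: f1.
  split=> //; suff : nbhs y [set z | X z -> f z = 0] by [].
  apply/nbhs_modulusP; exists (modulus (y - c n) - rho n); first by rewrite subr_gt0.
  move=> z zy Xz; apply: f0 => //.
  by have := ler_modulus_distD z y (c n); rewrite (modulusBC y z); lra.
have unique f x t : K x -> Jideal X x f -> t \in `[- 2^-1, 2^-1] -> f (vert (complex.Re x) t) = 0.
  case: x => a t0 Kx [fX f0] tI.
  have [Fa Ia] : F a /\ t0 \in `[- 2^-1, 2^-1] by move: Kx; rewrite hK.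
  have aK v : v \in `[- 2^-1, 2^-1] -> K (vert a v) by move=> vI; rewrite hK.
  exact: (unique_on_segment cd aK Ia KX fX f0 tI).
have other x : K x -> exists y, [/\ K y, y != x & complex.Re y = complex.Re x].
  move=> Kx; have := Kx; rewrite hK => -[Fx Ix].
  have [h|h] := eqVneq (complex.Im x) 0.
    exists (complex.Re x +i* 2^-1)%C; split=> //.
      by rewrite /=; split=> //; rewrite in_itv /= lexx andbT; lra.
    by rewrite eq_complex /= h eqxx /= invr_eq0 pnatr_eq0.
  exists (complex.Re x +i* 0)%C; split=> //.
    by rewrite /=; split=> //; rewrite in_itv /=; apply/andP; split; lra.
  by rewrite eq_complex /= eqxx /= eq_sym.
exists X; split.
- apply: swiss_cheese_swiss; [by case: cd|by case: cd|].
  by have [z Kz] := strip_neq0 hF hK; exists z; exact: KX.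
- exact: KX.
- move=> x [Xx nKx]; split; split=> // y [Xy /eqP yx] sub.
    have [|f [fy fx]] := bump x y Xx Xy yx; first by case.
    by have [_ f0] := sub f fy; rewrite f0 eqxx in fx.
  have [||f [fy fx]] := bump y x Xy Xx; first by rewrite eq_sym.
    by case=> _ [].
  by have [_ f0] := sub f fy; rewrite f0 eqxx in fx.
- move=> x Kx; have [y [Ky yx Re_yx]] := other x Kx.
  have vE (z : R[i]) : vert (complex.Re z) (complex.Im z) = z by case: z.
  have Im_I z : K z -> complex.Im z \in `[- 2^-1, 2^-1] by rewrite hK => -[].
  have Xx := KX x Kx; have Xy := KX y Ky.
  split; split=> // -[_ H]; apply: (H y) => //; try (by split=> //; exact/eqP).
    move=> f fx; split; first by case: fx.
    by rewrite -(vE y) Re_yx; apply: (unique f x) => //; exact: Im_I.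
  move=> f fy; split; first by case: fy.
  by rewrite -(vE x) -Re_yx; apply: (unique f y) => //; exact: Im_I.
move=> x Xx mu jen; have muX : mu X = 1%E by case: jen => -[].
apply: (trivial_of_negligible cX muX).
pose N n : set R[i] := if modulus (x - c n) < rho n then X `&` [set z | rho n <= modulus (z - c n)] else set0.
have negN : mu.-negligible (\bigcup_n N n : set (borelC R)).
  apply: negligible_bigcup => n; rewrite /N; case: ifP => hx; last exact: negligible_set0.
  have [f [fX f0 f1]] := fam n.
  have mA : measurable (X `&` [set z | rho n <= modulus (z - c n)] : set (borelC R)).
    apply: measurableI; first exact: closed_borelC.
    rewrite (_ : [set z | _] = ~` open_disc (c n) (rho n)); last first.
      apply/seteqP; split=> z; rewrite /open_disc /= leNgt; first by move/negP.
      by move=> h; apply/negP.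
    by apply: measurableC; apply: open_borelC; exact: open_open_disc.
  apply/negligibleP => //; apply: (jensen_null_zero cX fX jen) => //; first exact: f1.
  by move=> z [Xz hz]; exact: f0.
have inN z : X z -> z != x -> ~ (K x /\ K z /\ complex.Re x = complex.Re z) -> (\bigcup_n N n) z.
  move=> Xz zx H; have [n /andP[h1 h2]] := separate x z Xx Xz zx H.
  by exists n => //; rewrite /N h1; split=> //=; exact: ltW.
have [Kx|nKx] := pselect (K x); last first.
  by apply: negligibleS negN => z [Xz /eqP zx]; apply: inN => //; case.
pose p : {poly R[i]} := 1 + (4^-1)%:P * ('X - x%:P) ^+ 2.
have pE z : p.[z] = 1 + 4^-1 * (z - x) ^+ 2 by rewrite /p !hornerE.
(* On the vertical line through x, (z - x) ^ 2 is a nonpositive real number. *)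
have line z : K z -> complex.Re x = complex.Re z ->
    modulus p.[z] = 1 - 4^-1 * (complex.Im z - complex.Im x) ^+ 2.
  move=> Kz e; have [_ _ x1 x2] := strip_bounds hF2 hK Kx; have [_ _ z1 z2] := strip_bounds hF2 hK Kz.
  have -> : p.[z] = (1 - 4^-1 * (complex.Im z - complex.Im x) ^+ 2)%:C%C.
    have sq : (z - x) ^+ 2 = (- (complex.Im z - complex.Im x) ^+ 2)%:C%C.
      case: (x) (z) e => [a u] [b v] /= ->; apply/eqP; rewrite eq_complex /=.
      by apply/andP; split; apply/eqP; ring.
    have q4 : 4^-1 = (4^-1)%:C%C :> R[i] by rewrite fmorphV rmorph_nat.
    by rewrite pE sq q4 -rmorphM -(rmorph1 (real_complex R)) -rmorphD mulrN.
  rewrite modulus_real ger0_norm //; nra.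
have peak : mu.-negligible ([set z | X z /\ modulus p.[z] < 1] : set (borelC R)).
  apply: (jensen_null_peak cX (RX_poly X p) jen) negN _.
    by rewrite pE subrr expr0n mulr0 addr0.
  move=> z Xz nNz; have [->|zx] := eqVneq z x.
    by rewrite pE subrr expr0n mulr0 addr0 modulus1.
  have [[_ [Kz e]]|H] := pselect (K x /\ K z /\ complex.Re x = complex.Re z); last first.
    by case: nNz; exact: inN.
  by rewrite line // gerBl mulr_ge0 // sqr_ge0.
apply: negligibleS (negligibleU negN peak) => z [Xz /eqP zx].
have [[_ [Kz e]]|H] := pselect (K x /\ K z /\ complex.Re x = complex.Re z); last by left; exact: inN.
right; split=> //; rewrite line // gtrBl mulr_gt0 // lt_neqAle sqr_ge0 andbT eq_sym sqrf_eq0 subr_eq0.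
by apply: contraNneq zx => e'; rewrite eq_complex e e' !eqxx.
Qed.
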